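(* Let $a\in\mathbb{Z}^d_+$ and let $\nu$ be a non-negative Borel measure on $\Lambda=(0,\infty)^d$ such that $$\int_\Lambda\Big\{1-\Big(\sum_{j=1}^d\frac{\Theta(\frac12;ia_j^2/\lambda_j)}{\Theta(0;ia_j^2/\lambda_j)}-(d-1)\Big)\prod_{j=1}^d\Theta(0;ia_j^2/\lambda_j)\Big\}\prod_{j=1}^d\lambda_j^{-1/2}\,d\nu(\lambda)<\infty.$$ Let $g:\mathbb{T}^d\to\mathbb{R}$ be a continuous periodic function such that $$\hat g(k)=\int_\Lambda\hat G_\lambda(k)\,d\nu(\lambda)$$ for all $k\in\mathbb{Z}^d$ such that $|k_j|\ge a_j$ for some $j\in\{1,\dots,d\}$. Then, if $P$ is a real trigonometric polynomial with degree less than $a$ that minorizes $g$, we have $$\int_{\mathbb{T}^d}\{g(x)-P(x)\}\,dx\ \ge\ \int_\Lambda\prod_{k=1}^d\lambda_k^{-1/2}\Big\{1-\prod_{j=1}^d\Theta(\tfrac12;ia_j^2/\lambda_j)\Big\}\,d\nu(\lambda).$$ Furthermore, there exists a family of trigonometric polynomial minorants $\{l_a(x):a\in\mathbb{Z}^d_+\}$ of $g$, with $l_a$ of degree less than $a$, such that $$\int_{\mathbb{T}^d}\{g(x)-l_a(x)\}\,dx=\int_\Lambda\Big\{1-\Big(\sum_{j=1}^d\frac{\Theta(\frac12;ia_j^2/\lambda_j)}{\Theta(0;ia_j^2/\lambda_j)}-(d-1)\Big)\prod_{j=1}^d\Theta(0;ia_j^2/\lambda_j)\Big\}\prod_{j=1}^d\lambda_j^{-1/2}\,d\nu(\lambda),$$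 and $$\lim_{a\uparrow\infty}\int_{\mathbb{T}^d}\{g(x)-l_a(x)\}\,dx=0,$$ where $a\uparrow\infty$ means $a_j\uparrow\infty$ for every $j$.
   Context: Notation: $\mathbb{T}^d=\mathbb{R}^d/\mathbb{Z}^d$; $\mathbb{Z}^d_+$ is the set of $a\in\mathbb{Z}^d$ with $a_j\ge1$ for all $j$. A trigonometric polynomial $P$ has degree less than $a$ if $P(x)=\sum_{-a<n<a}\hat P(n)e^{2\pi i n\cdot x}$, where $-a<n<a$ means $n\in\mathbb{Z}^d$ and $-a_j<n_j<a_j$ for all $j$. A function $P$ minorizes $g$ (is a minorant of $g$) if $P(x)\le g(x)$ for all $x\in\mathbb{T}^d$. For $\lambda\in(0,\infty)^d$, $G_\lambda(x)=\prod_{j=1}^d e^{-\lambda_j\pi x_j^2}$ on $\mathbb{R}^d$, with Fourier transform $\hat G_\lambda(\xi)=\int_{\mathbb{R}^d}e^{-2\pi i x\cdot\xi}G_\lambda(x)\,dx=\prod_{j=1}^d\lambda_j^{-1/2}e^{-\pi\xi_j^2/\lambda_j}$. For $g$ on $\mathbb{T}^d$, $\hat g(k)=\int_{\mathbb{T}^d}g(x)e^{-2\pi i k\cdot x}\,dx$. Jacobi's theta function is $\Theta(v;\tau)=\sum_{n\in\mathbb{Z}}e^{-2\pi i nv}e^{\pi i\tau n^2}$ for $\operatorname{Im}\tau>0$.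
   Formalization: The hypotheses are made for one fixed a; the equality for the integral of g − l_b is asserted for all b with b_j ≥ a_j for every j (so for a itself), since for other b it can fail (d=1, a=2, ν=0, g=cos 2πx, b=1). All l_b are still minorants of degree less than b. *)

(* Defs.v *)
From HB Require Import structures.
From mathcomp Require Import all_boot all_order all_algebra complex.
From mathcomp Require Import all_classical all_reals all_analysis.
Import Order.TTheory GRing.Theory Num.Theory.
Import numFieldNormedType.Exports.

Set Implicit Arguments.
Unset Strict Implicit.
Unset Printing Implicit Defensive.

Local Open Scope classical_set_scope.
Local Open Scope ring_scope.
Local Open Scope complex_scope.

Definition cexp (R : realType) (z : R[i]) : R[i] :=
  (expR (complex.Re z))%:C * (cos (complex.Im z) +i* sin (complex.Im z)).

(* Bilateral series, as the limit of the sums over -N <= n <= N; the limit is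
   taken on real and imaginary parts separately because R[i] has no canonical
   topology. *)
Definition int_series (R : realType) (f : int -> R[i]) : R[i] :=
  let S (N : nat) := \sum_(0 <= m < N.*2.+1) f (m%:Z - N%:Z) in
  limn (fun N => complex.Re (S N)) +i* limn (fun N => complex.Im (S N)).

Definition Theta (R : realType) (v tau : R[i]) : R[i] :=
  int_series (fun n : int =>
    cexp ((0 +i* (- (2 * pi * n%:~R))) * v) *
    cexp ((0 +i* (pi * n%:~R ^+ 2)) * tau)).

(* A point of R^d is a [d.-tuple R]; its sigma-algebra, generated by the
   coordinates, is the Borel one.  Functions on the torus are Z^d-periodic
   functions on R^d. *)
Definition Zperiodic (R : realType) (d : nat) (g : d.-tuple R -> R) : Prop :=
  forall (x : d.-tuple R) (n : d.-tuple int),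
    g [tuple tnth x j + (tnth n j)%:~R | j < d] = g x.

(* Tuples carry no topology in the library, so continuity is expressed on row
   vectors. *)
Definition tcontinuous (R : realType) (d : nat) (g : d.-tuple R -> R) : Prop :=
  continuous (fun v : 'rV[R]_d => g [tuple v ord0 j | j < d]).

(* [measurableTypeR R] is R with the Borel sigma-algebra, the carrier on which
   the library defines the uniform law. *)
Definition tuple_cons (R : realType) (n : nat)
    (x : measurableTypeR R * n.-tuple R) : n.+1.-tuple R :=
  [tuple of (x.1 : R) :: x.2].

Lemma measurable_tuple_cons (R : realType) (n : nat) :
  measurable_fun [set: measurableTypeR R * n.-tuple R] (@tuple_cons R n).
Proof.
by apply: measurable_cons; [exact: measurable_fst | exact: measurable_snd].
Qed.

HB.instance Definition _ (R : realType) (n : nat) :=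
  isMeasurableFun.Build _ _ _ _ (@tuple_cons R n) (@measurable_tuple_cons R n).

(* Lebesgue measure on the fundamental cube [0,1]^d of the torus. *)
Fixpoint torus (R : realType) (d : nat) : probability (d.-tuple R) R :=
  match d with
  | 0 => \d_([tuple])
  | n.+1 =>
      distribution (uniform_prob (@ltr01 R) \x torus R n)%E (@tuple_cons R n)
  end.

Definition cintegral (R : realType) (d : nat) (f : d.-tuple R -> R[i]) : R[i] :=
  (\int[torus R d]_x complex.Re (f x))%R +i*
  (\int[torus R d]_x complex.Im (f x))%R.

(* e^(2 pi i k . x) *)
Definition echar (R : realType) (d : nat) (k : d.-tuple int) (x : d.-tuple R) :
    R[i] :=
  cexp (0 +i* (2 * pi * \sum_(j < d) (tnth k j)%:~R * tnth x j)).

Definition fourier (R : realType) (d : nat) (g : d.-tuple R -> R)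
    (k : d.-tuple int) : R[i] :=
  cintegral (fun x => (g x)%:C * echar [tuple - tnth k j | j < d] x).

(* The (finite) set of frequencies n with -a < n < a. *)
Definition freq_box (d : nat) (a : d.-tuple int) : set (d.-tuple int) :=
  [set n | forall j : 'I_d, - tnth a j < tnth n j < tnth a j].

(* A real-valued trigonometric polynomial of degree less than a. *)
Definition trig_poly (R : realType) (d : nat) (a : d.-tuple int)
    (P : d.-tuple R -> R) : Prop :=
  forall x, (P x)%:C = \sum_(n \in freq_box a) fourier P n * echar n x.

Definition minorizes (R : realType) (d : nat) (P g : d.-tuple R -> R) : Prop :=
  forall x, P x <= g x.

Definition positive_index (d : nat) (a : d.-tuple int) : Prop :=
  forall j : 'I_d, 1 <= tnth a j.

Definition Lambda (R : realType) (d : nat) : set (d.-tuple R) :=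
  [set l | forall j : 'I_d, 0 < tnth l j].
Arguments Lambda : clear implicits.

Definition gauss_hat (R : realType) (d : nat) (l : d.-tuple R)
    (k : d.-tuple int) : R :=
  \prod_(j < d) (tnth l j `^ (- 2^-1) *
                 expR (- pi * (tnth k j)%:~R ^+ 2 / tnth l j)).

(* Theta(v; i a_j^2 / lambda_j), which is real for real v; only v = 0 and
   v = 1/2 are used. *)
Definition theta_at (R : realType) (d : nat) (a : d.-tuple int)
    (l : d.-tuple R) (v : R) (j : 'I_d) : R :=
  complex.Re (Theta v%:C (0 +i* ((tnth a j)%:~R ^+ 2 / tnth l j))).

Definition bound_density (R : realType) (d : nat) (a : d.-tuple int)
    (l : d.-tuple R) : R :=
  \prod_(k < d) (tnth l k `^ (- 2^-1)) *
  (1 - \prod_(j < d) theta_at a l 2^-1 j).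

Definition minorant_density (R : realType) (d : nat) (a : d.-tuple int)
    (l : d.-tuple R) : R :=
  (1 - (\sum_(j < d) (theta_at a l 2^-1 j / theta_at a l 0 j) - (d%:R - 1)) *
       \prod_(j < d) theta_at a l 0 j) *
  \prod_(j < d) (tnth l j `^ (- 2^-1)).

(* Main.v *)
(* The periodized Gaussian in one variable is a theta function; it is the limit
   of the finite Jacobi products p_M = prod_(n < M) (1 + q^(4n+2) +
   2 q^(2n+1) cos), whose coefficients are Gaussian binomials.  As polynomials
   in t = cos x they have nonnegative coefficients in powers of 1 + t, so their
   quotients by T_a - 1 and T_a + 1 are nonnegative on [-1, 1]: the remainders
   are a majorant m and a minorant l of degree less than a, interpolating p_M
   at the points of (1/a) Z and of (1/a) (Z + 1/2).  In several variables
   sum_j l_j prod_(i <> j) m_i - (d - 1) prod_j m_j is a minorant of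
   prod_j p_j, by a Weierstrass product inequality (Selberg's combination).

   The coefficients of the limiting difference F_lambda are bounded by its mean
   value, the integrable density of the theorem, so they can be integrated
   against nu; the polynomial l_a is chosen so that g - l_a has the resulting
   coefficients at every frequency.  Positivity of g - l_a follows by pairing
   it with product Fejer kernels, and the means tend to 0 by dominated
   convergence.  For the lower bound, g - P is paired with Fejer kernels dilated
   by a and translated by half a period, which annihilate every nonzero
   frequency of P; their limit is handled by Fatou's lemma. *)

Require Import Defs.
From mathcomp Require Import all_boot all_order all_algebra complex.
From mathcomp Require Import all_classical all_reals all_analysis.
From mathcomp Require Import measurable_realfun.
From mathcomp Require Import ring lra zify.
Import Order.TTheory GRing.Theory Num.Theory.
Import numFieldNormedType.Exports.

Set Implicit Arguments.
Unset Strict Implicit.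
Unset Printing Implicit Defensive.

Local Open Scope classical_set_scope.
Local Open Scope ring_scope.

(** * Chebyshev polynomials and the sign of quotients by T_N - 1 and T_N + 1 *)

Section Chebyshev.
Variable R : realType.
Implicit Types (x t : R) (p : {poly R}).

(** Finite products make the comparison with an interpolant a Euclidean division of polynomials,
    where the sign of the quotient is read off coefficients. Dividing p_M by its constant
    coefficient turns the k-th coefficient into q^(k^2) times a weight in [0, 1] that tends to 1, so
    the passage to the limit is dominated. The obstacle is positivity of a function known only
    through infinitely many coefficients. It is stated by duality: the coefficients are paired with
    an arbitrary nonnegative trigonometric polynomial. Each pairing is a finite sum, which commutes
    with the limit in M and with the integral against nu. The integrability hypothesis concerns the
    single index a. It reaches every b above a because the density decreases in each coordinate of
    the index; the same monotonicity reduces the limit over multi-indices to a diagonal sequence.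
    The delicate ingredient is the monotonicity of Theta(1/2; i t) in t, hidden in its alternating
    series but visible on the products at cos x = -1. *)

Fixpoint cheb (n : nat) : {poly R} :=
  match n with
  | 0 => 1
  | n1.+1 => match n1 with
             | 0 => 'X
             | n2.+1 => ('X * cheb n1) *+ 2 - cheb n2
             end
  end.

Lemma cheb0 : cheb 0 = 1. Proof. by []. Qed.

Lemma cheb1 : cheb 1 = 'X. Proof. by []. Qed.

Lemma chebSS n : cheb n.+2 = ('X * cheb n.+1) *+ 2 - cheb n.
Proof. by []. Qed.

Lemma mulX_cheb n : ('X * cheb n.+1) *+ 2 = cheb n.+2 + cheb n.
Proof. by rewrite chebSS subrK. Qed.

Lemma cheb_cos n x : (cheb n).[cos x] = cos (n%:R * x).
Proof.
elim/ltn_ind: n => -[|[|n]] IH.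
- by rewrite /= hornerC mul0r cos0.
- by rewrite /= hornerX mul1r.
rewrite chebSS hornerD hornerN hornerMn hornerM hornerX !IH //.
rewrite (_ : n.+2%:R * x = n.+1%:R * x + x); last first.
  by rewrite -[n.+2]addn1 natrD; ring.
rewrite (_ : n%:R * x = n.+1%:R * x - x); last first.
  by rewrite -[n.+1]addn1 natrD; ring.
by rewrite cosB cosD; ring.
Qed.

(** The numbers 1 / (k + 1) lie in [-1, 1], so they are cosines and give the difference more roots
    than its degree. Trigonometric identities thus become polynomial ones. *)
Lemma poly_eq_on_cos p1 p2 : (forall x, p1.[cos x] = p2.[cos x]) -> p1 = p2.
Proof.
move=> H; apply/eqP; rewrite -subr_eq0; apply/eqP.
set p := p1 - p2.
pose rs := [seq (k.+1%:R)^-1 : R | k <- iota 0 (size p)].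
apply: (@roots_geq_poly_eq0 _ p rs).
- apply/allP => _ /mapP [k _ ->].
  have k1 : (0 : R) < k.+1%:R by rewrite ltr0n.
  rewrite /root /p hornerD hornerN subr_eq0.
  have kb : -1 <= (k.+1%:R : R)^-1 <= 1.
    rewrite invf_le1 // ler1n /= andbT.
    by rewrite (le_trans _ (ltW (_ : 0 < _))) ?invr_gt0 // lerN10.
  by rewrite -(acosK kb) H.
- rewrite map_inj_uniq ?iota_uniq // => i j /invr_inj /eqP.
  by rewrite eqr_nat => /eqP [].
- by rewrite size_map size_iota.
Qed.

Lemma cheb_addB k m : cheb (k + m + m) + cheb k = (cheb (k + m) * cheb m) *+ 2.
Proof.
apply: poly_eq_on_cos => x.
rewrite hornerD hornerMn hornerM !cheb_cos !natrD.
have -> : (k%:R + m%:R + m%:R) * x = (k%:R + m%:R) * x + m%:R * x by ring.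
have -> : k%:R * x = (k%:R + m%:R) * x - m%:R * x by ring.
by rewrite cosB cosD; ring.
Qed.

Lemma size_lead_cheb n :
  size (cheb n) = n.+1 /\ lead_coef (cheb n.+1) = 2 ^+ n :> R.
Proof.
have H m : size (cheb m.+1) = m.+2 -> size (cheb m) = m.+1 ->
    size (cheb m.+2) = m.+3 /\
    lead_coef (cheb m.+2) = 2 * lead_coef (cheb m.+1) :> R.
  move=> s1 s0.
  have c0 : cheb m.+1 != 0 by rewrite -size_poly_gt0 s1.
  have E : ('X * cheb m.+1) *+ 2 = (2 : R) *: ('X * cheb m.+1).
    by rewrite scaler_nat.
  have sE : size ((2 : R) *: ('X * cheb m.+1)) = m.+3.
    by rewrite size_scale ?pnatr_eq0 // mulrC size_mulX // s1.
  have ltn : (size (- cheb m) < size ((2 : R) *: ('X * cheb m.+1)))%N.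
    by rewrite size_polyN sE s0.
  rewrite chebSS E; split; first by rewrite size_polyDl.
  by rewrite lead_coefDl // lead_coefZ mulrC lead_coefM lead_coefX mul1r mulrC.
have S m : size (cheb m) = m.+1 /\ size (cheb m.+1) = m.+2.
  elim: m => [|m [IH1 IH2]]; first by rewrite /= size_poly1 size_polyX.
  by split => //; case: (H m).
split; first by case: (S n).
elim: n => [|n IH]; first by rewrite /= lead_coefX.
by rewrite (proj2 (H n (S n).2 (S n).1)) IH exprS.
Qed.

Lemma size_cheb n : size (cheb n) = n.+1.
Proof. by case: (size_lead_cheb n). Qed.

Lemma lead_chebS n : lead_coef (cheb n.+1) = 2 ^+ n.
Proof. by case: (size_lead_cheb n). Qed.

Lemma sin_natM n x : sin x = 0 -> sin (n%:R * x) = 0.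
Proof.
move=> s0; elim: n => [|n IH]; first by rewrite mul0r sin0.
by rewrite -[n.+1]addn1 natrD mulrDl mul1r sinD IH s0 mul0r mulr0 addr0.
Qed.

Lemma sin_addpi_eq0 k x : (sin (x + pi *+ k) == 0) = (sin x == 0).
Proof.
elim: k => [|k IH]; first by rewrite mulr0n addr0.
by rewrite mulrSr addrA sinDpi oppr_eq0.
Qed.

Lemma cos_inj_nodes N (al : R) (i j : 'I_N) : 0 < al -> al < pi / N%:R ->
  cos (al + 2 * pi * i%:R / N%:R) = cos (al + 2 * pi * j%:R / N%:R) -> i = j.
Proof.
wlog lij : i j / (i <= j)%N.
  by move=> W a0 a1 E; case: (leqP i j) => [/W|/ltnW /W]; [exact|move=> ->].
move=> a0 a1 E; apply/val_inj/eqP => /=; apply: contraT => neij.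
have {neij}lij : (i < j)%N by rewrite ltn_neqAle neij.
have N0 : (0 : R) < N%:R by rewrite ltr0n; apply: leq_ltn_trans (ltn_ord i).
(* The difference of the two cosines is 2 sin u sin v. Neither sine vanishes: N u differs by a
   multiple of pi from N al, which lies in (0, pi), and 0 < v < pi. *)
pose u := al + pi * (i + j)%:R / N%:R.
pose v : R := pi * (j - i)%:R / N%:R.
have E1 : al + 2 * pi * i%:R / N%:R = u - v.
  by rewrite /u /v natrD natrB 1?ltnW //; field; rewrite gt_eqF.
have E2 : al + 2 * pi * j%:R / N%:R = u + v.
  by rewrite /u /v natrD natrB 1?ltnW //; field; rewrite gt_eqF.
have su : sin u != 0.
  apply/eqP => /(sin_natM N).
  have -> : N%:R * u = N%:R * al + pi *+ (i + j).
    by rewrite /u -mulr_natr; field; rewrite gt_eqF.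
  apply/eqP; rewrite sin_addpi_eq0 gt_eqF // sin_gt0_pi //.
  by rewrite mulr_gt0 //= mulrC -ltr_pdivlMr.
have v0 : 0 < v by rewrite divr_gt0 // mulr_gt0 ?pi_gt0 // ltr0n subn_gt0.
have v1 : v < pi.
  rewrite /v ltr_pdivrMr // ltr_pM2l ?pi_gt0 // ltr_nat.
  by rewrite (leq_ltn_trans (leq_subr _ _)).
have sv : sin v != 0 by rewrite gt_eqF // sin_gt0_pi // v0 v1.
move: E; rewrite E1 E2 cosB cosD => E.
have : sin u * sin v = 0 by lra.
by move/eqP; rewrite mulf_eq0 (negbTE su) (negbTE sv).
Qed.

Lemma cheb_factor_gen N (al : R) : 0 < al -> al < pi / N.+1%:R ->
  cheb N.+1 - (cos (N.+1%:R * al))%:P =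
  2 ^+ N *: \prod_(j < N.+1) ('X - (cos (al + 2 * pi * j%:R / N.+1%:R))%:P).
Proof.
move=> a0 a1.
pose rs := [seq cos (al + 2 * pi * (j : 'I_N.+1)%:R / N.+1%:R) | j <- enum 'I_N.+1].
have ltn : (size (- (cos (N.+1%:R * al))%:P : {poly R}) < size (cheb N.+1))%N.
  by rewrite size_polyN size_cheb size_polyC; case: (_ != 0).
rewrite [LHS](@all_roots_prod_XsubC _ _ rs).
- by rewrite lead_coefDl // lead_chebS big_map big_enum.
- by rewrite size_polyDl // size_cheb size_map size_enum_ord.
- apply/allP => _ /mapP [j _ ->]; rewrite /root hornerD hornerN hornerC cheb_cos.
  have -> : N.+1%:R * (al + 2 * pi * j%:R / N.+1%:R) = N.+1%:R * al + pi *+ 2 *+ j.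
    by rewrite -[_ *+ j]mulr_natr -mulr_natr; field; rewrite addrC natr1 pnatr_eq0.
  suff -> : forall k, cos (N.+1%:R * al + pi *+ 2 *+ k) = cos (N.+1%:R * al).
    by rewrite subrr.
  elim=> [|k IH]; first by rewrite mulr0n addr0.
  by rewrite [_ *+ k.+1]mulrSr addrA cosD2pi IH.
- rewrite uniq_rootsE map_inj_in_uniq ?enum_uniq // => i j _ _.
  exact: cos_inj_nodes a0 a1.
Qed.

(** At the endpoints 0 and pi / N.+1 roots may coincide in pairs. Approaching them from inside the
    interval, where roots are distinct, and passing to the limit in the values at cos x yields the
    factorization without counting multiplicities. *)
Lemma cheb_factor_closure N (be : R) (u : nat -> R) :
  (forall n, 0 < u n < pi / N.+1%:R) -> u @ \oo --> be ->
  cheb N.+1 - (cos (N.+1%:R * be))%:P =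
  2 ^+ N *: \prod_(j < N.+1) ('X - (cos (be + 2 * pi * j%:R / N.+1%:R))%:P).
Proof.
move=> ub ube; apply: poly_eq_on_cos => x.
rewrite hornerD hornerN hornerC hornerZ horner_prod.
have E n : (cheb N.+1).[cos x] - cos (N.+1%:R * u n) =
    2 ^+ N * \prod_(j < N.+1) (cos x - cos (u n + 2 * pi * j%:R / N.+1%:R)).
  case/andP: (ub n) => u0 u1.
  have := congr1 (fun p => p.[cos x]) (cheb_factor_gen u0 u1).
  rewrite hornerD hornerN hornerC hornerZ horner_prod => ->; congr (_ * _).
  by apply: eq_bigr => j _; rewrite hornerXsubC.
have cL : (fun n => (cheb N.+1).[cos x] - cos (N.+1%:R * u n)) @ \oo -->
    (cheb N.+1).[cos x] - cos (N.+1%:R * be).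
  apply: cvgB; first exact: cvg_cst.
  apply: continuous_cvg; first exact: continuous_cos.
  exact: cvgMr.
have cR : (fun n => 2 ^+ N * \prod_(j < N.+1)
      (cos x - cos (u n + 2 * pi * j%:R / N.+1%:R))) @ \oo -->
    2 ^+ N * \prod_(j < N.+1) (cos x - cos (be + 2 * pi * j%:R / N.+1%:R)).
  apply: cvgMr.
  have -> : (fun n => \prod_(j < N.+1)
      (cos x - cos (u n + 2 * pi * j%:R / N.+1%:R))) =
    \prod_(j < N.+1) (fun n => (cos x - cos (u n + 2 * pi * j%:R / N.+1%:R))).
    by apply/funext => n; rewrite fct_prodE.
  elim/big_ind2: _ => [|f1 l1 f2 l2 c1 c2|j _].
  - exact: cvg_cst.
  - exact: cvgM.
  - apply: cvgB; first exact: cvg_cst.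
    apply: continuous_cvg; first exact: continuous_cos.
    by apply: cvgD => //; exact: cvg_cst.
rewrite (funext E) in cL.
under eq_bigr do rewrite hornerXsubC.
exact: cvg_unique cL cR.
Qed.

Lemma cheb_factor N (eps : R) : eps = 1 \/ eps = -1 ->
  exists2 rs : seq R, all (fun r => -1 <= r) rs &
    size rs = N.+1 /\
    cheb N.+1 - eps%:P = 2 ^+ N *: \prod_(r <- rs) ('X - r%:P).
Proof.
move=> heps.
have [be [u [ub ube <-]]] : exists (be : R) (u : nat -> R),
    [/\ forall n, 0 < u n < pi / N.+1%:R, u @ \oo --> be & cos (N.+1%:R * be) = eps].
  pose c : R := pi / N.+1%:R.
  have c0 : 0 < c by rewrite divr_gt0 // pi_gt0.
  have hb n : 0 < c * n.+2%:R^-1 < c.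
    by rewrite mulr_gt0 //= gtr_pMr // invf_lt1 // ltr1n.
  have cv : (fun n => c * n.+2%:R^-1) @ \oo --> (0 : R).
    rewrite -[X in _ --> X](mulr0 c); apply: cvgMr.
    have := @cvg_harmonic R; rewrite -(cvg_shiftS (harmonic : nat -> R)).
    exact.
  case: heps => ->.
  - by exists 0, (fun n => c * n.+2%:R^-1); split => //; rewrite mulr0 cos0.
  - exists c, (fun n => c - c * n.+2%:R^-1); split.
    + by move=> n; have := hb n; rewrite -/c; case/andP => h1 h2; rewrite subr_gt0 h2 gtrBl h1.
    + by rewrite -[X in _ --> X]subr0; apply: cvgB => //; exact: cvg_cst.
    + by rewrite /c mulrC divfK ?pnatr_eq0 // cospi.
exists [seq cos (be + 2 * pi * (j : 'I_N.+1)%:R / N.+1%:R) | j <- enum 'I_N.+1].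
  by apply/allP => _ /mapP[j _ ->]; exact: cos_geN1.
rewrite size_map size_enum_ord; split => //.
by rewrite (cheb_factor_closure ub ube) big_map big_enum.
Qed.

Definition pnneg p := forall k, 0 <= p`_k.

Lemma pnnegC (c : R) : 0 <= c -> pnneg c%:P.
Proof. by move=> c0 k; rewrite coefC; case: eqP. Qed.

Lemma pnnegX : pnneg 'X.
Proof. by move=> k; rewrite coefX. Qed.

Lemma pnnegD p1 p2 : pnneg p1 -> pnneg p2 -> pnneg (p1 + p2).
Proof. by move=> h1 h2 k; rewrite coefD addr_ge0. Qed.

Lemma pnnegM p1 p2 : pnneg p1 -> pnneg p2 -> pnneg (p1 * p2).
Proof. by move=> h1 h2 k; rewrite coefM sumr_ge0 // => i _; rewrite mulr_ge0. Qed.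

Lemma pnneg_horner p (x : R) : pnneg p -> 0 <= x -> 0 <= p.[x].
Proof.
by move=> hp x0; rewrite horner_coef sumr_ge0 // => i _; rewrite mulr_ge0 ?exprn_ge0.
Qed.

(** Horner's scheme: the coefficients of the quotient arise from those of [p] by multiplying by [r]
    and adding, so none becomes negative. *)
Lemma pnneg_divXsubC p (r : R) : pnneg p -> 0 <= r ->
  exists2 Q, pnneg Q & p = Q * ('X - r%:P) + p.[r]%:P.
Proof.
move=> hp r0; elim/poly_ind: p hp => [|p c IH] hp.
  by exists 0; rewrite ?mul0r ?horner0 ?addr0 // => k; rewrite coef0.
have hc := hp; have hp' : pnneg p.
  move=> k; have := hc k.+1.
  by rewrite coefD coefMX coefC /= addr0.
have c0 : 0 <= c by have := hc 0%N; rewrite coefD coefMX coefC /= add0r.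
have [Q hQ E] := IH hp'.
have pr0 : 0 <= p.[r] by exact: pnneg_horner.
exists (Q * 'X + p.[r]%:P).
  by apply: pnnegD; [apply: pnnegM => //; exact: pnnegX | exact: pnnegC].
rewrite hornerD hornerMX hornerC {1}E polyCD polyCM; ring.
Qed.

Lemma pnneg_divprod p (rs : seq R) :
  pnneg p -> all (fun r => 0 <= r) rs ->
  exists Q H, [/\ pnneg Q, (size (H : {poly R}) <= size rs)%N &
    p = Q * \prod_(r <- rs) ('X - r%:P) + H].
Proof.
elim: rs p => [|r rs IH] p hp /=.
  by exists p, 0; rewrite big_nil size_poly0 mulr1 addr0.
case/andP => r0 /IH{}IH; have [Q hQ E] := pnneg_divXsubC hp r0.
have [Q2 [H [hQ2 sH E2]]] := IH _ hQ.
exists Q2, (H * ('X - r%:P) + p.[r]%:P); split => //.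
- rewrite (leq_trans (size_polyD _ _)) // geq_max (leq_trans (size_polyC_leq1 _)) // andbT.
  by rewrite (leq_trans (size_polyMleq _ _)) // size_XsubC addn2 /= ltnS.
- by rewrite {1}E {1}E2 big_cons; ring.
Qed.

(* [p] is expanded in powers of [1 + t] with nonnegative coefficients, and the
   nodes of [W] lie in [-1, +oo[, so synthetic division keeps the coefficients
   of the quotient nonnegative. *)
Lemma nneg_quotient N (eps : R) p (l S : {poly R}) t :
  eps = 1 \/ eps = -1 -> pnneg (p \Po ('X - 1)) ->
  (size l <= N.+1)%N -> p = S * (cheb N.+1 - eps%:P) + l -> -1 <= t ->
  0 <= S.[t].
Proof.
move=> heps hp sl E t1.
have [rs hrs [srs W]] := cheb_factor N heps.
have [|Q [H [hQ sH E2]]] := @pnneg_divprod _ (map (fun r => r + 1) rs) hp.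
  rewrite all_map; apply: sub_all hrs => r /=; lra.
have EW : \prod_(r <- map (fun r => r + 1) rs) ('X - r%:P) =
    (2 ^+ N)^-1 *: ((cheb N.+1 - eps%:P) \Po ('X - 1)).
  rewrite W comp_polyZ scalerA mulVf ?expf_neq0 ?pnatr_eq0 // scale1r.
  rewrite big_map rmorph_prod /=; apply: eq_bigr => r _.
  by rewrite comp_polyB comp_polyX comp_polyC polyCD; ring.
have sW : size ((cheb N.+1 - eps%:P) \Po ('X - 1)) = N.+2.
  rewrite size_comp_poly2 ?size_XsubC // size_polyDl ?size_cheb //.
  by rewrite size_polyN size_polyC; case: (_ != 0).
(* Uniqueness of division: a nonzero difference of quotients times a polynomial of degree [N.+1] has
   size above [N.+1], while the difference of the remainders does not. *)
have ES : S \Po ('X - 1) = (2 ^+ N)^-1 *: Q.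
  apply/eqP; rewrite -subr_eq0; apply: contraT => nz.
  have Z : (S \Po ('X - 1) - (2 ^+ N)^-1 *: Q) * ((cheb N.+1 - eps%:P) \Po ('X - 1))
      = H - (l \Po ('X - 1)).
    rewrite mulrBl -scalerAl.
    have := congr1 (fun P => P \Po ('X - 1)) E.
    rewrite comp_polyD comp_polyM E2 EW -scalerAr => E3.
    by apply: (addIr (l \Po ('X - 1))); rewrite addrAC -E3; ring.
  have : (size (H - (l \Po ('X - 1)))%R <= N.+1)%N.
    rewrite (leq_trans (size_polyD _ _)) // geq_max size_polyN.
    by rewrite size_comp_poly2 ?size_XsubC // sl andbT -srs -(size_map (fun r => r + 1) rs).
  rewrite -Z size_mul // -?size_poly_gt0 ?sW // addnS /=.
  by move: nz; rewrite -size_poly_gt0; case: (size _) => // m _; rewrite addSn ltnNge leq_addl.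
have -> : S.[t] = (S \Po ('X - 1)).[t + 1].
  by rewrite horner_comp !hornerE addrK.
rewrite ES hornerZ mulr_ge0 ?invr_ge0 ?exprn_ge0 //.
by apply: pnneg_horner => //; lra.
Qed.

End Chebyshev.

Arguments cheb : simpl never.

Lemma cvg_exprn (R : realType) (u : nat -> R) (l : R) k :
  u @ \oo --> l -> (fun n => u n ^+ k) @ \oo --> l ^+ k.
Proof.
move=> ul; elim: k => [|k IH].
  by under eq_fun do rewrite expr0; exact: cvg_cst.
by under eq_fun do rewrite exprS; rewrite exprS; exact: cvgM.
Qed.

(** * Finite Jacobi products and their coefficients *)

Section JacobiProduct.
Variable R : realType.
Implicit Types (q x t : R).

(** Weight of the frequency [k] when an even sum over all integers is folded onto [k >= 0]. *)
Definition ek (k : nat) : R := if k == 0%N then 1 else 2.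

Lemma ekS k : ek k.+1 = 2. Proof. by []. Qed.

(** Multiplication by [2 X] adds the two shifts of the coefficient sequence, reflected at 0 because
    the sequence is even; the last two terms correct the cut at [K]. *)
Lemma mulX_cheb_sum K (u : nat -> R) :
  (2 : R) *: ('X * \sum_(k < K.+1) (ek k * u k) *: cheb R k) =
  \sum_(k < K.+1) (ek k * (u (if k == 0%N :> nat then 1%N else k.-1) + u k.+1)) *: cheb R k
  + (2 * u K) *: cheb R K.+1 - (2 * u K.+1) *: cheb R K.
Proof.
elim: K => [|K IH].
  rewrite !big_ord_recr !big_ord0 /= !add0r /ek /= !mul1r cheb0 cheb1 -!mul_polyC !polyCM !polyCD.
  ring.
rewrite big_ord_recr /= [in RHS]big_ord_recr /= ekS mulrDr scalerDr IH.
have E := mulX_cheb R K.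
have -> : 2 *: ('X * ((2 * u K.+1) *: cheb R K.+1)) =
    (2 * u K.+1) *: (cheb R K.+2 + cheb R K).
  by rewrite -E -!mul_polyC !polyCM !polyCMn ?polyC1; ring.
by rewrite -!mul_polyC !polyCM !polyCD; ring.
Qed.

(* [jG q M k] is the Gaussian binomial coefficient [2M choose M + k] in base
   [q ^ 2], through the recursion in [M] that multiplying the finite Jacobi
   product by one more factor produces. *)
Fixpoint jG q (M k : nat) : R :=
  match M with
  | 0 => (k == 0%N)%:R
  | M1.+1 => (1 + q ^+ (4 * M1 + 2)) * jG q M1 k +
      q ^+ (2 * (M1.+1 - k)) * jG q M1 (if k == 0%N then 1%N else k.-1) +
      q ^+ (2 * (M1.+1 + k)) * jG q M1 k.+1
  end.

Lemma jG_gt q M k : (M < k)%N -> jG q M k = 0.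
Proof.
elim: M k => [|M IH] [|k] //= lt; rewrite !IH ?mulr0 ?addr0 //; lia.
Qed.

(** At [X = cos x] the factors are the squared moduli of 1 + q^(2n+1) e^(ix). *)
Definition jprod q M : {poly R} :=
  \prod_(n < M) ((1 + q ^+ (4 * n + 2))%:P + (2 * q ^+ (2 * n + 1)) *: 'X).

(** Finite form of the Jacobi triple product. The exponents in the recursion of [jG] are what
    remains once [q ^+ (k ^ 2)] is taken out, since (k + 1)^2 and (k - 1)^2 differ from k^2 by 1 +
    2k and 1 - 2k. *)
Lemma jprodE q M :
  jprod q M = \sum_(k < M.+1) (ek k * (q ^+ (k ^ 2) * jG q M k)) *: cheb R k.
Proof.
elim: M => [|M IH].
  by rewrite /jprod big_ord0 big_ord_recr big_ord0 /= cheb0 add0r /ek /= expr0 !mulr1 scale1r.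
rewrite /jprod big_ord_recr /= -/(jprod q M) IH.
pose u k := q ^+ (k ^ 2) * jG q M k.
have uM : u M.+1 = 0 by rewrite /u jG_gt // mulr0.
have uM2 : u M.+2 = 0 by rewrite /u jG_gt // mulr0.
have -> : \sum_(k < M.+1) (ek k * (q ^+ (k ^ 2) * jG q M k)) *: cheb R k =
    \sum_(k < M.+2) (ek k * u k) *: cheb R k.
  by rewrite [RHS]big_ord_recr /= uM mulr0 scale0r addr0.
rewrite mulrDr -scalerAr [_ * 'X]mulrC [_ * _%:P]mulrC [2 * _]mulrC -scalerA mulX_cheb_sum.
rewrite uM uM2 !mulr0 !scale0r subr0 addr0 mul_polyC !scaler_sumr -big_split /=.
apply: eq_bigr => -[k hk] _ /=; rewrite !scalerA -scalerDl; congr (_ *: _).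
rewrite mulrCA [q ^+ _ * (ek k * _)]mulrCA -mulrDr; congr (_ * _).
rewrite /u; case: k hk => [|k] hk.
  rewrite /= expr0 !mul1r mulrDr !mulrA -!exprD subn0 !addn0.
  have -> : (2 * M + 1 + 1 ^ 2 = 2 * M.+1)%N by lia.
  by rewrite addrA.
have alg (a c x y z d e g0 g1 g2 : R) : a * y = x * d -> a * z = x * e ->
    (1 + c) * (x * g1) + a * (y * g0 + z * g2) = x * ((1 + c) * g1 + d * g0 + e * g2).
  by move=> h1 h2; rewrite mulrDr !mulrA h1 h2; ring.
apply: alg; rewrite -!exprD; congr (_ ^+ _); rewrite /=; lia.
Qed.

(** The q-Pochhammer symbol (q^2; q^2)_n. *)
Definition qP q n : R := \prod_(i < n) (1 - q ^+ (2 * i.+1)).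

Lemma qPS q n : qP q n.+1 = qP q n * (1 - q ^+ (2 * n.+1)).
Proof. by rewrite /qP big_ord_recr. Qed.

(** The product formula for Gaussian binomials, cleared of denominators. Each term of the recursion
    becomes [qP q (2 * M)] times two elementary factors, which leaves a polynomial identity in q^2,
    q^(2(M-k)) and q^(2(M+k)). *)
Lemma jG_closed q M k : (k <= M)%N ->
  jG q M k * (qP q (M - k) * qP q (M + k)) = qP q (2 * M).
Proof.
elim: M k => [|M IH] k hk.
  have -> : k = 0%N by lia.
  by rewrite /= /qP !big_ord0 !mulr1.
have -> : (2 * M.+1 = (2 * M).+2)%N by lia.
rewrite (qPS q (2 * M).+1) (qPS q (2 * M)).
(* At the border, where the index of [jG] exceeds [M], the left side is zero and so is one of the
   factors on the right, of the form 1 - q^0. *)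
have T0 : jG q M k * (qP q (M.+1 - k) * qP q (M.+1 + k)) =
    qP q (2 * M) * ((1 - q ^+ (2 * (M.+1 - k))) * (1 - q ^+ (2 * (M.+1 + k)))).
  have [lek|gtk] := leqP k M.
    by rewrite subSn // addSn !qPS -(IH k lek); ring.
  have -> : k = M.+1 by lia.
  by rewrite jG_gt // subnn muln0 expr0 subrr !(mul0r, mulr0).
have T2 : jG q M k.+1 * (qP q (M.+1 - k) * qP q (M.+1 + k)) =
    qP q (2 * M) * ((1 - q ^+ (2 * (M.+1 - k))) * (1 - q ^+ (2 * (M - k)))).
  have [lek|gtk] := leqP k.+1 M.
    rewrite -(IH _ lek).
    have -> : (M.+1 - k = (M - k.+1).+2)%N by lia.
    have -> : (M - k = (M - k.+1).+1)%N by lia.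
    have -> : (M.+1 + k = M + k.+1)%N by lia.
    by rewrite !qPS; ring.
  rewrite jG_gt // mul0r; case: (ltnP M k) => h.
    have -> : (M.+1 - k = 0)%N by lia.
    by rewrite muln0 expr0 subrr mul0r mulr0.
  have -> : (M - k = 0)%N by lia.
  by rewrite muln0 expr0 subrr !mulr0.
have T1 : jG q M (if k == 0%N then 1%N else k.-1) * (qP q (M.+1 - k) * qP q (M.+1 + k)) =
    qP q (2 * M) * ((1 - q ^+ (2 * (M + k))) * (1 - q ^+ (2 * (M.+1 + k)))).
  case: k hk T0 T2 => [|k] hk T0 T2 /=; first by rewrite T2 subn0 !addn0 subn0; ring.
  rewrite -(IH k) //.
  have -> : (M.+1 - k.+1 = M - k)%N by lia.
  have -> : (M.+1 + k.+1 = (M + k).+2)%N by lia.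
  by rewrite !qPS addnS; ring.
have alg (A g d g1 e g2 P : R) :
    (A * g + d * g1 + e * g2) * P = A * (g * P) + d * (g1 * P) + e * (g2 * P) by ring.
rewrite [jG q M.+1 k]/= alg T0 T1 T2.
have E1 : q ^+ (2 * (M.+1 + k)) = q ^+ 2 * q ^+ (2 * (M + k)).
  by rewrite -exprD; congr (_ ^+ _); lia.
have [lek|gtk] := leqP k M; last first.
  have -> : k = M.+1 by lia.
  rewrite subnn muln0 expr0 subrr !(mul0r, mulr0) add0r addr0 mul1r -mulrA.
  by congr (_ * (_ * _)); congr (1 - q ^+ _); lia.
have E2 : q ^+ (2 * (M.+1 - k)) = q ^+ 2 * q ^+ (2 * (M - k)).
  by rewrite -exprD; congr (_ ^+ _); lia.
have E3 : q ^+ (2 * (2 * M).+1) = q ^+ 2 * (q ^+ (2 * (M - k)) * q ^+ (2 * (M + k))).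
  by rewrite -!exprD; congr (_ ^+ _); lia.
have E4 : q ^+ (2 * (2 * M).+2) =
    q ^+ 2 * q ^+ 2 * (q ^+ (2 * (M - k)) * q ^+ (2 * (M + k))).
  by rewrite -!exprD; congr (_ ^+ _); lia.
have E5 : q ^+ (4 * M + 2) = q ^+ 2 * (q ^+ (2 * (M - k)) * q ^+ (2 * (M + k))).
  by rewrite -!exprD; congr (_ ^+ _); lia.
rewrite E1 E2 E3 E4 E5; ring.
Qed.

Section Bounds.
Variable q : R.
Hypotheses (q0 : 0 < q) (q1 : q < 1).

Lemma qfactor i : 0 < 1 - q ^+ (2 * i.+1) <= 1.
Proof.
have h : 0 <= q ^+ (2 * i.+1) < 1 by rewrite exprn_ge0 ?(ltW q0) //= exprn_ilt1 ?(ltW q0).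
by lra.
Qed.

Lemma qP_gt0 n : 0 < qP q n.
Proof. by apply: prodr_gt0 => i _; case/andP: (qfactor i). Qed.

(** Division by the central binomial removes the constant of the triple product: [jG q M k] itself
    tends to 1 / (q^2; q^2)_oo, whereas these weights tend to 1. *)
Definition jb M k : R := jG q M k / jG q M 0.

Lemma jG_gt0 M k : (k <= M)%N -> 0 < jG q M k.
Proof.
move=> hk; have := qP_gt0 (2 * M); rewrite -(jG_closed q hk).
by rewrite pmulr_lgt0 // mulr_gt0 ?qP_gt0.
Qed.

Lemma qP_addn n k : qP q (n + k) = qP q n * \prod_(i < k) (1 - q ^+ (2 * (n + i).+1)).
Proof.
elim: k => [|k IH]; first by rewrite addn0 big_ord0 mulr1.
by rewrite addnS qPS IH big_ord_recr /= mulrA.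
Qed.

(** By the product formula the ratio is qP(M)^2 / (qP(M-k) qP(M+k)), that is [k] factors over [k]
    factors; the bounds on [jb] follow factor by factor. *)
Lemma jbE M k : (k <= M)%N ->
  jb M k * \prod_(i < k) (1 - q ^+ (2 * (M + i).+1)) =
  \prod_(i < k) (1 - q ^+ (2 * (M - k + i).+1)).
Proof.
move=> hk; rewrite /jb.
have H0 := jG_closed q (leq0n M); have Hk := jG_closed q hk.
rewrite subn0 addn0 -Hk qP_addn in H0.
have := qP_addn (M - k) k; rewrite subnK // => E.
have p1 := gt_eqF (qP_gt0 M); have p2 := gt_eqF (qP_gt0 (M - k)).
have g0 := gt_eqF (jG_gt0 (leq0n M)).
move: H0 E; set A := \prod_(i < k) _; set B := \prod_(i < k) _ => H0 E.
apply: (mulfI (negbT p1)); apply: (mulfI (negbT g0)); apply: (mulfI (negbT p2)).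
have -> : qP q (M - k) * (jG q M 0 * (qP q M * (jG q M k / jG q M 0 * A))) =
   jG q M k * (qP q (M - k) * (qP q M * A)) by field; rewrite g0.
by rewrite -H0 {2}E; ring.
Qed.

Lemma jb_ge0 M k : 0 <= jb M k.
Proof.
rewrite /jb; have [h|h] := leqP k M; last by rewrite jG_gt // mul0r.
by rewrite divr_ge0 // ltW // jG_gt0.
Qed.

Lemma jb_le1 M k : jb M k <= 1.
Proof.
have [h|h] := leqP k M; last by rewrite /jb jG_gt // mul0r ler01.
have P0 : 0 < \prod_(i < k) (1 - q ^+ (2 * (M + i).+1)).
  by apply: prodr_gt0 => i _; case/andP: (qfactor (M + i)).
rewrite -(ler_pM2r P0) jbE // mul1r; apply: ler_prod => i _.
case/andP: (qfactor (M - k + i)) => /ltW -> _ /=.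
rewrite lerB // ler_wiXn2l ?(ltW q0) ?(ltW q1) //; lia.
Qed.

Lemma jb_lower M k : (k <= M)%N -> (1 - q ^+ (2 * (M - k).+1)) ^+ k <= jb M k.
Proof.
move=> h.
have P0 : 0 <= \prod_(i < k) (1 - q ^+ (2 * (M + i).+1)) <= 1.
  rewrite prodr_ge0 /=; last by move=> i _; case/andP: (qfactor (M + i)) => /ltW.
  by apply: prodr_ile1 => i _; case/andP: (qfactor (M + i)) => /ltW -> ->.
apply: (@le_trans _ _ (jb M k * \prod_(i < k) (1 - q ^+ (2 * (M + i).+1)))).
  have -> : (1 - q ^+ (2 * (M - k).+1)) ^+ k = \prod_(i < k) (1 - q ^+ (2 * (M - k).+1)).
    by rewrite prodr_const card_ord.
  rewrite jbE //; apply: ler_prod => i _.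
  case/andP: (qfactor (M - k)) => /ltW -> _ /=.
  rewrite lerB // ler_wiXn2l ?(ltW q0) ?(ltW q1) //; lia.
by case/andP: P0 => _ P1; rewrite ler_piMr ?jb_ge0.
Qed.

Lemma cvg_jb k : (fun M => jb M k) @ \oo --> (1 : R).
Proof.
have cq : (fun M => q ^+ (2 * (M - k).+1)) @ \oo --> (0 : R).
  apply: (@squeeze_cvgr _ _ _ _ (cst 0) (fun M => q ^+ (M - k))).
  - near=> M; rewrite /= exprn_ge0 ?(ltW q0) //= ler_wiXn2l ?(ltW q0) ?(ltW q1) //; lia.
  - exact: cvg_cst.
  - rewrite -(cvg_shiftn k) /=; under eq_fun do rewrite addnK.
    by apply: cvg_expr; rewrite gtr0_norm.
apply: (@squeeze_cvgr _ _ _ _ (fun M => (1 - q ^+ (2 * (M - k).+1)) ^+ k) (cst 1)).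
- near=> M; rewrite /= jb_le1 andbT jb_lower //.
  by near: M; exists k.
- rewrite -[X in _ --> X](expr1n _ k).
  apply: cvg_exprn.
  rewrite -[X in _ --> X]subr0; apply: cvgB => //; exact: cvg_cst.
- exact: cvg_cst.
Unshelve. all: by end_near. Qed.

End Bounds.

(** The recursion has only nonnegative coefficients. At [k = 0] this controls the denominator of the
    normalized product at -1, whose numerator decreases by [horner_jprodN1_anti]. *)
Lemma jG_homo M k : {in Num.nneg &, {homo (fun q => jG q M k) : q1 q2 / q1 <= q2}}.
Proof.
move=> q1 q2; rewrite !nnegrE => h1 h2 h12.
have hX n : q1 ^+ n <= q2 ^+ n by rewrite lerXn2r.
have g0 : forall q M k, 0 <= q -> 0 <= jG q M k.
  move=> q N; elim: N => [|N IH] j hq /=; first by rewrite ler0n.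
  by rewrite !addr_ge0 // mulr_ge0 ?IH ?addr_ge0 ?exprn_ge0.
elim: M k => [|M IH] k //=.
by rewrite !lerD // ler_pM ?g0 ?addr_ge0 ?exprn_ge0 // lerD.
Qed.

Lemma horner_jprodN1 q M : (jprod q M).[-1] = \prod_(n < M) (1 - q ^+ (2 * n + 1)) ^+ 2.
Proof.
rewrite /jprod horner_prod; apply: eq_bigr => n _.
rewrite !hornerE.
have -> : (4 * n + 2 = (2 * n + 1) * 2)%N by lia.
by rewrite exprM; ring.
Qed.

Lemma horner_jprodN1_anti M q1 q2 : 0 <= q1 -> q1 <= q2 -> q2 <= 1 ->
  (jprod q2 M).[-1] <= (jprod q1 M).[-1].
Proof.
move=> h1 h12 h2; rewrite !horner_jprodN1; apply: ler_prod => n _.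
have q20 : 0 <= q2 by exact: le_trans h12.
have e2 : q2 ^+ (2 * n + 1) <= 1 by rewrite exprn_ile1.
have e12 : q1 ^+ (2 * n + 1) <= q2 ^+ (2 * n + 1) by rewrite lerXn2r.
by rewrite sqr_ge0 /= lerXn2r ?nnegrE; lra.
Qed.

Lemma jprod_gt0 q M t : 0 < q -> q < 1 -> -1 <= t -> 0 < (jprod q M).[t].
Proof.
move=> q0 q1 t1; rewrite /jprod horner_prod; apply: prodr_gt0 => n _.
rewrite !hornerE.
have -> : (4 * n + 2 = (2 * n + 1) * 2)%N by lia.
have : 0 < q ^+ (2 * n + 1) < 1 by rewrite exprn_gt0 //= exprn_ilt1 ?ltW //; lia.
rewrite exprM; move: (q ^+ _) => x /andP[x0 x1].
have -> : 1 + x ^+ 2 + 2 * x * t = (1 - x) ^+ 2 + 2 * (x * (1 + t)) by ring.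
by rewrite ltr_pwDl ?exprn_gt0 ?subr_gt0 // mulr_ge0 // mulr_ge0 ?(ltW x0) //; lra.
Qed.

Lemma pnneg_jprod q M : 0 < q -> q < 1 -> pnneg (jprod q M \Po ('X - 1)).
Proof.
move=> q0 q1; rewrite /jprod rmorph_prod /=.
elim/big_ind: _ => [|p1 p2|n _]; [exact: (@pnnegC R 1) | exact: pnnegM | ].
have -> : ((1 + q ^+ (4 * n + 2))%:P + (2 * q ^+ (2 * n + 1)) *: 'X) \Po ('X - 1) =
   ((1 - q ^+ (2 * n + 1)) ^+ 2)%:P + (2 * q ^+ (2 * n + 1))%:P * 'X.
  rewrite comp_polyD comp_polyC comp_polyZ comp_polyX -mul_polyC.
  have -> : (4 * n + 2 = (2 * n + 1) * 2)%N by lia.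
  rewrite exprM; move: (q ^+ (2 * n + 1)) => x.
  have -> : ((1 - x) ^+ 2)%:P = (1 + x ^+ 2)%:P - (2 * x)%:P.
    by rewrite -polyCB; congr (_%:P); ring.
  ring.
apply: pnnegD; first by apply: pnnegC; exact: sqr_ge0.
by apply: pnnegM; [apply: pnnegC; rewrite mulr_ge0 // exprn_ge0 // ltW | exact: pnnegX].
Qed.

End JacobiProduct.

(** * Limits of finite sums and products, dominated series *)

Lemma cvg_bigsum (R : realType) (I : Type) (r : seq I) (P : pred I)
    (f : I -> nat -> R) (l : I -> R) :
  (forall i, P i -> f i @ \oo --> l i) ->
  (fun n => \sum_(i <- r | P i) f i n) @ \oo --> \sum_(i <- r | P i) l i.
Proof.
move=> H; elim: r => [|i r IH].
  by under eq_fun do rewrite big_nil; rewrite big_nil; exact: cvg_cst.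
under eq_fun do rewrite big_cons; rewrite big_cons.
by case: ifP => // Pi; apply: cvgD => //; exact: H.
Qed.

Lemma cvg_bigprod (R : realType) (I : Type) (r : seq I) (P : pred I)
    (f : I -> nat -> R) (l : I -> R) :
  (forall i, P i -> f i @ \oo --> l i) ->
  (fun n => \prod_(i <- r | P i) f i n) @ \oo --> \prod_(i <- r | P i) l i.
Proof.
move=> H; elim: r => [|i r IH].
  by under eq_fun do rewrite big_nil; rewrite big_nil; exact: cvg_cst.
under eq_fun do rewrite big_cons; rewrite big_cons.
by case: ifP => // Pi; apply: cvgM => //; exact: H.
Qed.

Section Series.
Variable R : realType.
Implicit Types (u : nat -> R) (b : nat -> nat -> R).

Definition geom_bound u := exists C z : R, [/\ 0 < z, z < 1 & forall k, `|u k| <= C * z ^+ k].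

Lemma geom_bound_cvg_norm u : geom_bound u -> cvgn (series (fun k => `|u k|)).
Proof.
case=> C [z [z0 z1 H]].
apply: (@series_le_cvg _ _ (geometric C z)) => //.
- by move=> n; rewrite /geometric /= (le_trans _ (H n)).
- by apply: is_cvg_geometric_series; rewrite gtr0_norm.
Qed.

Lemma geom_bound_cvg u : geom_bound u -> cvgn (series u).
Proof. by move/geom_bound_cvg_norm; exact: normed_cvg. Qed.

(** Tannery's theorem: the tail beyond [K] is small uniformly in [M] because the weights [1 - b M k]
    stay in [0, 1], and the finitely many terms below [K] tend to 0. *)
Lemma cvg_weighted_series u b : geom_bound u ->
  (forall M k, 0 <= b M k <= 1) -> (forall k, (fun M => b M k) @ \oo --> (1 : R)) ->
  (fun M => \sum_(k < M.+1) b M k * u k) @ \oo --> limn (series u).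
Proof.
move=> gu b01 b1.
suff H : (fun M => \sum_(k < M.+1) (1 - b M k) * u k) @ \oo --> (0 : R).
  have E : (fun M => \sum_(k < M.+1) b M k * u k) =
      (fun M => series u M.+1 - \sum_(k < M.+1) (1 - b M k) * u k).
    apply/funext => M; rewrite /series /= big_mkord -sumrB.
    by apply: eq_bigr => k _; ring.
  rewrite E -[limn _]subr0; apply: cvgB H.
  rewrite (cvg_shiftS (series u)); exact: geom_bound_cvg.
apply/cvgr0Pnorm_lt => e e0.
have e2 : 0 < e / 2 by rewrite divr_gt0.
have /cauchy_cvgP/cauchy_seriesP := geom_bound_cvg_norm gu.
move=> /(_ _ e2) [[A B] [[K1 _ hA] [K2 _ hB]] hAB].
pose K := maxn K1 K2.
have hK n : (K <= n)%N -> \sum_(K <= k < n) `|u k| < e / 2.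
  move=> Kn; apply: le_lt_trans (hAB (K, n) _); first exact: ler_norm.
  by split => /=; [apply: hA | apply: hB]; rewrite /K /=; lia.
have c0 : (fun M => \sum_(k < K) (1 - b M k) * `|u k|) @ \oo --> (0 : R).
  rewrite [X in _ --> X](_ : _ = \sum_(k < K) (0 : R)); last by rewrite big1.
  apply: cvg_bigsum => k _; rewrite -[X in _ --> X](mul0r `|u k|).
  apply: cvgMl; rewrite -[X in _ --> X](subrr 1); apply: cvgB => //.
  exact: cvg_cst.
have /cvgr0Pnorm_lt/(_ _ e2) c1 := c0.
near=> M.
have KM : (K <= M.+1)%N by near: M; exists K => // n /= ?; lia.
rewrite -(big_mkord xpredT (fun k => (1 - b M k) * u k)).
rewrite (big_cat_nat (n := K)) //= (le_lt_trans (ler_normD _ _)) //.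
rewrite [ltRHS](splitr e) ltr_leD //.
  apply: le_lt_trans (_ : `|\sum_(k < K) (1 - b M k) * `|u k| | < _); last by near: M.
  rewrite big_mkord (le_trans (ler_norm_sum _ _ _)) // (le_trans _ (ler_norm _)) //.
  apply: ler_sum => k _; rewrite normrM ger0_norm // subr_ge0.
  by case/andP: (b01 M k).
apply: le_trans (ltW (hK _ KM)).
rewrite (le_trans (ler_norm_sum _ _ _)) //; apply: ler_sum => k _.
have /andP[h1 h2] := b01 M k.
by rewrite normrM ler_piMl // ger0_norm ?subr_ge0 // lerBlDr lerDl.
Unshelve. all: by end_near. Qed.

Lemma bernoulli_le (h : R) k : 0 <= h -> 1 + k%:R * h <= (1 + h) ^+ k.
Proof.
move=> h0; elim: k => [|k IH]; first by rewrite mul0r addr0 expr0.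
rewrite exprS (le_trans _ (ler_wpM2l _ IH)) ?addr_ge0 // -natr1.
rewrite [leRHS](_ : _ = 1 + (k%:R + 1) * h + h * (k%:R * h)); last by ring.
by rewrite lerDl mulr_ge0 // mulr_ge0.
Qed.

Lemma geom_bound_gauss (q : R) u : 0 < q -> q < 1 ->
  (forall k, `|u k| <= (k.+1.*2)%:R * q ^+ (k ^ 2)) -> geom_bound u.
Proof.
(* Any ratio strictly between [q] and 1 would do. As [z = q (1 + h)], Bernoulli's inequality gives
   [(1 + h^-1) (1 + h) ^+ k >= k + 1]; this absorbs the linear factor and explains the constant. *)
move=> q0 q1 H; pose z := (1 + q) / 2; pose h := z / q - 1.
have z0 : 0 < z by rewrite /z; lra.
have z1 : z < 1 by rewrite /z; lra.
have h0 : 0 < h by rewrite /h subr_gt0 ltr_pdivlMr // mul1r /z; lra.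
exists (2 * (1 + h^-1)), z; split => // k.
apply: le_trans (H k) _; rewrite -muln2 mulnC natrM -!mulrA ler_pM2l //.
have -> : z = q * (1 + h) by rewrite /h; field; rewrite gt_eqF.
rewrite exprMn mulrCA -ler_pdivrMl ?exprn_gt0 // mulrCA.
have B := bernoulli_le k (ltW h0).
apply: (@le_trans _ _ k.+1%:R).
  rewrite ler_piMr // -ler_pdivlMl ?invr_gt0 ?exprn_gt0 // invrK mulr1.
  by rewrite ler_wiXn2l ?(ltW q0) ?(ltW q1) //; case: k {B} => // k; lia.
apply: (@le_trans _ _ ((1 + h^-1) * (1 + k%:R * h))); last first.
  by rewrite ler_wpM2l // addr_ge0 // invr_ge0 ltW.
rewrite [leRHS](_ : _ = k.+1%:R + h^-1 + k%:R * h); last first.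
  by rewrite -natr1; field; rewrite gt_eqF.
by rewrite -addrA lerDl addr_ge0 ?invr_ge0 ?mulr_ge0 ?(ltW h0).
Qed.

End Series.

(** * Interpolating majorants and minorants in one variable *)

Section Interpolation.
Variable R : realType.
Implicit Types (q eps x : R).

(* Modulo [T_N - eps] with [eps = 1] or [-1], [T_(N m + r)] reduces to
   [eps ^ m ((m + 1) T_r - eps m T_(N - r))]; [rho eps N k] lists the
   coefficients of the reduction of [ek k T_k]. *)
Definition rho eps (N k r : nat) : R :=
  if r == 0%N then (if (k %% N == 0)%N then eps ^+ (k %/ N) * ek R k else 0)
  else if (r < N)%N then
    (k %% N == r)%N%:R * (eps ^+ (k %/ N) * (k %/ N).+1%:R) -
    (k %% N == N - r)%N%:R * (eps ^+ (k %/ N).+1 * (k %/ N)%:R)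
  else 0.

Lemma rho_ge eps N k r : (N <= r)%N -> (0 < N)%N -> rho eps N k r = 0.
Proof. by move=> h N0; rewrite /rho ltnNge h /=; case: eqP => //; lia. Qed.

Section Eps.
Variables (eps : R) (heps : eps = 1 \/ eps = -1).

Let eps2 : eps * eps = 1.
Proof. by case: heps => ->; rewrite ?mulrNN mulr1. Qed.

Lemma norm_epsX k : `|eps ^+ k| = 1.
Proof. by rewrite normrX; case: heps => ->; rewrite ?normrN normr1 expr1n. Qed.

(** The growth in [k] is linear, as [geom_bound_gauss] allows. *)
Lemma rho_bound N k r : `|rho eps N k r| <= (k.+1.*2)%:R.
Proof.
have kN : (k %/ N <= k)%N by exact: leq_div.
rewrite /rho; case: eqP => _.
  case: eqP => _; last by rewrite normr0.
  rewrite normrM norm_epsX mul1r /ek; case: eqP => _; rewrite ger0_norm //.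
    by rewrite ler1n; lia.
  by rewrite ler_nat; lia.
case: ifP => _; last by rewrite normr0.
rewrite (le_trans (ler_normB _ _)) //.
rewrite !normrM !norm_epsX !mul1r !normr_nat -!natrM -natrD ler_nat.
by case: eqP; case: eqP => _ _; lia.
Qed.

(** Modulo T_N - eps, the relation T_(k+2N) = 2 T_N T_(k+N) - T_k becomes a recursion with
    coefficients 2 eps and -1. Its characteristic polynomial has the double root eps, hence the
    factors linear in [m]. *)
Lemma cheb_reduce N m r : (r <= N)%N ->
  (cheb R N - eps%:P) %| (cheb R (N * m + r) -
    ((eps ^+ m * m.+1%:R)%:P * cheb R r - (eps ^+ m.+1 * m%:R)%:P * cheb R (N - r))).
Proof.
move=> rN.
suff H : (cheb R N - eps%:P) %| (cheb R (N * m + r) -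
    ((eps ^+ m * m.+1%:R)%:P * cheb R r - (eps ^+ m.+1 * m%:R)%:P * cheb R (N - r))) /\
  (cheb R N - eps%:P) %| (cheb R (N * m.+1 + r) -
    ((eps ^+ m.+1 * m.+2%:R)%:P * cheb R r - (eps ^+ m.+2 * m.+1%:R)%:P * cheb R (N - r))).
  by case: H.
elim: m => [|m [IH1 IH2]]; split => //.
- by rewrite muln0 mulr0 !mulr1 expr0 polyC1 mul0r mul1r subr0 subrr dvdp0.
- have E := cheb_addB R (N - r) r.
  rewrite subnK // in E.
  rewrite muln1 expr1 !mulr1 expr2 eps2 mul1r.
  have -> : cheb R (N + r) - ((eps * 2)%:P * cheb R r - cheb R (N - r)) =
     ((2 : R)%:P * cheb R r) * (cheb R N - eps%:P).
    rewrite opprB addrA E polyCM; ring.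
  by rewrite dvdp_mulIr.
- have E := cheb_addB R (N * m + r) N.
  have e1 : (N * m.+1 + r = N * m + r + N)%N by lia.
  have e2 : (N * m.+2 + r = N * m + r + N + N)%N by lia.
  have eE : eps ^+ m.+2 = eps ^+ m by rewrite !exprS mulrA eps2 mul1r.
  have eE3 : eps ^+ m.+3 = eps ^+ m.+1 by rewrite !exprS !mulrA eps2 mul1r.
  rewrite e1 in IH2; rewrite e2 (canRL (addrK _) E).
  set A := cheb R (N * m + r) in IH1 *; set B := cheb R (N * m + r + N) in IH2 *.
  have -> : (B * cheb R N) *+ 2 - A -
      ((eps ^+ m.+2 * m.+3%:R)%:P * cheb R r - (eps ^+ m.+3 * m.+2%:R)%:P * cheb R (N - r)) =
    ((2 : R)%:P * B) * (cheb R N - eps%:P) +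
    (2 * eps)%:P * (B - ((eps ^+ m.+1 * m.+2%:R)%:P * cheb R r - (eps ^+ m.+2 * m.+1%:R)%:P * cheb R (N - r))) -
    (A - ((eps ^+ m * m.+1%:R)%:P * cheb R r - (eps ^+ m.+1 * m%:R)%:P * cheb R (N - r))).
    have E1 : (eps ^+ m.+2 * m.+3%:R)%:P =
        (2 * eps)%:P * (eps ^+ m.+1 * m.+2%:R)%:P - (eps ^+ m * m.+1%:R)%:P :> {poly R}.
      rewrite -polyCM -polyCB; congr (_%:P).
      rewrite [2 * eps * _](_ : _ = 2 * m.+2%:R * (eps * eps ^+ m.+1)); last by ring.
      by rewrite -exprS eE -[m.+3]addn1 -[m.+2]addn1 -[m.+1]addn1 !natrD; ring.
    have E2 : (eps ^+ m.+3 * m.+2%:R)%:P =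
        (2 * eps)%:P * (eps ^+ m.+2 * m.+1%:R)%:P - (eps ^+ m.+1 * m%:R)%:P :> {poly R}.
      rewrite -polyCM -polyCB; congr (_%:P).
      rewrite [2 * eps * _](_ : _ = 2 * m.+1%:R * (eps * eps ^+ m.+2)); last by ring.
      by rewrite -exprS eE3 -[m.+2]addn1 -[m.+1]addn1 !natrD; ring.
    rewrite E1 E2 [(2 * eps)%:P]polyCM; ring.
  by rewrite dvdp_sub // dvdp_add ?dvdp_mulIr // dvdp_mull.
Qed.

Lemma delta_sum (V : lmodType R) N r0 (f : nat -> V) : (r0 < N)%N ->
  \sum_(r < N) (r0 == r)%N%:R *: f r = f r0.
Proof.
move=> h; rewrite (bigD1 (Ordinal h)) //= eqxx scale1r big1 ?addr0 // => i ne.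
case: eqP => [e|]; last by rewrite scale0r.
by case/eqP: ne; apply/val_inj.
Qed.

Lemma cheb_rho N k : (0 < N)%N ->
  (cheb R N - eps%:P) %|
    (ek R k *: cheb R k - \sum_(r < N) (ek R r * rho eps N k r) *: cheb R r).
Proof.
move=> N0; have rN : (k %% N < N)%N by rewrite ltn_mod.
have [r00|rn0] := eqVneq (k %% N)%N 0%N.
  have -> : \sum_(r < N) (ek R r * rho eps N k r) *: cheb R r =
      (eps ^+ (k %/ N) * ek R k)%:P.
    case: N N0 rN r00 => // N _ _ r00.
    rewrite big_ord_recl /= {1}/rho r00 eqxx /= big1 ?addr0.
      by rewrite /ek eqxx mul1r cheb0 alg_polyC.
    move=> i _; rewrite /rho /= r00; case: ifP => lt; last by rewrite mulr0 scale0r.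
    rewrite (_ : (0 == bump 0 i)%N = false) // (_ : (0 == N.+1 - bump 0 i)%N = false).
      by rewrite !mul0r subr0 mulr0 scale0r.
    by apply/eqP; move: lt; rewrite /bump; lia.
  (* For [r = 0] the reduction still contains [cheb R N], which is congruent to [eps]; replacing it
     collapses (m + 1) - m to 1. *)
  have := cheb_reduce (k %/ N) (leq0n N).
  set m := (k %/ N)%N; have -> : (N * m + 0 = k)%N.
    by have := divn_eq k N; rewrite r00 -/m mulnC => <-.
  rewrite cheb0 mulr1 subn0 => H.
  have -> : ek R k *: cheb R k - (eps ^+ m * ek R k)%:P = (ek R k)%:P *
     ((cheb R k - ((eps ^+ m * m.+1%:R)%:P - (eps ^+ m.+1 * m%:R)%:P * cheb R N)) -
      (eps ^+ m.+1 * m%:R)%:P * (cheb R N - eps%:P)).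
    have -> : (eps ^+ m * m.+1%:R)%:P = (eps ^+ m)%:P + (eps ^+ m.+1 * m%:R)%:P * eps%:P :> {poly R}.
      rewrite -polyCM -polyCD; congr (_%:P).
      rewrite exprS [RHS](_ : _ = eps ^+ m + (eps * eps) * (eps ^+ m * m%:R)); last by ring.
      by rewrite eps2 -natr1; ring.
    by rewrite -mul_polyC polyCM; ring.
  by rewrite dvdp_mull // dvdp_sub // dvdp_mull.
have k0 : k != 0%N by apply: contra rn0 => /eqP ->; rewrite mod0n.
set m := (k %/ N)%N; set r0 := (k %% N)%N in rN rn0 *.
have Nr : (N - r0 < N)%N by lia.
have -> : \sum_(r < N) (ek R r * rho eps N k r) *: cheb R r =
   2 *: ((eps ^+ m * m.+1%:R) *: cheb R r0 - (eps ^+ m.+1 * m%:R) *: cheb R (N - r0)).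
  rewrite -(delta_sum (fun r => (eps ^+ m * m.+1%:R) *: cheb R r) rN).
  rewrite -(delta_sum (fun r => (eps ^+ m.+1 * m%:R) *: cheb R r) Nr).
  rewrite -sumrB scaler_sumr; apply: eq_bigr => r _.
  rewrite !scalerA -scalerBl scalerA; congr (_ *: _).
  rewrite /rho -/m -/r0; have rlt := ltn_ord r.
  case: (nat_of_ord r =P 0%N) => [->|rn].
    rewrite (negbTE rn0) mulr0 mul0r (_ : (N - r0 == 0)%N = false) ?mul0r ?subr0 ?mulr0 //.
    by apply/eqP; lia.
  rewrite rlt {1}/ek; case: eqP => // _; congr (2 * (_ - _%:R * _)).
  by congr nat_of_bool; apply/eqP/eqP; lia.
rewrite /ek (negbTE k0) -scalerBr.
have := cheb_reduce m (ltnW rN).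
have -> : (N * m + r0 = k)%N by have := divn_eq k N; rewrite -/m -/r0 mulnC => <-.
rewrite -!mul_polyC => H; by rewrite dvdp_mull.
Qed.

Definition interp_coef q N M r : R :=
  \sum_(k < M.+1) jb q M k * (q ^+ (k ^ 2) * rho eps N k r).

Definition jpoly q M : {poly R} := (jG q M 0)^-1 *: jprod q M.

Lemma jpolyE q M :
  jpoly q M = \sum_(k < M.+1) (ek R k * (q ^+ (k ^ 2) * jb q M k)) *: cheb R k.
Proof.
rewrite /jpoly jprodE scaler_sumr; apply: eq_bigr => k _.
by rewrite scalerA /jb; congr (_ *: _); ring.
Qed.

(* The remainder of [jpoly q M] modulo [T_N - eps]: it interpolates [jpoly] at
   the nodes [cos x] with [cos (N x) = eps]. *)
Definition interp q N M : {poly R} :=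
  \sum_(r < N) (ek R r * interp_coef q N M r) *: cheb R r.

Lemma size_interp q N M : (size (interp q N M) <= N)%N.
Proof.
rewrite (leq_trans (size_sum _ _ _)) //; apply/bigmax_leqP => r _.
by rewrite (leq_trans (size_scale_leq _ _)) // size_cheb.
Qed.

(** The sign of the last factor decides the side: for [eps = 1] it is at most 0 and the interpolant
    is a majorant, for [eps = -1] it is at least 0 and the interpolant is a minorant. *)
Lemma jpoly_interp q N M x : 0 < q -> q < 1 ->
  exists2 s : R, 0 <= s &
    (jpoly q M).[cos x] = (interp q N.+1 M).[cos x] + s * (cos (N.+1%:R * x) - eps).
Proof.
move=> q0 q1.
have : (cheb R N.+1 - eps%:P) %| (jpoly q M - interp q N.+1 M).
  have -> : jpoly q M - interp q N.+1 M = \sum_(k < M.+1) (q ^+ (k ^ 2) * jb q M k)%:P *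
     (ek R k *: cheb R k - \sum_(r < N.+1) (ek R r * rho eps N.+1 k r) *: cheb R r).
    transitivity (jpoly q M - \sum_(k < M.+1) \sum_(r < N.+1)
        (ek R r * (jb q M k * (q ^+ (k ^ 2) * rho eps N.+1 k r))) *: cheb R r).
      congr (_ - _); rewrite exchange_big /interp; apply: eq_bigr => r _.
      by rewrite /interp_coef mulr_sumr scaler_suml.
    rewrite jpolyE -sumrB; apply: eq_bigr => k _.
    rewrite mulrBr mulr_sumr; congr (_ - _).
      by rewrite mul_polyC scalerA mulrC.
    by apply: eq_bigr => r _; rewrite mul_polyC scalerA; congr (_ *: _); ring.
  elim/big_ind: _ => [|p1 p2 h1 h2|k _]; first exact: dvdp0.
    exact: dvdp_add.
  by rewrite dvdp_mull // cheb_rho.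
case/dvdpP => S /(canRL (subrK _)) E.
exists S.[cos x]; last by rewrite E !hornerE cheb_cos addrC.
apply: nneg_quotient heps _ (size_interp q N.+1 M) E _; last exact: cos_geN1.
rewrite /jpoly comp_polyZ -mul_polyC; apply: pnnegM; last exact: pnneg_jprod.
by apply: pnnegC; rewrite invr_ge0 ltW // jG_gt0.
Qed.

Lemma geom_bound_rho q N r : 0 < q -> q < 1 ->
  geom_bound (fun k => q ^+ (k ^ 2) * rho eps N k r).
Proof.
move=> q0 q1; apply: (geom_bound_gauss q0 q1) => k.
rewrite normrM ger0_norm ?exprn_ge0 ?(ltW q0) // mulrC.
by rewrite ler_wpM2r ?exprn_ge0 ?(ltW q0) // rho_bound.
Qed.

(** Cosine coefficient of the limiting interpolant of the theta function. *)
Definition ext_coef q N r : R := limn (series (fun k => q ^+ (k ^ 2) * rho eps N k r)).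

Lemma cvg_interp_coef q N r : 0 < q -> q < 1 ->
  (fun M => interp_coef q N M r) @ \oo --> ext_coef q N r.
Proof.
move=> q0 q1; apply: cvg_weighted_series; first exact: geom_bound_rho.
- by move=> M k; rewrite jb_ge0 // jb_le1.
- by move=> k; exact: cvg_jb.
Qed.

Lemma ext_coef_ge q N r : (0 < N <= r)%N -> ext_coef q N r = 0.
Proof.
case/andP => N0 Nr; rewrite /ext_coef.
have -> : (fun k => q ^+ (k ^ 2) * rho eps N k r) = fun=> 0.
  by apply/funext => k; rewrite rho_ge // mulr0.
have -> : series (fun=> 0 : R) = fun=> 0.
  by apply/funext => n; rewrite /series /= big1.
exact: lim_cst.
Qed.

Lemma interp_coef_ge q N M r : (0 < N <= r)%N -> interp_coef q N M r = 0.
Proof.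
by case/andP => N0 Nr; rewrite /interp_coef big1 // => k _; rewrite rho_ge // !mulr0.
Qed.

(* [th 1 Q] and [th (-1) Q] are [Theta(0; i t)] and [Theta(1/2; i t)] for
   [Q = exp(- pi t)]. *)
Definition th q : R := limn (series (fun k => ek R k * (eps ^+ k * q ^+ (k ^ 2)))).

Lemma geom_bound_th q : 0 < q -> q < 1 ->
  geom_bound (fun k => ek R k * (eps ^+ k * q ^+ (k ^ 2))).
Proof.
move=> q0 q1; apply: (geom_bound_gauss q0 q1) => k.
rewrite mulrA normrM [X in _ * X]ger0_norm ?exprn_ge0 ?(ltW q0) //.
rewrite ler_wpM2r ?exprn_ge0 ?(ltW q0) // normrM norm_epsX mulr1 /ek.
case: eqP => _; rewrite ger0_norm //; first by rewrite ler1n; lia.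
by rewrite ler_nat; lia.
Qed.

Lemma cvg_th q : 0 < q -> q < 1 ->
  series (fun k => ek R k * (eps ^+ k * q ^+ (k ^ 2))) @ \oo --> th q.
Proof. by move=> q0 q1; apply: geom_bound_cvg; exact: geom_bound_th. Qed.

(** Only the multiples [k = N m] reach the constant coefficient, where q^(k^2) is (q^(N^2))^(m^2).
    The partial sums are read at the lengths [N * n], so that each block of [N] indices contains
    exactly one multiple. *)
Lemma ext_coef0 q N : 0 < q -> q < 1 -> (0 < N)%N ->
  ext_coef q N 0 = th (q ^+ (N ^ 2)).
Proof.
move=> q0 q1 N0.
have cv : series (fun k => q ^+ (k ^ 2) * rho eps N k 0) @ \oo --> ext_coef q N 0.
  by apply: geom_bound_cvg; exact: geom_bound_rho.
have cv2 : (fun n => series (fun k => q ^+ (k ^ 2) * rho eps N k 0) (N * n)%N) @ \oo -->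
    ext_coef q N 0.
  apply: (cvg_comp _ _ _ cv) => A [n0 _ hA]; exists n0 => // n /= hn.
  by apply: hA => /=; apply: leq_trans hn _; rewrite leq_pmull.
symmetry; apply: cvg_lim => //; apply: cvg_trans cv2.
apply: near_eq_cvg; near=> n; rewrite /series /= !big_mkord.
elim: (n) => [|m IH]; first by rewrite muln0 !big_ord0.
rewrite big_ord_recr /= -IH mulnS addnC big_split_ord /=; congr (_ + _).
case: (N) N0 => // N' _; rewrite big_ord_recl /= big1 => [|i _].
  rewrite addr0 addn0 /rho eqxx modnMr eqxx mulKn // mulrC.
  have -> : ek R (N'.+1 * m) = ek R m by rewrite /ek muln_eq0.
  by rewrite -exprM [(N'.+1 ^ 2 * _)%N](_ : _ = ((N'.+1 * m) ^ 2)%N) ?expnMn //; ring.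
rewrite /rho eqxx (_ : ((N'.+1 * m + bump 0 i) %% N'.+1 == 0)%N = false) ?mulr0 //.
rewrite mulnC modnMDl modn_small; first by [].
by rewrite /bump /=; have := ltn_ord i; lia.
Unshelve. all: by end_near. Qed.

Lemma th_near1 q : 0 < q -> q < 1 -> `|th q - 1| <= 2 * q / (1 - q).
Proof.
move=> q0 q1; have cv := cvg_th q0 q1.
have c1 : (fun n => `|series (fun k => ek R k * (eps ^+ k * q ^+ (k ^ 2))) n.+1 - 1|) @ \oo
    --> `|th q - 1|.
  apply: cvg_norm; apply: cvgB; last exact: cvg_cst.
  by rewrite (cvg_shiftS (series _)).
apply: (ler_cvg_to c1 (cvg_cst _)); near=> n.
rewrite /series /= big_mkord big_ord_recl /= /ek eqxx !mul1r addrAC subrr add0r.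
rewrite (le_trans (ler_norm_sum _ _ _)) //.
apply: (@le_trans _ _ (\sum_(i < n) 2 * q * q ^+ i)).
  apply: ler_sum => i _; rewrite /bump /= add1n normrM !normrM norm_epsX mul1r.
  rewrite ger0_norm // ger0_norm ?exprn_ge0 ?(ltW q0) // -mulrA ler_pM2l // -exprS.
  by rewrite ler_wiXn2l ?(ltW q0) ?(ltW q1) //; lia.
rewrite -mulr_sumr ler_pM2l ?mulr_gt0 // -[leRHS]div1r ler_pdivlMr ?subr_gt0 //.
rewrite mulrC -opprB mulNr -subrX1 opprB lerBlDr lerDl exprn_ge0 //.
exact: ltW.
Unshelve. all: by end_near. Qed.

End Eps.

(** The alternating series [th (-1) q] shows neither its sign nor its monotonicity in [q]; as a
    limit of normalized products at cos x = -1 it shows both. *)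
Lemma cvg_jprodN1 q : 0 < q -> q < 1 ->
  (fun M => (jprod q M).[-1] / jG q M 0) @ \oo --> th (-1) q.
Proof.
move=> q0 q1.
have hm : (-1 = 1 :> R) \/ (-1 = -1 :> R) by right.
have := cvg_weighted_series (geom_bound_th hm q0 q1)
  (fun M k => _ : 0 <= jb q M k <= 1) (cvg_jb q0 q1).
have H M k : 0 <= jb q M k <= 1 by rewrite jb_ge0 // jb_le1.
move=> /(_ H); apply: cvg_trans; apply: near_eq_cvg; near=> M.
have -> : (jprod q M).[-1] / jG q M 0 = (jpoly q M).[-1] by rewrite /jpoly hornerZ mulrC.
rewrite jpolyE horner_sum; apply: eq_bigr => k _.
rewrite hornerZ -cospi cheb_cos.
have -> : cos (k%:R * pi) = (-1) ^+ k :> R.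
  elim: (nat_of_ord k) => [|m IH]; first by rewrite mul0r cos0.
  by rewrite -natr1 mulrDl mul1r cosDpi IH exprS mulN1r.
by rewrite cospi; ring.
Unshelve. all: by end_near. Qed.

Lemma jG_ge1 q M : 0 <= q -> 1 <= jG q M 0.
Proof.
(* Comparison with [q = 0], where only the summand 1 of the recursion survives. *)
move=> q0; have := @jG_homo R M 0 0 q; rewrite !nnegrE => /(_ (lexx 0) q0 q0).
apply: le_trans; elim: M => [|M IH] //=.
rewrite (le_trans IH) // addn2 expr0n /= addr0 mul1r.
have -> : (2 * (M.+1 - 0) = (2 * M).+2)%N by lia.
have -> : (2 * (M.+1 + 0) = (2 * M).+2)%N by lia.
by rewrite !expr0n /= !mul0r !addr0.
Qed.

Lemma thN1_anti q1 q2 : 0 < q1 -> q1 <= q2 -> q2 < 1 -> th (-1) q2 <= th (-1) q1.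
Proof.
move=> h1 h12 h2; have q20 := lt_le_trans h1 h12; have q11 := le_lt_trans h12 h2.
apply: (ler_cvg_to (cvg_jprodN1 q20 h2) (cvg_jprodN1 h1 q11)); near=> M.
apply: ler_pM.
- by rewrite horner_jprodN1 prodr_ge0 // => i _; exact: sqr_ge0.
- by rewrite invr_ge0 (le_trans ler01) // jG_ge1 // ltW.
- by apply: horner_jprodN1_anti => //; exact: ltW.
- have g1 q : 0 < q -> 0 < jG q M 0 by move=> /ltW /(jG_ge1 M); exact: lt_le_trans.
  rewrite lef_pV2 ?posrE ?g1 //.
  by apply: jG_homo => //; rewrite nnegrE; exact: ltW.
Unshelve. all: by end_near. Qed.

Lemma thN1_itv q : 0 < q -> q < 1 -> 0 <= th (-1) q <= 1.
Proof.
move=> q0 q1; have cv := cvg_jprodN1 q0 q1; apply/andP; split.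
  apply: (ler_cvg_to (cvg_cst _) cv); near=> M.
  rewrite divr_ge0 //; last by rewrite (le_trans ler01) // jG_ge1 // ltW.
  by rewrite horner_jprodN1 prodr_ge0 // => i _; exact: sqr_ge0.
apply: (ler_cvg_to cv (cvg_cst _)); near=> M.
have g1 : 1 <= jG q M 0 by rewrite jG_ge1 // ltW.
rewrite ler_pdivrMr ?(lt_le_trans ltr01) // mul1r (le_trans _ g1) //.
rewrite horner_jprodN1; apply: prodr_ile1 => n _; rewrite sqr_ge0 /=.
have : 0 <= q ^+ (2 * n + 1) <= 1 by rewrite exprn_ge0 ?exprn_ile1 ?ltW.
case/andP => h1 h2; rewrite exprn_ile1 ?subr_ge0 //; lra.
Unshelve. all: by end_near. Qed.

Lemma th1_homo q1 q2 : 0 < q1 -> q1 <= q2 -> q2 < 1 -> th 1 q1 <= th 1 q2.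
Proof.
move=> h1 h12 h2; have q20 := lt_le_trans h1 h12; have q11 := le_lt_trans h12 h2.
have hp : (1 = 1 :> R) \/ (1 = -1 :> R) by left.
apply: (ler_cvg_to (cvg_th hp h1 q11) (cvg_th hp q20 h2)); near=> M.
apply: ler_sum => k _; rewrite !expr1n !mul1r ler_wpM2l //; first by rewrite /ek; case: eqP.
by rewrite lerXn2r // nnegrE ltW.
Unshelve. all: by end_near. Qed.

Lemma th1_ge1 q : 0 < q -> q < 1 -> 1 <= th 1 q.
Proof.
move=> q0 q1.
have hp : (1 = 1 :> R) \/ (1 = -1 :> R) by left.
have := cvg_th hp q0 q1; rewrite -(cvg_shiftS (series _)) => cv.
apply: (ler_cvg_to (cvg_cst _) cv); near=> M.
rewrite /series /= big_mkord big_ord_recl /= /ek eqxx !mul1r lerDl.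
by apply: sumr_ge0 => i _; rewrite !mulr_ge0 ?exprn_ge0 ?ltW.
Unshelve. all: by end_near. Qed.

End Interpolation.

(** * Integrals of bounded measurable functions on a probability space *)

Section BoundedMeasurable.
Context (disp : measure_display) (T : measurableType disp) (R : realType).
Variable P : probability T R.
Implicit Types (f g : T -> R).

(** A class closed under sums, products and scalars whose members are all integrable, so that
    linearity of the integral can be applied freely. *)
Definition bdm f := measurable_fun setT f /\ exists M, forall x, `|f x| <= M.

Lemma bdm_cst (c : R) : bdm (fun=> c).
Proof. by split; [exact: measurable_cst | exists `|c|]. Qed.

Lemma bdmD f g : bdm f -> bdm g -> bdm (fun x => f x + g x).
Proof.
move=> [mf [A hA]] [mg [B hB]]; split; first exact: measurable_funD.
by exists (A + B) => x; rewrite (le_trans (ler_normD _ _)) // lerD.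
Qed.

Lemma bdmM f g : bdm f -> bdm g -> bdm (fun x => f x * g x).
Proof.
move=> [mf [A hA]] [mg [B hB]]; split; first exact: measurable_funM.
by exists (A * B) => x; rewrite normrM ler_pM.
Qed.

Lemma bdmZ (c : R) f : bdm f -> bdm (fun x => c * f x).
Proof. by move=> hf; apply: bdmM => //; exact: bdm_cst. Qed.

Lemma bdmN f : bdm f -> bdm (fun x => - f x).
Proof. by move=> hf; under eq_fun do rewrite -mulN1r; exact: bdmZ. Qed.

Lemma bdmB f g : bdm f -> bdm g -> bdm (fun x => f x - g x).
Proof. by move=> hf hg; apply: bdmD => //; exact: bdmN. Qed.

Lemma bdm_sum (I : Type) (r : seq I) (F : I -> T -> R) :
  (forall i, bdm (F i)) -> bdm (fun x => \sum_(i <- r) F i x).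
Proof.
move=> H; elim: r => [|i r IH].
  by under eq_fun do rewrite big_nil; exact: bdm_cst.
by under eq_fun do rewrite big_cons; exact: bdmD.
Qed.

Lemma bdm_integrable f : bdm f -> P.-integrable setT (EFin \o f).
Proof.
move=> [mf [M hM]]; apply: measurable_bounded_integrable => //.
- by rewrite (le_lt_trans (probability_le1 _ _)) ?ltry.
- exists M; split; first exact: num_real.
  by move=> x Mx t _ /=; rewrite (le_trans (hM t)) // ltW.
Qed.

Lemma IntD f g : bdm f -> bdm g ->
  \int[P]_x (f x + g x) = \int[P]_x f x + \int[P]_x g x.
Proof. by move=> hf hg; rewrite RintegralD //; exact: bdm_integrable. Qed.

Lemma IntZ (c : R) f : bdm f -> \int[P]_x (c * f x) = c * \int[P]_x f x.
Proof. by move=> hf; rewrite RintegralZl //; exact: bdm_integrable. Qed.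

Lemma IntB f g : bdm f -> bdm g ->
  \int[P]_x (f x - g x) = \int[P]_x f x - \int[P]_x g x.
Proof. by move=> hf hg; rewrite RintegralB //; exact: bdm_integrable. Qed.

Lemma Int_cst (c : R) : \int[P]_x c = c.
Proof. rewrite Rintegral_cst // -[RHS]mulr1; congr (_ * _).
by rewrite -[RHS]/(fine 1%E) -(probability_setT P). Qed.

Lemma Int_sum (I : Type) (r : seq I) (F : I -> T -> R) :
  (forall i, bdm (F i)) ->
  \int[P]_x (\sum_(i <- r) F i x) = \sum_(i <- r) \int[P]_x F i x.
Proof.
move=> H; elim: r => [|i r IH].
  by under eq_Rintegral do rewrite big_nil; rewrite Int_cst big_nil.
under eq_Rintegral do rewrite big_cons; rewrite big_cons -IH IntD //.
exact: bdm_sum.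
Qed.

Lemma le_Int f g : bdm f -> bdm g -> (forall x, f x <= g x) ->
  \int[P]_x f x <= \int[P]_x g x.
Proof.
by move=> hf hg H; apply: le_Rintegral => //; exact: bdm_integrable.
Qed.

End BoundedMeasurable.

(** * Orthogonality of characters on the torus *)

Section Torus.
Variable R : realType.

Lemma sin_intpi (k : int) : sin (2 * pi * k%:~R) = 0 :> R.
Proof.
have H n : sin (2 * pi * n%:R) = 0 :> R.
  elim: n => [|n IH]; first by rewrite mulr0 sin0.
  rewrite -[n.+1%:R]natr1 mulrDr mulr1 [X in sin (_ + X)]mulr_natl.
  by rewrite sinD2pi.
case: k => n; first exact: H.
by rewrite NegzE mulrNz mulrN sinN -pmulrn H oppr0.
Qed.

Lemma cos_intpi (k : int) : cos (2 * pi * k%:~R) = 1 :> R.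
Proof.
have H n : cos (2 * pi * n%:R) = 1 :> R.
  elim: n => [|n IH]; first by rewrite mulr0 cos0.
  rewrite -[n.+1%:R]natr1 mulrDr mulr1 [X in cos (_ + X)]mulr_natl.
  by rewrite cosD2pi.
case: k => n; first exact: H.
by rewrite NegzE mulrNz mulrN cosN -pmulrn H.
Qed.

Local Notation U := (uniform_prob (@ltr01 R)).

Lemma int_uniform_FTC (f F : R -> R) : continuous f -> (forall x, 0 <= f x) ->
  (forall x : R, is_derive x (1 : R) F (f x)) -> \int[U]_x f x = F 1 - F 0.
Proof.
move=> cf f0 dF; rewrite /Rintegral integral_uniform //=; last first.
- by apply/measurable_EFinP; exact: continuous_measurable_fun.
have cF : continuous F.
  by move=> x; apply: differentiable_continuous; apply/derivable1_diffP; case: (dF x).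
rewrite subr0 invr1 mul1e (continuous_FTC2 (F := F)) //=.
- by apply: continuous_subspaceT.
- split.
  + by move=> x _; case: (dF x).
  + exact: cvg_at_right_filter (cF 0).
  + exact: cvg_at_left_filter (cF 1).
- by move=> x _; rewrite derive1E; apply: derive_val.
Qed.

Lemma bdm_cont1 (f : R -> R) (M : R) : continuous f -> (forall x, `|f x| <= M) ->
  bdm (f : measurableTypeR R -> R).
Proof.
by move=> cf hM; split; [exact: continuous_measurable_fun | exists M].
Qed.

Lemma continuous_coswx (w : R) : continuous (fun x => cos (w * x)).
Proof.
by move=> x; apply: continuous_comp; [exact: mulrl_continuous | exact: continuous_cos].
Qed.

Lemma continuous_sinwx (w : R) : continuous (fun x => sin (w * x)).
Proof.
by move=> x; apply: continuous_comp; [exact: mulrl_continuous | exact: continuous_sin].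
Qed.

Lemma bdm_coswx (w : R) : bdm (fun x : measurableTypeR R => cos (w * x)).
Proof. by apply: (@bdm_cont1 _ 1) => [|x]; [exact: continuous_coswx|exact: cos_max]. Qed.

Lemma bdm_sinwx (w : R) : bdm (fun x : measurableTypeR R => sin (w * x)).
Proof. by apply: (@bdm_cont1 _ 1) => [|x]; [exact: continuous_sinwx|exact: sin_max]. Qed.

Lemma is_derive_mulw (w x : R) : is_derive x (1 : R) (fun y => w * y) w.
Proof.
have H := @is_deriveZ _ _ _ id w x (1 : R) 1 (is_derive_id _ _).
by rewrite /GRing.scale /= mulr1 in H.
Qed.

Lemma is_derive_sinwx (w x : R) :
  is_derive x (1 : R) (fun y => sin (w * y)) (cos (w * x) * w).
Proof. exact: (is_derive1_comp (is_derive_sin (w * x)) (is_derive_mulw w x)). Qed.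

Lemma is_derive_coswx (w x : R) :
  is_derive x (1 : R) (fun y => cos (w * y)) (- sin (w * x) * w).
Proof. exact: (is_derive1_comp (is_derive_cos (w * x)) (is_derive_mulw w x)). Qed.

Lemma int_cos1 (k : int) : \int[U]_x cos (2 * pi * k%:~R * x) = (k == 0)%:R.
Proof.
have [->|k0] := eqVneq k 0.
  under eq_Rintegral do rewrite mulr0 mul0r cos0.
  by rewrite (Int_cst U).
set w := 2 * pi * k%:~R.
have w0 : w != 0 by rewrite !mulf_neq0 ?intr_eq0 // gt_eqF // pi_gt0.
(* Adding 1 makes the integrand nonnegative, as [int_uniform_FTC] demands; the mean of the constant
   is removed at the end. *)
have D (x : R) : is_derive x (1 : R) (fun x => x + w^-1 * sin (w * x)) (1 + cos (w * x)).
  have H := is_derive_sinwx w x.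
  have -> : 1 + cos (w * x) = 1 + w^-1 * (cos (w * x) * w) by field.
  by apply: is_deriveD; exact: is_deriveZ.
have E : \int[U]_x (1 + cos (w * x)) = 1.
  rewrite (int_uniform_FTC _ _ D).
  - by rewrite mulr1 mulr0 sin0 mulr0 addr0 /w sin_intpi mulr0 addr0 subr0.
  - move=> x; apply: continuousD; [exact: cvg_cst | exact: continuous_coswx].
  - by move=> x; have := cos_geN1 (w * x); lra.
move: E; rewrite (IntD U (bdm_cst _ 1) (bdm_coswx w)) Int_cst => E.
by apply: (addrI 1); rewrite E addr0.
Qed.

Lemma int_sin1 (k : int) : \int[U]_x sin (2 * pi * k%:~R * x) = 0.
Proof.
have [->|k0] := eqVneq k 0.
  under eq_Rintegral do rewrite mulr0 mul0r sin0.
  by rewrite (Int_cst U).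
set w := 2 * pi * k%:~R.
have w0 : w != 0 by rewrite !mulf_neq0 ?intr_eq0 // gt_eqF // pi_gt0.
have D (x : R) : is_derive x (1 : R) (fun x => x - w^-1 * cos (w * x)) (1 + sin (w * x)).
  have H := is_derive_coswx w x.
  have -> : 1 + sin (w * x) = 1 - w^-1 * (- sin (w * x) * w) by field.
  by apply: is_deriveB; exact: is_deriveZ.
have E : \int[U]_x (1 + sin (w * x)) = 1.
  rewrite (int_uniform_FTC _ _ D).
  - by rewrite mulr1 mulr0 cos0 /w cos_intpi; lra.
  - move=> x; apply: continuousD; [exact: cvg_cst | exact: continuous_sinwx].
  - by move=> x; have := sin_geN1 (w * x); lra.
move: E; rewrite (IntD U (bdm_cst _ 1) (bdm_sinwx w)) Int_cst; lra.
Qed.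

Definition phase d (n : d.-tuple int) (x : d.-tuple R) : R :=
  2 * pi * \sum_(j < d) (tnth n j)%:~R * tnth x j.

Lemma phase_cons d (k : int) (n : d.-tuple int) (t : R) (x : d.-tuple R) :
  phase [tuple of k :: n] [tuple of t :: x] = 2 * pi * k%:~R * t + phase n x.
Proof.
rewrite /phase big_ord_recl mulrDr mulrA !tnth0; congr (_ + _ * _).
by apply: eq_bigr => j _; rewrite !tnthS.
Qed.

Lemma measurable_phase d (n : d.-tuple int) : measurable_fun setT (phase n).
Proof.
apply: measurable_funM; first exact: measurable_cst.
apply: measurable_sum => j; apply: measurable_funM; first exact: measurable_cst.
exact: measurable_tnth.
Qed.

Lemma bdm_cosphase d (n : d.-tuple int) : bdm (fun x : d.-tuple R => cos (phase n x)).
Proof.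
split; last by exists 1 => x; exact: cos_max.
apply: (measurableT_comp _ (measurable_phase n)).
by apply: continuous_measurable_fun; exact: continuous_cos.
Qed.

Lemma bdm_sinphase d (n : d.-tuple int) : bdm (fun x : d.-tuple R => sin (phase n x)).
Proof.
split; last by exists 1 => x; exact: sin_max.
apply: (measurableT_comp _ (measurable_phase n)).
by apply: continuous_measurable_fun; exact: continuous_sin.
Qed.

Lemma int_torus_prod d (f : R -> R) (h : d.-tuple R -> R) (F : d.+1.-tuple R -> R) :
  bdm (f : measurableTypeR R -> R) -> bdm h -> bdm F ->
  (forall (t : R) (x : d.-tuple R), F [tuple of t :: x] = f t * h x) ->
  \int[torus R d.+1]_x F x = (\int[U]_t f t) * (\int[torus R d]_x h x).
Proof.
move=> bf bh [mF [M hM]] E.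
have bG : bdm (fun z : measurableTypeR R * d.-tuple R => F (tuple_cons z)).
  by split; [exact: measurableT_comp | exists M => z].
have iG := bdm_integrable (U \x torus R d)%E bG.
rewrite {1}/Rintegral /= integral_distribution //; last exact/measurable_EFinP.
rewrite -(integral12_prod_meas1 iG).
have -> : fubini_F (torus R d) (EFin \o (fun z : measurableTypeR R * d.-tuple R => F (tuple_cons z))) =
    (fun t => (f t * \int[torus R d]_x h x)%:E).
  apply/funext => t; rewrite /fubini_F /=.
  rewrite -(IntZ _ _ bh) /Rintegral fineK.
    by apply: eq_integral => x _; rewrite /tuple_cons /= E.
  apply: integrable_fin_num => //; apply: (bdm_integrable (torus R d)).
  exact: bdmZ.
rewrite mulrC -(IntZ _ _ bf) /Rintegral.
by congr fine; apply: eq_integral => t _; rewrite mulrC.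
Qed.

(** The addition formulas mix sine and cosine, so both integrals go through the same induction on
    the dimension. *)
Lemma int_trig d (n : d.-tuple int) :
  \int[torus R d]_x cos (phase n x) = (n == [tuple 0 | j < d])%:R /\
  \int[torus R d]_x sin (phase n x) = 0.
Proof.
elim: d n => [|d IH] n.
  have p0 x : phase n x = 0 by rewrite /phase big_ord0 mulr0.
  split; under eq_Rintegral do rewrite p0 ?cos0 ?sin0; rewrite Int_cst //.
  by rewrite (tuple0 n) (tuple0 [tuple _ | j < 0]) eqxx.
rewrite (tuple_eta n); set k := thead n; set m := behead_tuple n.
have [IHc IHs] := IH m.
pose n' := [tuple of k :: m].
have Ecos : \int[torus R d.+1]_x cos (phase n' x) =
    \int[U]_t cos (2 * pi * k%:~R * t) * \int[torus R d]_x cos (phase m x) -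
    \int[U]_t sin (2 * pi * k%:~R * t) * \int[torus R d]_x sin (phase m x).
  pose C (x : d.+1.-tuple R) := cos (2 * pi * k%:~R * thead x) * cos (phase m (behead_tuple x)).
  pose S (x : d.+1.-tuple R) := sin (2 * pi * k%:~R * thead x) * sin (phase m (behead_tuple x)).
  have mth : measurable_fun [set: d.+1.-tuple R] (fun x => thead x).
    exact: measurable_tnth.
  have mbe : measurable_fun [set: d.+1.-tuple R] (fun x => behead_tuple x).
    exact: measurable_behead.
  have bC : bdm C.
    split; last by exists 1 => x; rewrite normrM mulr_ile1 ?cos_max.
    apply: measurable_funM.
      exact: (measurableT_comp (bdm_coswx _).1 mth).
    exact: (measurableT_comp (bdm_cosphase _).1 mbe).
  have bS : bdm S.
    split; last by exists 1 => x; rewrite normrM mulr_ile1 ?sin_max.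
    apply: measurable_funM.
      exact: (measurableT_comp (bdm_sinwx _).1 mth).
    exact: (measurableT_comp (bdm_sinphase _).1 mbe).
  rewrite -(int_torus_prod (bdm_coswx _) (bdm_cosphase _) bC); last first.
    by move=> t x; rewrite /C theadE; congr (_ * cos (phase _ _)); apply/val_inj.
  rewrite -(int_torus_prod (bdm_sinwx _) (bdm_sinphase _) bS); last first.
    by move=> t x; rewrite /S theadE; congr (_ * sin (phase _ _)); apply/val_inj.
  rewrite -IntB //; apply: eq_Rintegral => x _.
  by rewrite {1}(tuple_eta x) phase_cons cosD.
have Esin : \int[torus R d.+1]_x sin (phase n' x) =
    \int[U]_t sin (2 * pi * k%:~R * t) * \int[torus R d]_x cos (phase m x) +
    \int[U]_t cos (2 * pi * k%:~R * t) * \int[torus R d]_x sin (phase m x).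
  pose C (x : d.+1.-tuple R) := sin (2 * pi * k%:~R * thead x) * cos (phase m (behead_tuple x)).
  pose S (x : d.+1.-tuple R) := cos (2 * pi * k%:~R * thead x) * sin (phase m (behead_tuple x)).
  have mth : measurable_fun [set: d.+1.-tuple R] (fun x => thead x).
    exact: measurable_tnth.
  have mbe : measurable_fun [set: d.+1.-tuple R] (fun x => behead_tuple x).
    exact: measurable_behead.
  have bC : bdm C.
    split; last by exists 1 => x; rewrite normrM mulr_ile1 ?cos_max ?sin_max.
    apply: measurable_funM.
      exact: (measurableT_comp (bdm_sinwx _).1 mth).
    exact: (measurableT_comp (bdm_cosphase _).1 mbe).
  have bS : bdm S.
    split; last by exists 1 => x; rewrite normrM mulr_ile1 ?sin_max ?cos_max.
    apply: measurable_funM.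
      exact: (measurableT_comp (bdm_coswx _).1 mth).
    exact: (measurableT_comp (bdm_sinphase _).1 mbe).
  rewrite -(int_torus_prod (bdm_sinwx _) (bdm_cosphase _) bC); last first.
    by move=> t x; rewrite /C theadE; congr (_ * cos (phase _ _)); apply/val_inj.
  rewrite -(int_torus_prod (bdm_coswx _) (bdm_sinphase _) bS); last first.
    by move=> t x; rewrite /S theadE; congr (_ * sin (phase _ _)); apply/val_inj.
  rewrite -IntD //; apply: eq_Rintegral => x _.
  by rewrite {1}(tuple_eta x) phase_cons sinD.
rewrite -/n' Ecos Esin IHc IHs int_cos1 int_sin1 !(mulr0, mul0r) subr0 addr0.
split => //; rewrite -natrM mulnb; congr (_%:R); congr nat_of_bool.
apply/andP/eqP => [[/eqP k0 /eqP m0]|E].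
  apply/eq_from_tnth => j; rewrite tnth_mktuple.
  case: (unliftP ord0 j) => [i ->|->]; last by rewrite tnth0.
  by rewrite tnthS m0 tnth_mktuple.
split; apply/eqP.
  by have := congr1 (fun u => tnth u ord0) E; rewrite tnth0 tnth_mktuple.
apply/eq_from_tnth => j; have := congr1 (fun u => tnth u (lift ord0 j)) E.
by rewrite tnthS !tnth_mktuple.
Qed.

End Torus.

(** * Cosine sums and Fejer kernels in one variable *)

Lemma sym_sum (V : zmodType) N (F : int -> V) :
  \sum_(i < N.*2.+1) F (i%:Z - N%:Z) = F 0 + \sum_(k < N) (F k.+1%:Z + F (- k.+1%:Z)).
Proof.
elim: N => [|N IH]; first by rewrite big_ord_recr !big_ord0 /= subr0 add0r addr0.
rewrite [RHS](_ : _ = (F 0 + \sum_(k < N) (F k.+1%:Z + F (- k.+1%:Z))) +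
    (F N.+1%:Z + F (- N.+1%:Z))); last by rewrite big_ord_recr addrA.
have -> : \sum_(i < N.+1.*2.+1) F (i%:Z - N.+1%:Z) =
    F (- N.+1%:Z) + (\sum_(i < N.*2.+1) F (i%:Z - N%:Z) + F N.+1%:Z).
  rewrite doubleS big_ord_recl big_ord_recr /=.
  congr (F _ + (_ + F _)); rewrite /bump /=; [lia | | lia].
  by apply: eq_bigr => i _; congr F; lia.
by rewrite -IH addrC -addrA.
Qed.

Lemma sum_multiples (V : zmodType) a n (g : nat -> V) : (0 < a)%N ->
  \sum_(k < a * n) (if (k %% a == 0)%N then g (k %/ a)%N else 0) = \sum_(m < n) g m.
Proof.
move=> a0; elim: n => [|n IH]; first by rewrite muln0 !big_ord0.
rewrite big_ord_recr /= -IH mulnS addnC big_split_ord /=; congr (_ + _).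
case: a a0 {IH} => // a _; rewrite big_ord_recl /= big1 => [|i _].
  by rewrite addr0 addn0 modnMr eqxx mulKn.
rewrite (_ : ((a.+1 * n + bump 0 i) %% a.+1 == 0)%N = false) //.
rewrite mulnC modnMDl modn_small; first by [].
by rewrite /bump /=; have := ltn_ord i; lia.
Qed.

Section Cosines.
Variable R : realType.

Definition cosum (K : nat) (c : nat -> R) (x : R) : R :=
  \sum_(k < K) ek R k * c k * cos (k%:R * x).

Lemma cosum_extend K K' c x : (K <= K')%N -> (forall k, (K <= k)%N -> c k = 0) ->
  cosum K' c x = cosum K c x.
Proof.
move=> h H; rewrite /cosum -(subnKC h) big_split_ord /= [X in _ + X]big1 ?addr0 //.
by move=> i _; rewrite H ?leq_addr // mulr0 mul0r.
Qed.

Definition fw (N k : nat) : R := if (k < N)%N then 1 - k%:R / N%:R else 0.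

(** The right side is the squared modulus of the sum of e^(ikx) over k < N, whence the nonnegativity
    of the kernel. In the induction the cross terms produce the cosines of (N - k) x. *)
Lemma fejer_sum N (x : R) :
  \sum_(k < N) ek R k * (N%:R - k%:R) * cos (k%:R * x) =
  (\sum_(k < N) cos (k%:R * x)) ^+ 2 + (\sum_(k < N) sin (k%:R * x)) ^+ 2.
Proof.
elim: N => [|N IH]; first by rewrite !big_ord0 expr0n addr0.
rewrite [in RHS]big_ord_recr [X in _ + X ^+ 2]big_ord_recr /=.
set C := \sum_(k < N) cos (k%:R * x) in IH *.
set S := \sum_(k < N) sin (k%:R * x) in IH *.
have -> : (C + cos (N%:R * x)) ^+ 2 + (S + sin (N%:R * x)) ^+ 2 =
    (C ^+ 2 + S ^+ 2) + (cos (N%:R * x) ^+ 2 + sin (N%:R * x) ^+ 2) +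
    2 * (C * cos (N%:R * x) + S * sin (N%:R * x)) by ring.
rewrite cos2Dsin2 -IH.
have -> : \sum_(k < N.+1) ek R k * (N.+1%:R - k%:R) * cos (k%:R * x) =
    \sum_(k < N.+1) ek R k * (N%:R - k%:R) * cos (k%:R * x) +
    \sum_(k < N.+1) ek R k * cos (k%:R * x).
  by rewrite -big_split /=; apply: eq_bigr => k _; rewrite -natr1; ring.
rewrite big_ord_recr /= subrr mulr0 mul0r addr0 -addrA; congr (_ + _).
rewrite big_ord_recl /= mul0r cos0 /ek eqxx mulr1; congr (_ + _).
rewrite /C /S !mulr_suml -big_split mulr_sumr (reindex_inj rev_ord_inj) /=.
apply: eq_bigr => i _; rewrite -cosB; congr (_ * _); rewrite -cosN; congr cos.
have -> : bump 0 (N - i.+1) = (N - i)%N by rewrite /bump; have := ltn_ord i; lia.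
by rewrite natrB ?(ltnW (ltn_ord i)) //; ring.
Qed.

Lemma fejer_ge0 N x : 0 <= cosum N (fw N) x.
Proof.
case: N => [|N]; first by rewrite /cosum big_ord0.
have N0 : (0 : R) < N.+1%:R by rewrite ltr0n.
rewrite -(pmulr_rge0 _ N0) /cosum mulr_sumr.
rewrite (_ : \sum_(i < _) _ = \sum_(k < N.+1) ek R k * (N.+1%:R - k%:R) * cos (k%:R * x)).
  by rewrite fejer_sum addr_ge0 // sqr_ge0.
apply: eq_bigr => k _; rewrite /fw ltn_ord; field.
by rewrite addrC natr1 pnatr_eq0.
Qed.

Lemma fw_ge N k : (N <= k)%N -> fw N k = 0.
Proof. by rewrite /fw ltnNge => ->. Qed.

Lemma fw0 N : (0 < N)%N -> fw N 0 = 1.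
Proof. by move=> N0; rewrite /fw N0 mul0r subr0. Qed.

Lemma fw_ge0 N k : 0 <= fw N k.
Proof.
rewrite /fw; case: ifP => // h; rewrite subr_ge0 ler_pdivrMr ?mul1r ?ler_nat ?(ltnW h) //.
by rewrite ltr0n; lia.
Qed.

Lemma fw_anti N k : fw N k.+1 <= fw N k.
Proof.
have := fw_ge0 N k; rewrite {2 3}/fw; case: ifP => h1; rewrite /fw.
  rewrite (ltnW h1) => _; rewrite lerB // ler_wpM2r ?invr_ge0 // ler_nat; lia.
by [].
Qed.

Lemma cvg_fw k : (fun N => fw N k) @ \oo --> (1 : R).
Proof.
have H : (fun N => 1 - k%:R * harmonic N) @ \oo --> (1 - k%:R * 0 : R).
  apply: cvgB; first exact: cvg_cst.
  by apply: cvgMr; exact: cvg_harmonic.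
rewrite mulr0 subr0 in H; rewrite -(cvg_shiftS (fun N => fw N k)).
apply: cvg_trans H; apply: near_eq_cvg; near=> N.
have kN : (k < N.+1)%N by near: N; exists k => // n /= ?; lia.
by rewrite /= /fw kN.
Unshelve. all: by end_near. Qed.

(* A Fejer kernel dilated by [a] and translated by half a period: nonnegative,
   with frequencies in [a Z] only. *)
Definition dilfw (a N k : nat) : R :=
  if (k %% a == 0)%N then (-1) ^+ (k %/ a) * fw N (k %/ a) else 0.

Lemma cos_natpi (m : nat) (x : R) : cos (x + m%:R * pi) = (-1) ^+ m * cos x.
Proof.
elim: m => [|m IH]; first by rewrite mul0r addr0 mul1r.
by rewrite -[m.+1%:R]natr1 mulrDl mul1r addrA cosDpi IH exprS mulN1r mulNr.
Qed.

Lemma dilfw_ge0 a N x : (0 < a)%N -> 0 <= cosum (a * N) (dilfw a N) x.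
Proof.
move=> a0; pose g m := ek R m * ((-1) ^+ m * fw N m) * cos (m%:R * (a%:R * x)).
rewrite /cosum (_ : \sum_(k < _) _ =
    \sum_(k < a * N) (if (k %% a == 0)%N then g (k %/ a)%N else 0)).
  rewrite sum_multiples // (_ : \sum_(m < _) _ = cosum N (fw N) (a%:R * x + pi)).
    exact: fejer_ge0.
  by apply: eq_bigr => m _; rewrite /g mulrDr cos_natpi; ring.
apply: eq_bigr => k _; rewrite /dilfw; case: ifP => [h|]; last by rewrite mulr0 mul0r.
have E : nat_of_ord k = (k %/ a * a)%N.
  by rewrite {1}(divn_eq k a) (eqP h) addn0.
rewrite /g -mulrA mulrA [in RHS]mulrA; congr (_ * _ * cos _).
  by rewrite /ek {1}E muln_eq0 [(a == 0)%N]eqn0Ngt a0 orbF.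
by rewrite {1}E natrM.
Qed.

Lemma dilfw0 a N : (0 < N)%N -> dilfw a N 0 = 1.
Proof. by move=> N0; rewrite /dilfw mod0n div0n eqxx fw0 // mulr1. Qed.

Lemma dilfw_ge a N k : (0 < a)%N -> (a * N <= k)%N -> dilfw a N k = 0.
Proof.
case: a => // a _ h.
by rewrite /dilfw fw_ge ?mulr0 ?if_same // leq_divRL // mulnC.
Qed.

Lemma dilfw_small a N k : (0 < k < a)%N -> dilfw a N k = 0.
Proof. by case/andP => k0 ka; rewrite /dilfw modn_small // (gtn_eqF k0). Qed.

End Cosines.

(** * Trigonometric sums over cubes of frequencies *)

Section Cube.
Variables (R : realType) (d : nat).
Implicit Types (n m : d.-tuple int) (x y : d.-tuple R) (N : nat).

(* [fr] enumerates the frequencies of the cube [-N, N]^d. *)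
Definition idx N := {ffun 'I_d -> 'I_N.*2.+1}.

Definition fr N (f : idx N) : d.-tuple int := [tuple (f j)%:Z - N%:Z | j < d].

Definition tneg n : d.-tuple int := [tuple - tnth n j | j < d].

Definition tadd n m : d.-tuple int := [tuple tnth n j + tnth m j | j < d].

Definition incube N n := [forall j : 'I_d, (`|tnth n j| <= N)%N].

Lemma tnegK : involutive tneg.
Proof. by move=> n; apply/eq_from_tnth => j; rewrite !tnth_mktuple opprK. Qed.

Lemma fr_inj N : injective (@fr N).
Proof.
move=> f g /eqP E; apply/ffunP => j; apply/val_inj.
have := congr1 (fun t => tnth t j) (eqP E); rewrite !tnth_mktuple /=.
by move/addIr => [].
Qed.

Lemma incube_fr N f : incube N (@fr N f).
Proof.
apply/forallP => j; by rewrite tnth_mktuple; have := ltn_ord (f j); lia.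
Qed.

Lemma fr_surj N n : incube N n -> exists f, @fr N f = n.
Proof.
move=> /forallP H.
have hb j : (`|(tnth n j + N%:Z)%R| < N.*2.+1)%N by have := H j; lia.
exists [ffun j => Ordinal (hb j)]; apply/eq_from_tnth => j.
by rewrite tnth_mktuple ffunE /=; have := H j; lia.
Qed.

Lemma incube_tneg N n : incube N (tneg n) = incube N n.
Proof. by apply: eq_forallb => j; rewrite tnth_mktuple abszN. Qed.

Lemma delta_fr N n (F : d.-tuple int -> R) :
  \sum_(f : idx N) (fr f == n)%:R * F (fr f) = (incube N n)%:R * F n.
Proof.
case: (boolP (incube N n)) => h; last first.
  rewrite mul0r big1 // => f _; case: eqP => [E|]; last by rewrite mul0r.
  by rewrite -E incube_fr in h.
have [f0 E0] := fr_surj h.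
rewrite (bigD1 f0) //= E0 eqxx big1 ?addr0 // => f ne.
case: eqP => [E|]; last by rewrite mul0r.
by rewrite -E in E0; rewrite (fr_inj E0) eqxx in ne.
Qed.

Lemma sum_fr_tneg N (F : d.-tuple int -> R) :
  \sum_(f : idx N) F (tneg (fr f)) = \sum_(f : idx N) F (fr f).
Proof.
pose ng (f : idx N) : idx N := [ffun j => rev_ord (f j)].
have ngK : involutive ng by move=> f; apply/ffunP => j; rewrite !ffunE rev_ordK.
rewrite [RHS](reindex_inj (inv_inj ngK)); apply: eq_bigr => f _; congr F.
apply/eq_from_tnth => j; rewrite !tnth_mktuple ffunE /=.
have hk : (nat_of_ord (f j) < N.*2.+1)%N by exact: ltn_ord.
by move: hk; move: (nat_of_ord (f j)) => k; lia.
Qed.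

Lemma phaseN n x : phase (tneg n) x = - phase n x.
Proof.
rewrite /phase -mulrN -sumrN; congr (_ * _); apply: eq_bigr => j _.
by rewrite tnth_mktuple mulrNz mulNr.
Qed.

Lemma phaseD n m x : phase (tadd n m) x = phase n x + phase m x.
Proof.
rewrite /phase -mulrDr -big_split; congr (_ * _); apply: eq_bigr => j _ /=.
by rewrite tnth_mktuple intrD mulrDl.
Qed.

Lemma tadd_eq0 n m : (tadd n m == [tuple 0 | j < d]) = (n == tneg m).
Proof.
apply/eqP/eqP => [E|->]; apply/eq_from_tnth => j; rewrite !tnth_mktuple ?addNr //.
have := congr1 (fun t => tnth t j) E; rewrite !tnth_mktuple.
by move/eqP; rewrite addr_eq0 => /eqP.
Qed.

Local Notation T := (torus R d).

Lemma int_coscos n m : \int[T]_x (cos (phase n x) * cos (phase m x)) =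
  ((n == m)%:R + (n == tneg m)%:R) / 2.
Proof.
have E x : cos (phase n x) * cos (phase m x) =
    2^-1 * (cos (phase (tadd n (tneg m)) x) + cos (phase (tadd n m) x)).
  by rewrite !phaseD phaseN cosB cosD; field.
under eq_Rintegral do rewrite E.
rewrite IntZ ?IntD //; try (apply: bdmD; exact: bdm_cosphase); try exact: bdm_cosphase.
by rewrite !(int_trig _ _).1 !tadd_eq0 tnegK mulrC.
Qed.

Lemma int_sinsin n m : \int[T]_x (sin (phase n x) * sin (phase m x)) =
  ((n == m)%:R - (n == tneg m)%:R) / 2.
Proof.
have E x : sin (phase n x) * sin (phase m x) =
    2^-1 * (cos (phase (tadd n (tneg m)) x) - cos (phase (tadd n m) x)).
  by rewrite !phaseD phaseN cosB cosD; field.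
under eq_Rintegral do rewrite E.
rewrite IntZ ?IntB //; try (apply: bdmB; exact: bdm_cosphase); try exact: bdm_cosphase.
by rewrite !(int_trig _ _).1 !tadd_eq0 tnegK mulrC.
Qed.

Lemma int_sincos n m : \int[T]_x (sin (phase n x) * cos (phase m x)) = 0.
Proof.
have E x : sin (phase n x) * cos (phase m x) =
    2^-1 * (sin (phase (tadd n m) x) + sin (phase (tadd n (tneg m)) x)).
  by rewrite !phaseD phaseN sinD sinB; field.
under eq_Rintegral do rewrite E.
rewrite IntZ ?IntD //; try (apply: bdmD; exact: bdm_sinphase); try exact: bdm_sinphase.
by rewrite !(int_trig _ _).2 addr0 mulr0.
Qed.

(** Both [n] and [tneg n] occur in the cube. For [A] even and [B] odd their contributions coincide,
    so that [A n] and [B n] are exactly the cosine and sine integrals of the sum, at [n = 0] as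
    well. *)
Definition tsum N (A B : d.-tuple int -> R) x : R :=
  \sum_(f : idx N) (A (fr f) * cos (phase (fr f) x) + B (fr f) * sin (phase (fr f) x)).

Lemma bdm_tterm (a b : R) n : bdm (fun x => a * cos (phase n x) + b * sin (phase n x)).
Proof.
by apply: bdmD; apply: bdmZ; [exact: bdm_cosphase | exact: bdm_sinphase].
Qed.

Lemma bdm_tsum N A B : bdm (tsum N A B).
Proof. by apply: bdm_sum => f; exact: bdm_tterm. Qed.

Lemma int_mul_tsum N A B (h : d.-tuple R -> R) : bdm h ->
  \int[T]_x (h x * tsum N A B x) =
  \sum_(f : idx N) (A (fr f) * \int[T]_x (h x * cos (phase (fr f) x)) +
                    B (fr f) * \int[T]_x (h x * sin (phase (fr f) x))).
Proof.
move=> bh; under eq_Rintegral do rewrite /tsum mulr_sumr.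
rewrite Int_sum => [|f]; last by apply: bdmM => //; exact: bdm_tterm.
apply: eq_bigr => f _.
have E x : h x * (A (fr f) * cos (phase (fr f) x) + B (fr f) * sin (phase (fr f) x)) =
    A (fr f) * (h x * cos (phase (fr f) x)) + B (fr f) * (h x * sin (phase (fr f) x)).
  by ring.
under eq_Rintegral do rewrite E.
have bc := bdmM bh (bdm_cosphase R (fr f)); have bs := bdmM bh (bdm_sinphase R (fr f)).
by rewrite IntD ?IntZ //; exact: bdmZ.
Qed.

Lemma int_tsum_cos N A B n : (forall m, A (tneg m) = A m) ->
  \int[T]_x (tsum N A B x * cos (phase n x)) = (incube N n)%:R * A n.
Proof.
move=> hA; under eq_Rintegral do rewrite mulrC.
rewrite int_mul_tsum; last exact: bdm_cosphase.
have E f : A (@fr N f) * \int[T]_x (cos (phase n x) * cos (phase (fr f) x)) +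
    B (fr f) * \int[T]_x (cos (phase n x) * sin (phase (fr f) x)) =
    2^-1 * ((fr f == n)%:R * A (fr f)) + 2^-1 * ((fr f == tneg n)%:R * A (fr f)).
  under [in X in _ + _ * X]eq_Rintegral do rewrite mulrC.
  rewrite int_coscos int_sincos mulr0 addr0 [n == _]eq_sym.
  have -> : (n == tneg (fr f)) = (fr f == tneg n).
    by apply/eqP/eqP => [->|->]; rewrite tnegK.
  by field.
under eq_bigr do rewrite E.
rewrite big_split /= -!mulr_sumr !delta_fr incube_tneg hA.
by field.
Qed.

Lemma int_tsum_sin N A B n : (forall m, B (tneg m) = - B m) ->
  \int[T]_x (tsum N A B x * sin (phase n x)) = (incube N n)%:R * B n.
Proof.
move=> hB; under eq_Rintegral do rewrite mulrC.
rewrite int_mul_tsum; last exact: bdm_sinphase.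
have E f : A (@fr N f) * \int[T]_x (sin (phase n x) * cos (phase (fr f) x)) +
    B (fr f) * \int[T]_x (sin (phase n x) * sin (phase (fr f) x)) =
    2^-1 * ((fr f == n)%:R * B (fr f)) - 2^-1 * ((fr f == tneg n)%:R * B (fr f)).
  rewrite int_sinsin int_sincos mulr0 add0r [n == _]eq_sym.
  have -> : (n == tneg (fr f)) = (fr f == tneg n).
    by apply/eqP/eqP => [->|->]; rewrite tnegK.
  by field.
under eq_bigr do rewrite E.
rewrite sumrB /= -!mulr_sumr !delta_fr incube_tneg hB.
by field.
Qed.

Local Open Scope complex_scope.

Lemma cis_prod (I : finType) (a : I -> R) :
  \prod_i (cos (a i) +i* sin (a i)) = cos (\sum_i a i) +i* sin (\sum_i a i) :> R[i].
Proof.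
have H : forall r : seq I, \prod_(i <- r) (cos (a i) +i* sin (a i)) =
    cos (\sum_(i <- r) a i) +i* sin (\sum_(i <- r) a i) :> R[i].
  elim=> [|i r IH]; first by rewrite !big_nil cos0 sin0.
  rewrite !big_cons IH cosD sinD; apply/eqP; rewrite eq_complex /=.
  by apply/andP; split; apply/eqP; ring.
exact: H.
Qed.

Lemma cosum_complex N (c : nat -> R) (x : R) :
  \sum_(i < N.*2.+1) ((c `|i%:Z - N%:Z|%N)%:C *
    (cos ((i%:Z - N%:Z)%:~R * x) +i* sin ((i%:Z - N%:Z)%:~R * x))) =
  (cosum N.+1 c x)%:C :> R[i].
Proof.
rewrite (sym_sum N (fun k : int => (c `|k|%N)%:C * (cos (k%:~R * x) +i* sin (k%:~R * x)))).
rewrite /cosum big_ord_recl rmorphD rmorph_sum; congr (_ + _).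
  rewrite mulr0z mul0r cos0 sin0; apply/eqP; rewrite eq_complex /= /ek /= ?mul0r ?cos0.
  by apply/andP; split; apply/eqP; ring.
apply: eq_bigr => k _ /=.
rewrite /ek /= mulrNz mulNr cosN sinN /bump leq0n add1n.
by apply/eqP; rewrite eq_complex /=; apply/andP; split; apply/eqP; ring.
Qed.

(** The product is expanded on complex exponentials, where a product of characters is a single
    character; the real part is taken at the end. *)
Lemma cosum_prod N (c : 'I_d -> nat -> R) (t : 'I_d -> R) :
  \prod_j cosum N.+1 (c j) (2 * pi * t j) =
  \sum_(f : idx N) (\prod_j c j `|tnth (fr f) j|%N) *
    cos (2 * pi * \sum_j (tnth (fr f) j)%:~R * t j).
Proof.
pose F j (i : 'I_N.*2.+1) : R[i] := (c j `|i%:Z - N%:Z|%N)%:C *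
    (cos ((i%:Z - N%:Z)%:~R * (2 * pi * t j)) +i* sin ((i%:Z - N%:Z)%:~R * (2 * pi * t j))).
have E : \prod_j (cosum N.+1 (c j) (2 * pi * t j))%:C =
    \sum_(f : idx N) \prod_j F j (f j) :> R[i].
  by rewrite -bigA_distr_bigA; apply: eq_bigr => j _; rewrite cosum_complex.
have {E} := congr1 (@complex.Re R) E.
rewrite -rmorph_prod /= => ->.
rewrite raddf_sum; apply: eq_bigr => f _ /=.
rewrite /F big_split /= -rmorph_prod cis_prod /=.
rewrite mul0r subr0; congr (_ * cos _).
  by apply: eq_bigr => j _; rewrite tnth_mktuple.
rewrite mulr_sumr; apply: eq_bigr => j _; rewrite tnth_mktuple; ring.
Qed.

End Cube.

(** * Continuous periodic functions and product Fejer kernels *)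

Section Continuous.
Variables (R : realType) (d : nat).
Implicit Types (g h : d.-tuple R -> R) (x y : d.-tuple R).

Lemma tcontinuous_dist g x (e : R) : tcontinuous g -> 0 < e ->
  exists2 delta : R, 0 < delta &
    forall y, (forall j, `|tnth x j - tnth y j| < delta) -> `|g x - g y| < e.
Proof.
move=> gc e0; pose v : 'rV[R]_d := \row_j tnth x j.
have xE : [tuple v ord0 j | j < d] = x.
  by apply/eq_from_tnth => j; rewrite tnth_mktuple mxE.
have := gc v => /cvgrPdist_lt/(_ _ e0) /nbhs_ballP [delta /= d0 H].
exists delta => // y hy.
have yE : [tuple (\row_j tnth y j : 'rV[R]_d) ord0 j | j < d] = y.
  by apply/eq_from_tnth => j; rewrite tnth_mktuple mxE.
have /H : ball v delta (\row_j tnth y j : 'rV[R]_d).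
  by split => // i j; rewrite !mxE; exact: hy.
by rewrite /= xE yE.
Qed.

Lemma periodic_bounded g : Zperiodic g -> tcontinuous g ->
  exists M : R, forall x, `|g x| <= M.
Proof.
move=> gp gc.
pose A := [set v : 'rV[R]_d | forall i, `[0, 1]%classic (v ord0 i)].
have cA : compact A.
  by apply: (@rV_compact R d (fun=> `[0, 1]%classic)) => i; exact: segment_compact.
have /compact_bounded [M [_ HM]] : compact
    ((fun v : 'rV[R]_d => g [tuple v ord0 j | j < d]) @` A).
  by apply: continuous_compact cA; exact: continuous_subspaceT.
exists (M + 1) => x.
pose n : d.-tuple int := [tuple - Num.floor (tnth x j) | j < d].
rewrite -(gp x n); apply: HM; first by rewrite ltrDl.
exists (\row_j (tnth x j + (tnth n j)%:~R)).
  move=> j /=; rewrite mxE tnth_mktuple in_itv /= mulrNz subr_ge0 Num.Theory.floor_le /=.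
  by rewrite lerBlDr addrC ltW // -[1]/(1%:~R) -intrD Num.Theory.floorD1_gt.
by congr (g _); apply/eq_from_tnth => j; rewrite !tnth_mktuple mxE tnth_mktuple.
Qed.

(** Continuity lives on row vectors and the sigma-algebra on tuples. The bridge is sampling: [g] at
    the lower corner of the grid cell of mesh 1 / (k + 1) takes countably many values and converges
    to [g]. *)
Lemma tcontinuous_measurable g : tcontinuous g -> measurable_fun setT g.
Proof.
move=> gc.
pose r (k : nat) (n : d.-tuple int) : d.-tuple R :=
  [tuple (tnth n j)%:~R / k.+1%:R | j < d].
pose fl (k : nat) x : d.-tuple int := [tuple Num.floor (k.+1%:R * tnth x j) | j < d].
apply: (@measurable_fun_cvg _ _ _ _ (fun k x => g (r k (fl k x)))).
- move=> k _ Y mY; rewrite setTI.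
  have -> : (fun x => g (r k (fl k x))) @^-1` Y =
      \bigcup_n [set x | fl k x = n /\ Y (g (r k n))].
    apply/seteqP; split => [x Yx|x [n _ [<- //]]].
    by exists (fl k x).
  apply: countable_bigcupT_measurable => [|n]; first exact: countableP.
  have [Yn|Yn] := pselect (Y (g (r k n))); last first.
    by rewrite (_ : [set _ | _] = set0) //; apply/seteqP; split => // x [].
  rewrite (_ : [set _ | _] = \bigcap_(j in [set: 'I_d])
      ((fun x => tnth x j) @^-1`
        [set t | (tnth n j)%:~R <= k.+1%:R * t < (tnth n j + 1)%:~R])); last first.
    apply/seteqP; split => [x [<- _] j _ /=|x H /=].
      by rewrite tnth_mktuple Num.Theory.floor_le Num.Theory.floorD1_gt.
    split => //; apply/eq_from_tnth => j; rewrite tnth_mktuple.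
    by apply: Num.Theory.floor_def; exact: H.
  apply: fin_bigcap_measurable => // j _.
  rewrite -[X in measurable X]setTI; apply: measurable_tnth => //.
  rewrite (_ : [set _ | _] = `[(tnth n j)%:~R / k.+1%:R, (tnth n j + 1)%:~R / k.+1%:R[%classic).
    exact: measurable_itv.
  apply/seteqP; split => t /=; rewrite in_itv /= ler_pdivrMr ?ltr0n // ltr_pdivlMr ?ltr0n //;
    by rewrite [t * _]mulrC.
- move=> x _; apply/cvgrPdist_lt => e e0.
  have [delta d0 H] := tcontinuous_dist x gc e0.
  near=> k; apply: H => j; rewrite !tnth_mktuple.
  have k0 : (0 : R) < k.+1%:R by rewrite ltr0n.
  have h1 := Num.Theory.floor_le (k.+1%:R * tnth x j).
  have h2 := Num.Theory.floorD1_gt (k.+1%:R * tnth x j).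
  set z := Num.floor _ in h1 h2 *.
  have E : tnth x j - z%:~R / k.+1%:R = (k.+1%:R * tnth x j - z%:~R) / k.+1%:R.
    by field; rewrite addrC natr1 gt_eqF.
  rewrite E ger0_norm; last by rewrite divr_ge0 ?subr_ge0 // ltW.
  apply: lt_trans (_ : k.+1%:R^-1 < delta).
    by rewrite -[ltRHS]mul1r ltr_pM2r ?invr_gt0 // ltrBlDr addrC -[1]/(1%:~R) -intrD.
  near: k; have := @cvg_harmonic R => /cvgr0Pnorm_lt/(_ _ d0).
  by apply: filterS => k; rewrite /= ger0_norm // invr_ge0.
Unshelve. all: by end_near. Qed.

Lemma periodic_bdm g : Zperiodic g -> tcontinuous g -> bdm g.
Proof.
by move=> gp gc; split; [exact: tcontinuous_measurable | exact: periodic_bounded].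
Qed.

Definition wprod N (n : d.-tuple int) : R := \prod_(j < d) fw R N.+1 `|tnth n j|%N.

Lemma wprod_tneg N n : wprod N (tneg n) = wprod N n.
Proof. by apply: eq_bigr => j _; rewrite tnth_mktuple abszN. Qed.

Definition fejer N y x : R :=
  tsum N (fun n => wprod N n * cos (phase n y)) (fun n => wprod N n * sin (phase n y)) x.

Lemma fejerE N y x : fejer N y x =
  \prod_j cosum N.+1 (fw R N.+1) (2 * pi * (tnth x j - tnth y j)).
Proof.
rewrite (cosum_prod N (fun=> fw R N.+1) (fun j => tnth x j - tnth y j)).
apply: eq_bigr => f _; rewrite -[X in X + _]mulrA -[X in _ + X]mulrA -mulrDr; congr (_ * _).
rewrite [RHS](_ : _ = cos (phase (fr f) x - phase (fr f) y)); last first.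
  rewrite /phase -mulrBr -sumrB; congr (cos (_ * _)).
  by apply: eq_bigr => j _; rewrite mulrBr.
by rewrite cosB; ring.
Qed.

Lemma fejer_kernel_ge0 N y x : 0 <= fejer N y x.
Proof. by rewrite fejerE; apply: prodr_ge0 => j _; exact: fejer_ge0. Qed.

Lemma fejer_even N y m :
  wprod N (tneg m) * cos (phase (tneg m) y) = wprod N m * cos (phase m y).
Proof. by rewrite wprod_tneg phaseN cosN. Qed.

Lemma fejer_odd N y m :
  wprod N (tneg m) * sin (phase (tneg m) y) = - (wprod N m * sin (phase m y)).
Proof. by rewrite wprod_tneg phaseN sinN mulrN. Qed.

Local Notation T := (torus R d).

Lemma bdm_fejer N y : bdm (fejer N y).
Proof. exact: bdm_tsum. Qed.

Lemma int_fejer_shift N y n : incube N n ->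
  \int[T]_x (fejer N y x * cos (phase n x - phase n y)) = wprod N n.
Proof.
move=> hn.
have E x : fejer N y x * cos (phase n x - phase n y) =
    cos (phase n y) * (fejer N y x * cos (phase n x)) +
    sin (phase n y) * (fejer N y x * sin (phase n x)).
  by rewrite cosB; ring.
under eq_Rintegral do rewrite E.
have bc := bdmM (bdm_fejer N y) (bdm_cosphase R n).
have bs := bdmM (bdm_fejer N y) (bdm_sinphase R n).
rewrite IntD; [|exact: bdmZ|exact: bdmZ]; rewrite !IntZ // /fejer.
rewrite int_tsum_cos; last exact: fejer_even.
rewrite int_tsum_sin; last exact: fejer_odd.
rewrite hn -[true%:R]/(1 : R) [LHS](_ : _ = wprod N n * (cos (phase n y) ^+ 2 + sin (phase n y) ^+ 2)).
  by rewrite cos2Dsin2 mulr1.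
by rewrite !mul1r; ring.
Qed.

Definition tunit (j : 'I_d) : d.-tuple int := [tuple (i == j)%:Z | i < d].

Lemma phase_tunit j x : phase (tunit j) x = 2 * pi * tnth x j.
Proof.
rewrite /phase (bigD1 j) //= tnth_mktuple eqxx mul1r big1 ?addr0 // => i ne.
by rewrite tnth_mktuple (negbTE ne) mul0r.
Qed.

Lemma int_fejer N y : \int[T]_x fejer N y x = 1.
Proof.
pose z : d.-tuple int := [tuple 0 | j < d].
have pz x : phase z x = 0.
  by rewrite /phase big1 ?mulr0 // => j _; rewrite tnth_mktuple mul0r.
have hz : incube N z by apply/forallP => j; rewrite tnth_mktuple.
have := int_fejer_shift y hz.
under eq_Rintegral do rewrite !pz subr0 cos0 mulr1.
move=> ->; rewrite /wprod big1 // => j _; rewrite tnth_mktuple; exact: fw0.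
Qed.

(** The defect 1 / (N + 1) is the Fejer mean of 1 - cos (2 pi (x_j - y_j)). *)
Lemma wprod_tunit N j : (0 < N)%N -> wprod N (tunit j) = 1 - N.+1%:R^-1.
Proof.
move=> N0; rewrite /wprod (bigD1 j) //= tnth_mktuple eqxx big1 ?mulr1.
  by rewrite /fw ltnS N0 mul1r.
by move=> i ne; rewrite tnth_mktuple (negbTE ne); exact: fw0.
Qed.

Lemma cos_turn_le (delta u : R) : 0 < delta -> delta <= 2^-1 -> delta <= `|u| <= 2^-1 ->
  cos (2 * pi * u) <= cos (2 * pi * delta).
Proof.
move=> d0 d1 /andP[u0 u1]; have p0 := pi_gt0 R.
have -> : cos (2 * pi * u) = cos (2 * pi * `|u|).
  by rewrite -[LHS]cos_norm normrM [X in X * _]ger0_norm // mulr_ge0 // ltW.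
have h (t : R) : 0 < t -> t <= 2^-1 -> 2 * pi * t \in `[0, pi].
  move=> t0 t1; rewrite in_itv /= mulr_ge0 ?mulr_ge0 ?(ltW p0) ?(ltW t0) //=.
  rewrite mulrAC -[leRHS]mul1r ler_pM2r //; lra.
rewrite leNgt ltr_cos ?h //; last exact: lt_le_trans u0.
by rewrite -leNgt ler_pM2l // mulr_gt0.
Qed.

Lemma periodic_majorant h y : Zperiodic h -> tcontinuous h -> h y < 0 ->
  exists2 C : R, 0 <= C &
    forall x, h x <= h y / 2 + C * \sum_j (1 - cos (2 * pi * (tnth x j - tnth y j))).
Proof.
move=> hp hc hy.
have e0 : 0 < - h y / 2 by lra.
have [d1 d10 H1] := tcontinuous_dist y hc e0.
(* The cap 1/2 keeps 2 pi delta within [0, pi], where the cosine decreases. *)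
pose delta := Num.min d1 2^-1.
have delta0 : 0 < delta by rewrite lt_min d10 /= invr_gt0.
have delta1 : delta <= 2^-1 by rewrite ge_min lexx orbT.
have [M HM] := periodic_bounded hp hc.
have c0 : 0 < 1 - cos (2 * pi * delta).
  have p0 := pi_gt0 R.
  rewrite subr_gt0 -[ltRHS]cos0 ltr_cos ?mulr_gt0 //.
    by rewrite in_itv /= lexx ltW.
  rewrite in_itv /= ltW ?mulr_gt0 //= mulrAC -[leRHS]mul1r ler_pM2r //; lra.
have M0 : 0 <= M by exact: le_trans (HM y).
(* Chosen so that one coordinate at distance [delta] already lifts the right side to the bound [M]
   of [h]. *)
exists ((M - h y / 2) / (1 - cos (2 * pi * delta))).
  by rewrite divr_ge0 ?(ltW c0) //; lra.
move=> x; set C := (M - _) / _.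
have C0 : 0 <= C by rewrite divr_ge0 ?(ltW c0) //; lra.
have terms j : 0 <= 1 - cos (2 * pi * (tnth x j - tnth y j)) by rewrite subr_ge0 cos_le1.
(* [u j] is the difference modulo 1, taken in [-1/2, 1/2]; by periodicity [x] may be moved to its
   translate nearest to [y]. *)
pose n j : int := Num.floor (tnth x j - tnth y j + 2^-1).
pose u j : R := tnth x j - tnth y j - (n j)%:~R.
have hu j : `|u j| <= 2^-1.
  have h1 := Num.Theory.floor_le (tnth x j - tnth y j + 2^-1).
  have h2 := Num.Theory.floorD1_gt (tnth x j - tnth y j + 2^-1).
  rewrite intrD in h2.
  by rewrite ler_norml /u /n; apply/andP; split; lra.
have [/forallP near|/forallPn [j far]] := boolP [forall j, `|u j| < delta].
  have hx : h x = h [tuple tnth x j + (tnth [tuple - n j | j < d] j)%:~R | j < d].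
    by rewrite hp.
  have := H1 [tuple tnth x j + (tnth [tuple - n j | j < d] j)%:~R | j < d].
  rewrite -hx => HH.
  have : `|h y - h x| < - h y / 2.
    apply: HH => j; rewrite !tnth_mktuple mulrNz.
    have := near j; rewrite /u distrC lt_min => /andP[+ _].
    rewrite (_ : tnth y j - (tnth x j - (n j)%:~R) = (n j)%:~R - (tnth x j - tnth y j)) //.
    by ring.
  rewrite ltr_norml => /andP[h1 h2].
  have : 0 <= C * \sum_j (1 - cos (2 * pi * (tnth x j - tnth y j))).
    by rewrite mulr_ge0 // sumr_ge0.
  lra.
rewrite -leNgt in far.
have E : cos (2 * pi * (tnth x j - tnth y j)) = cos (2 * pi * u j).
  rewrite /u; move: (tnth x j - tnth y j) (n j) => t k.
  by rewrite mulrBr cosB cos_intpi sin_intpi; ring.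
have big : 1 - cos (2 * pi * delta) <= \sum_j (1 - cos (2 * pi * (tnth x j - tnth y j))).
  rewrite (bigD1 j) //= -[leLHS]addr0 lerD ?sumr_ge0 // lerB // E.
  by apply: cos_turn_le => //; rewrite far hu.
have : C * (1 - cos (2 * pi * delta)) <= C * \sum_j (1 - cos (2 * pi * (tnth x j - tnth y j))).
  by rewrite ler_wpM2l.
rewrite {1}/C divfK ?gt_eqF // => hC.
have := HM x; rewrite ler_norml => /andP[_ hx]; lra.
Qed.

(* Korovkin: if [h y < 0], then [h] lies below [h y / 2] plus a multiple of
   [sum_j (1 - cos (2 pi (x_j - y_j)))], whose Fejer means at [y] tend to 0. *)
Lemma fejer_pos h : Zperiodic h -> tcontinuous h ->
  (forall N y, 0 <= \int[T]_x (h x * fejer N y x)) -> forall y, 0 <= h y.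
Proof.
move=> hp hc H y; rewrite leNgt; apply/negP => hy.
have [C C0 HC] := periodic_majorant hp hc hy.
have bh := periodic_bdm hp hc.
have key N : (0 < N)%N -> 0 <= h y / 2 + C * (d%:R * N.+1%:R^-1).
  move=> N0; apply: le_trans (H N y) _.
  have bK := bdm_fejer N y.
  have bt j : bdm (fun x => fejer N y x * cos (phase (tunit j) x - phase (tunit j) y)).
    have E x : cos (phase (tunit j) x - phase (tunit j) y) =
        cos (phase (tunit j) y) * cos (phase (tunit j) x) +
        sin (phase (tunit j) y) * sin (phase (tunit j) x) by rewrite cosB; ring.
    by under eq_fun do rewrite E; apply: bdmM => //; exact: bdm_tterm.
  pose S x := \sum_(j < d) (fejer N y x -
     fejer N y x * cos (phase (tunit j) x - phase (tunit j) y)).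
  have bS : bdm S by apply: bdm_sum => j; exact: bdmB.
  have le x : h x * fejer N y x <= h y / 2 * fejer N y x + C * S x.
    apply: le_trans (ler_wpM2r (fejer_kernel_ge0 N y x) (HC x)) _.
    rewrite mulrDl -[C * _ * _]mulrA lerD2l ler_wpM2l // mulr_suml; apply: ler_sum => j _.
    rewrite !phase_tunit -mulrBr; rewrite le_eqVlt; apply/orP; left; apply/eqP; ring.
  apply: (le_trans (le_Int T (bdmM bh bK) _ le)).
    by apply: bdmD; exact: bdmZ.
  rewrite IntD; [|exact: bdmZ|exact: bdmZ].
  rewrite !IntZ // int_fejer mulr1 lerD2l ler_wpM2l //.
  rewrite Int_sum => [|j]; last exact: bdmB.
  rewrite (eq_bigr (fun=> N.+1%:R^-1)) => [|j _].
    by rewrite sumr_const card_ord mulr_natl.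
  rewrite IntB // int_fejer int_fejer_shift ?wprod_tunit //; first by ring.
  apply/forallP => i; rewrite tnth_mktuple; by case: (i == j).
have cv : (fun N => h y / 2 + C * (d%:R * harmonic N)) @ \oo --> (h y / 2 + C * (d%:R * 0) : R).
  apply: cvgD; first exact: cvg_cst.
  by do 2 apply: cvgMr; exact: cvg_harmonic.
rewrite !mulr0 addr0 in cv.
have : 0 <= h y / 2.
  apply: (ler_cvg_to (cvg_cst _) cv); near=> N.
  apply: key; near: N; by exists 1%N.
lra.
Unshelve. all: by end_near. Qed.

End Continuous.

(** * Product inequalities behind Selberg's combination *)

Section Weierstrass.
Variable R : realFieldType.

(** The upper bound is carried along for the induction step, which uses (1 - r_i) (1 - P) >= 0 with
    [P] the product of the other factors. *)
Lemma weierstrass_prod (I : Type) (s : seq I) (r : I -> R) :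
  (forall i, 0 <= r i <= 1) ->
  1 - \sum_(i <- s) (1 - r i) <= \prod_(i <- s) r i <= 1.
Proof.
move=> H; elim: s => [|i s /andP[IH1 IH2]]; first by rewrite !big_nil subr0 lexx.
rewrite !big_cons; have /andP[r0 r1] := H i; set S := \sum_(i <- s) _ in IH1 *.
have P0 : 0 <= \prod_(i <- s) r i by apply: prodr_ge0 => j _; case/andP: (H j).
set P := \prod_(i <- s) _ in IH1 IH2 P0 *.
have h1 : 0 <= (1 - r i) * (1 - P) by rewrite mulr_ge0 // subr_ge0.
by apply/andP; split; nra.
Qed.

Lemma prod_update (I : finType) (j : I) (l m : I -> R) : m j != 0 ->
  \prod_i (if i == j then l i else m i) = l j / m j * \prod_i m i.
Proof.
move=> mj; rewrite (bigD1 j) //= eqxx [in RHS](bigD1 j) //= mulrA divfK //.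
by congr (_ * _); apply: eq_bigr => i /negbTE ->.
Qed.

(** Divided by the product of the [m i], this is [weierstrass_prod] for r_i = p_i / m_i; replacing
    p_j by the smaller l_j in the subtracted sum only helps, whatever the sign of [l j]. *)
Lemma selberg_combination (d : nat) (p l m : 'I_d -> R) :
  (forall i, 0 < p i) -> (forall i, l i <= p i <= m i) ->
  0 <= \prod_i p i - \sum_j \prod_i (if i == j then l i else m i) +
       (d%:R - 1) * \prod_i m i.
Proof.
move=> p0 H; have m0 i : 0 < m i by apply: lt_le_trans (p0 i) _; case/andP: (H i).
pose r i := p i / m i.
have r01 i : 0 <= r i <= 1.
  by rewrite /r divr_ge0 ?(ltW (p0 i)) ?(ltW (m0 i)) //= ler_pdivrMr // mul1r; case/andP: (H i).
have /andP[W _] := weierstrass_prod (index_enum 'I_d) r01.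
have P0 : 0 < \prod_i m i by apply: prodr_gt0.
have -> : \prod_i p i = (\prod_i r i) * \prod_i m i.
  by rewrite -big_split; apply: eq_bigr => i _; rewrite /= divfK // gt_eqF.
have -> : \sum_j \prod_i (if i == j then l i else m i) = (\sum_j l j / m j) * \prod_i m i.
  by rewrite mulr_suml; apply: eq_bigr => j _; rewrite prod_update // gt_eqF.
rewrite -mulrBl -mulrDl; apply: mulr_ge0; last exact: ltW.
have : \sum_j l j / m j <= \sum_j r j.
  by apply: ler_sum => j _; rewrite ler_pM2r ?invr_gt0 //; case/andP: (H j).
move: W; rewrite sumrB sumr_const card_ord -[1 *+ d]/(d%:R); lra.
Qed.

(* The density with factors [u], [w] is [1 - P + D]; a step of the induction
   compares [u D - w P] for the two families. *)
Lemma selberg_density_mono (I : Type) (s : seq I) (u w u' w' : I -> R) :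
  (forall i, 1 <= u' i <= u i) -> (forall i, 0 <= w i <= w' i) ->
  (forall i, w' i <= 1) ->
  let P := \prod_(i <- s) u i in let P' := \prod_(i <- s) u' i in
  let D := P * \sum_(i <- s) (1 - w i / u i) in
  let D' := P' * \sum_(i <- s) (1 - w' i / u' i) in
  [/\ 0 <= P' <= P, 0 <= D' & P - P' <= D - D'].
Proof.
move=> Hu Hw Hw1; elim: s => [|i s]; first by rewrite /= !big_nil; split; lra.
rewrite /= !big_cons.
set P := \prod_(i <- s) u i; set P' := \prod_(i <- s) u' i.
set S := \sum_(i <- s) (1 - w i / u i); set S' := \sum_(i <- s) (1 - w' i / u' i).
move=> [/andP[P0 PP] D0 DD].
have /andP[u1 uu] := Hu i; have /andP[w0 ww] := Hw i; have w1 := Hw1 i.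
have up : u i != 0 by rewrite gt_eqF //; lra.
have up' : u' i != 0 by rewrite gt_eqF //; lra.
have -> : u i * P * (1 - w i / u i + S) = u i * (P * S) + (u i - w i) * P by field.
have -> : u' i * P' * (1 - w' i / u' i + S') = u' i * (P' * S') + (u' i - w' i) * P' by field.
set D := P * S in DD *; set D' := P' * S' in D0 DD *.
have h1 : u' i * P' <= u i * P by rewrite ler_pM //; lra.
have h2 : 0 <= u' i * P' by rewrite mulr_ge0 //; lra.
have h3 : 0 <= u' i * D' by rewrite mulr_ge0 //; lra.
have h4 : 0 <= (u' i - w' i) * P' by rewrite mulr_ge0 //; lra.
have h5 : 0 <= (u i - u' i) * D' by rewrite mulr_ge0 //; lra.
have h6 : 0 <= u i * (D - D' - (P - P')) by rewrite mulr_ge0 //; lra.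
have h7 : 0 <= (u i - w i) * (P - P') by rewrite mulr_ge0 //; lra.
have h8 : 0 <= (w' i - w i) * P' by rewrite mulr_ge0 //; lra.
split; [by rewrite h2 h1 | by rewrite addr_ge0 | nra].
Qed.

End Weierstrass.

(** * Densities in lambda and the coefficients F_lambda *)

Section Densities.
Variables (R : realType) (d : nat).
Implicit Types (l : d.-tuple R) (n : d.-tuple int) (a b : d.-tuple int).

Definition an n (j : 'I_d) : nat := `|tnth n j|%N.

Lemma sq_an n j : (an n j ^ 2)%:R = (tnth n j)%:~R ^+ 2 :> R.
Proof. by rewrite natrX /an natr_absz intr_norm real_normK // num_real. Qed.

(** The nome of the j-th variable: the Gaussian transform at [k] is [lamfac l] times the product of
    the q_j^(k_j^2), and Theta(v; i a_j^2 / lambda_j) has nome q_j^(a_j^2). *)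
Definition qv l (j : 'I_d) : R := expR (- pi / tnth l j).

Definition lamfac l : R := \prod_(j < d) (tnth l j `^ (- 2^-1)).

Lemma lamfac_ge0 l : 0 <= lamfac l.
Proof. by apply: prodr_ge0 => j _; exact: powR_ge0. Qed.

Lemma qv_gt0 l j : 0 < qv l j.
Proof. exact: expR_gt0. Qed.

Lemma qv_lt1 l j : Lambda R d l -> qv l j < 1.
Proof.
move=> /(_ j) lj; rewrite /qv -expR0 ltr_expR mulNr oppr_lt0.
by rewrite divr_gt0 // pi_gt0.
Qed.

Lemma qvX l j (k : nat) : qv l j ^+ k = expR (- pi * k%:R / tnth l j).
Proof. by rewrite /qv -expRM_natl -mulr_natl; congr expR; ring. Qed.

Local Open Scope complex_scope.

(** The condition on the cosines covers [v = 0] with [eps = 1] and [v = 1/2] with [eps = -1]. The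
    symmetric partial sums fold onto the one-sided series [th]. *)
Lemma Re_Theta (v t eps : R) : eps = 1 \/ eps = -1 ->
  (forall k : nat, cos (2 * pi * k%:R * v) = eps ^+ k) -> 0 < t ->
  complex.Re (Theta v%:C (0 +i* t)) = th eps (expR (- pi * t)).
Proof.
move=> heps hv t0; pose f (n : int) : R[i] := cexp ((0 +i* (- (2 * pi * n%:~R))) * v%:C) *
    cexp ((0 +i* (pi * n%:~R ^+ 2)) * (0 +i* t)).
have -> : Theta v%:C (0 +i* t) = int_series f by [].
rewrite /int_series /=.
have Ref (n : int) : complex.Re (f n) = cos (2 * pi * n%:~R * v) * expR (- (pi * t * n%:~R ^+ 2)).
  rewrite /f /cexp /= !(mul0r, mulr0, subr0, addr0, add0r, sub0r, sin0, cos0, expR0, mul1r, mulr1).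
  rewrite oppr0 expR0 mul1r mulNr cosN; congr (_ * expR (- _)); ring.
have q0 : 0 < expR (- pi * t) by exact: expR_gt0.
have q1 : expR (- pi * t) < 1.
  by rewrite -[ltRHS]expR0 ltr_expR mulNr oppr_lt0 mulr_gt0 // pi_gt0.
apply: cvg_lim => //; have cv := cvg_th heps q0 q1.
rewrite -(cvg_shiftS (series _)) in cv; apply: cvg_trans cv.
apply: near_eq_cvg; near=> N.
rewrite big_mkord [RHS](_ : _ = \sum_(i < N.*2.+1) complex.Re (f (i%:Z - N%:Z)));
  last exact: raddf_sum.
rewrite (eq_bigr _ (fun i _ => Ref _)).
rewrite (sym_sum N (fun n : int => cos (2 * pi * n%:~R * v) * expR (- (pi * t * n%:~R ^+ 2)))).
rewrite /series /= big_mkord big_ord_recl; congr (_ + _).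
  by rewrite !(mul0r, mulr0) mulr0z expr0n /= !(mul0r, mulr0) oppr0 cos0 expR0 /ek !mulr1.
apply: eq_bigr => k _; rewrite lift0 mulrNz !(mulrN, mulNr) cosN sqrrN -pmulrn hv ekS.
rewrite -expRM_natl -[in RHS]mulrDl mulrA -mulr2n -[_ *+ 2]mulr_natl; congr (_ * expR _).
  by ring.
by rewrite natrX; ring.
Unshelve. all: by end_near. Qed.

Local Close Scope complex_scope.

Lemma an_pos a j : positive_index a -> (0 < an a j)%N.
Proof. by move=> /(_ j); rewrite /an; lia. Qed.

Lemma theta_at0 a l j : positive_index a -> Lambda R d l ->
  theta_at a l 0 j = th 1 (qv l j ^+ (an a j ^ 2)).
Proof.
move=> ha hl; have lj := hl j; rewrite /theta_at (@Re_Theta _ _ 1).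
- by rewrite (qvX l j) sq_an mulrA.
- by left.
- by move=> k; rewrite mulr0 cos0 expr1n.
- by rewrite divr_gt0 // exprn_gt0 // ltr0z; have := ha j; lia.
Qed.

Lemma theta_at_half a l j : positive_index a -> Lambda R d l ->
  theta_at a l 2^-1 j = th (-1) (qv l j ^+ (an a j ^ 2)).
Proof.
move=> ha hl; have lj := hl j; rewrite /theta_at (@Re_Theta _ _ (-1)).
- by rewrite (qvX l j) sq_an mulrA.
- by right.
- move=> k; have := cos_natpi k (0 : R); rewrite cos0 mulr1 add0r => <-.
  by congr cos; field.
- by rewrite divr_gt0 // exprn_gt0 // ltr0z; have := ha j; lia.
Qed.

Lemma qvX_itv a l j : positive_index a -> Lambda R d l ->
  0 < qv l j ^+ (an a j ^ 2) < 1.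
Proof.
move=> ha hl; rewrite exprn_gt0 ?qv_gt0 //= exprn_ilt1 ?ltW ?qv_gt0 ?qv_lt1 //.
by have := an_pos j ha; case: (an a j).
Qed.

(** The form 1 - P + D to which [selberg_density_mono] applies. *)
Lemma minorant_densityE a l : minorant_density a l =
  (1 - \prod_j theta_at a l 0 j +
   \prod_j theta_at a l 0 j * \sum_j (1 - theta_at a l 2^-1 j / theta_at a l 0 j)) * lamfac l.
Proof.
rewrite /minorant_density -/(lamfac l); congr (_ * _).
by rewrite sumrB sumr_const card_ord -[1 *+ d]/(d%:R); ring.
Qed.

(** Enlarging the index lowers every nome q^(a^2): Theta at 0 decreases but stays above 1, Theta at
    1/2 increases but stays below 1. *)
Lemma minorant_density_anti a b l : positive_index a ->
  (forall j, tnth a j <= tnth b j) -> Lambda R d l ->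
  minorant_density b l <= minorant_density a l.
Proof.
move=> ha hab hl.
have hb : positive_index b by move=> j; exact: le_trans (ha j) (hab j).
rewrite !minorant_densityE ler_wpM2r ?lamfac_ge0 //.
have ab j : (an a j <= an b j)%N by have := ha j; have := hab j; rewrite /an; lia.
have qle j : qv l j ^+ (an b j ^ 2) <= qv l j ^+ (an a j ^ 2).
  by rewrite ler_wiXn2l ?(ltW (qv_gt0 _ _)) ?(ltW (qv_lt1 _ hl)) // leq_exp2r.
have := @selberg_density_mono R _ (index_enum 'I_d)
  (fun j => theta_at a l 0 j) (fun j => theta_at a l 2^-1 j)
  (fun j => theta_at b l 0 j) (fun j => theta_at b l 2^-1 j).
case.
- move=> j; rewrite !theta_at0 //.
  have /andP[? ?] := qvX_itv j ha hl; have /andP[? ?] := qvX_itv j hb hl.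
  by rewrite th1_ge1 // th1_homo.
- move=> j; rewrite !theta_at_half //.
  have /andP[? ?] := qvX_itv j ha hl; have /andP[? ?] := qvX_itv j hb hl.
  rewrite thN1_anti // andbT.
  by have /andP[] : 0 <= th (-1) (qv l j ^+ (an a j ^ 2)) <= 1 by exact: thN1_itv.
- move=> j; rewrite theta_at_half //.
  have /andP[? ?] := qvX_itv j hb hl.
  by have /andP[] : 0 <= th (-1) (qv l j ^+ (an b j ^ 2)) <= 1 by exact: thN1_itv.
move=> _ _; lra.
Qed.

(* Combination of one-variable coefficient sequences [p], [l], [m] along
   [prod p - sum_j l_j prod_(i != j) m_i + (d - 1) prod m]. *)
Definition selberg (p l m : 'I_d -> R) : R :=
  \prod_i p i - \sum_j \prod_i (if i == j then l i else m i) + (d%:R - 1) * \prod_i m i.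

(* [Fhat a l] are the Fourier coefficients of the periodized Gaussian of
   parameter [l] minus its Selberg minorant of degree [a]. *)
Definition Fhat a l n : R := lamfac l *
  selberg (fun i => qv l i ^+ (an n i ^ 2))
          (fun i => ext_coef (-1) (qv l i) (an a i) (an n i))
          (fun i => ext_coef 1 (qv l i) (an a i) (an n i)).

Lemma an_tneg n j : an (tneg n) j = an n j.
Proof. by rewrite /an tnth_mktuple abszN. Qed.

Lemma Fhat_tneg a l n : Fhat a l (tneg n) = Fhat a l n.
Proof.
by rewrite /Fhat; congr (_ * selberg _ _ _); apply/funext => i; rewrite an_tneg.
Qed.

(** Every product in the two corrective terms has a factor of index [j0], and an interpolant of
    degree below [an a j0] has no coefficient at [an n j0]. *)
Lemma Fhat_out a l n : positive_index a -> (exists j, tnth a j <= `|tnth n j|) ->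
  Fhat a l n = gauss_hat l n.
Proof.
move=> ha [j0 hj]; have aj : (0 < an a j0 <= an n j0)%N.
  by rewrite an_pos //=; move: hj; have := ha j0; rewrite /an; lia.
rewrite /Fhat /selberg.
have -> : \prod_i ext_coef 1 (qv l i) (an a i) (an n i) = 0.
  by apply/eqP; rewrite prodf_seq_eq0; apply/hasP; exists j0;
    rewrite ?mem_index_enum //= ext_coef_ge.
have -> : \sum_j \prod_i (if i == j then ext_coef (-1) (qv l i) (an a i) (an n i)
    else ext_coef 1 (qv l i) (an a i) (an n i)) = 0.
  rewrite big1 // => j _; apply/eqP; rewrite prodf_seq_eq0; apply/hasP; exists j0;
    rewrite ?mem_index_enum //=.
  by case: ifP => _; rewrite ext_coef_ge.
rewrite mulr0 addr0 subr0 /gauss_hat big_split /=; congr (_ * _).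
by apply: eq_bigr => j _; rewrite (qvX l j) sq_an.
Qed.

Definition tzero : d.-tuple int := [tuple 0 | j < d].

Lemma Fhat0 a l : positive_index a -> Lambda R d l ->
  Fhat a l tzero = minorant_density a l.
Proof.
move=> ha hl; rewrite /Fhat /selberg.
have z i : an tzero i = 0%N by rewrite /an tnth_mktuple.
have hm : (-1 = 1 :> R) \/ (-1 = -1 :> R) by right.
have hp : (1 = 1 :> R) \/ (1 = -1 :> R) by left.
have E0 i : ext_coef 1 (qv l i) (an a i) (an tzero i) = theta_at a l 0 i.
  by rewrite z ext_coef0 ?theta_at0 ?qv_gt0 ?qv_lt1 ?an_pos.
have Eh i : ext_coef (-1) (qv l i) (an a i) (an tzero i) = theta_at a l 2^-1 i.
  by rewrite z ext_coef0 ?theta_at_half ?qv_gt0 ?qv_lt1 ?an_pos.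
under [X in X - _]eq_bigr do rewrite z expr0.
rewrite big1 //.
under [X in _ - X + _]eq_bigr do under eq_bigr do rewrite E0 Eh.
under [X in _ + _ * X]eq_bigr do rewrite E0.
rewrite mulrC /minorant_density -/(lamfac l); congr (_ * _).
have -> : \sum_j \prod_i (if i == j then theta_at a l 2^-1 i else theta_at a l 0 i) =
    (\sum_j theta_at a l 2^-1 j / theta_at a l 0 j) * \prod_i theta_at a l 0 i.
  rewrite mulr_suml; apply: eq_bigr => j _; rewrite prod_update //.
  have /andP[? ?] := qvX_itv j ha hl.
  by rewrite theta_at0 // gt_eqF // (lt_le_trans ltr01) // th1_ge1.
ring.
Qed.

(* The truncation of [Fhat] in which the theta function is replaced by the
   normalized finite Jacobi product [jpoly]. *)
Definition FhatM a l M n : R :=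
  selberg (fun i => qv l i ^+ (an n i ^ 2) * jb (qv l i) M (an n i))
          (fun i => interp_coef (-1) (qv l i) (an a i) M (an n i))
          (fun i => interp_coef 1 (qv l i) (an a i) M (an n i)).

Lemma cvg_FhatM a l n : positive_index a -> Lambda R d l ->
  (fun M => lamfac l * FhatM a l M n) @ \oo --> Fhat a l n.
Proof.
move=> ha hl.
have hm : (-1 = 1 :> R) \/ (-1 = -1 :> R) by right.
have hp : (1 = 1 :> R) \/ (1 = -1 :> R) by left.
have q0 i := qv_gt0 l i; have q1 i := qv_lt1 i hl.
apply: cvgMr; apply: cvgD; first apply: cvgB.
- apply: cvg_bigprod => i _.
  rewrite -[X in _ --> X]mulr1; apply: cvgMr; exact: cvg_jb.
- apply: cvg_bigsum => j _; apply: cvg_bigprod => i _.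
  by case: ifP => _; exact: cvg_interp_coef.
- by apply: cvgMr; apply: cvg_bigprod => i _; exact: cvg_interp_coef.
Qed.

Lemma horner_cosum K (c : nat -> R) x :
  (\sum_(k < K) (ek R k * c k) *: cheb R k).[cos x] = cosum K c x.
Proof.
by rewrite horner_sum; apply: eq_bigr => k _; rewrite hornerZ cheb_cos.
Qed.

(** The sum regroups into [selberg] of the one-variable values at the coordinates of [x], where
    [selberg_combination] applies; [K] is large enough for no coefficient to be cut off. *)
Lemma FhatM_sum_ge0 a l M K x : positive_index a -> Lambda R d l -> (M <= K)%N ->
  (forall j, an a j <= K)%N -> 0 <= tsum K (FhatM a l M) (fun=> 0) x.
Proof.
move=> ha hl MK aK; have q0 i := qv_gt0 l i; have q1 i := qv_lt1 i hl.
pose t (j : 'I_d) := 2 * pi * tnth x j.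
pose pp (i : 'I_d) k := qv l i ^+ (k ^ 2) * jb (qv l i) M k.
pose cl (i : 'I_d) k := interp_coef (-1) (qv l i) (an a i) M k.
pose cm (i : 'I_d) k := interp_coef 1 (qv l i) (an a i) M k.
have -> : tsum K (FhatM a l M) (fun=> 0) x = selberg (fun i => cosum K.+1 (pp i) (t i))
    (fun i => cosum K.+1 (cl i) (t i)) (fun i => cosum K.+1 (cm i) (t i)).
  rewrite /selberg /t (cosum_prod K pp) (cosum_prod K cm).
  rewrite [X in _ - X + _](_ : _ = \sum_j \sum_(f : idx d K)
     (\prod_i (if i == j then cl i (an (fr f) i) else cm i (an (fr f) i))) *
        cos (2 * pi * \sum_j (tnth (fr f) j)%:~R * tnth x j)); last first.
    apply: eq_bigr => j _.
    transitivity (\prod_i cosum K.+1 ((fun i => if i == j then cl i else cm i) i)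
        (2 * pi * tnth x i)).
      by apply: eq_bigr => i _ /=; case: ifP.
    rewrite cosum_prod.
    by apply: eq_bigr => f _; congr (_ * _); apply: eq_bigr => i _; case: ifP.
  rewrite exchange_big /= mulr_sumr -sumrB -big_split; apply: eq_bigr => f _.
  rewrite mul0r addr0 /FhatM /selberg /= -mulr_suml mulrA -mulrBl -mulrDl.
  by congr (_ * _).
have aN i : exists N, an a i = N.+1 by have := an_pos i ha; case: (an a i) => // N; exists N.
have Ep i : cosum K.+1 (pp i) (t i) = (jpoly (qv l i) M).[cos (t i)].
  rewrite (@cosum_extend R M.+1) //; last first.
    by move=> k hk; rewrite /pp /jb jG_gt // mul0r mulr0.
  by rewrite jpolyE -(horner_cosum _ (pp i)).
have hm : (-1 = 1 :> R) \/ (-1 = -1 :> R) by right.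
have hp : (1 = 1 :> R) \/ (1 = -1 :> R) by left.
have El eps i : cosum K.+1 (fun k => interp_coef eps (qv l i) (an a i) M k) (t i) =
    (interp eps (qv l i) (an a i) M).[cos (t i)].
  rewrite (@cosum_extend R (an a i)) //; last first.
  - by move=> k hk; rewrite interp_coef_ge // an_pos.
  - exact: leqW.
  by rewrite /interp horner_cosum.
apply: selberg_combination => i.
- rewrite Ep /jpoly hornerZ mulr_gt0 ?invr_gt0 ?jG_gt0 //.
  by apply: jprod_gt0 => //; exact: cos_geN1.
- rewrite Ep /cl /cm !El; have [N ->] := aN i.
  apply/andP; split.
    have [s s0 ->] := jpoly_interp hm N M (t i) (q0 i) (q1 i).
    by rewrite lerDl mulr_ge0 // subr_ge0 cos_geN1.
  have [s s0 ->] := jpoly_interp hp N M (t i) (q0 i) (q1 i).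
  by rewrite gerDl mulr_ge0_le0 // subr_le0 cos_le1.
Qed.

(** At finite [M], and up to [lamfac], the sum is by orthogonality the mean of a product of two
    nonnegative trigonometric polynomials. [N] stays fixed while [M] grows, so the limit is taken in
    a finite sum. *)
Lemma Fhat_pairing_ge0 a l N (A B : d.-tuple int -> R) :
  positive_index a -> Lambda R d l -> (forall x, 0 <= tsum N A B x) ->
  0 <= \sum_(f : idx d N) A (fr f) * Fhat a l (fr f).
Proof.
move=> ha hl pos.
have cv : (fun M => \sum_(f : idx d N) A (fr f) * (lamfac l * FhatM a l M (fr f))) @ \oo -->
    \sum_(f : idx d N) A (fr f) * Fhat a l (fr f).
  by apply: cvg_bigsum => f _; apply: cvgMr; exact: cvg_FhatM.
apply: (ler_cvg_to (cvg_cst _) cv); near=> M.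
(* A cube holding the tested frequencies, those of the Jacobi products and those of the
   interpolants. *)
pose K := (N + M + \sum_j an a j)%N.
have aK j : (an a j <= K)%N by rewrite /K (bigD1 j) //=; lia.
have MK : (M <= K)%N by rewrite /K; lia.
have F0 x := FhatM_sum_ge0 x ha hl MK aK.
have H : 0 <= \int[torus R d]_x (tsum K (FhatM a l M) (fun=> 0) x * tsum N A B x).
  by apply: Rintegral_ge0 => x _; rewrite mulr_ge0.
rewrite int_mul_tsum in H; last exact: bdm_tsum.
have E f : A (@fr d N f) * \int[torus R d]_x (tsum K (FhatM a l M) (fun=> 0) x * cos (phase (fr f) x)) +
   B (fr f) * \int[torus R d]_x (tsum K (FhatM a l M) (fun=> 0) x * sin (phase (fr f) x)) =
   A (fr f) * FhatM a l M (fr f).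
  rewrite int_tsum_cos; last first.
    by move=> m; rewrite /FhatM; congr (selberg _ _ _); apply/funext => i; rewrite an_tneg.
  rewrite int_tsum_sin; last by move=> m; rewrite oppr0.
  have -> : incube K (fr f).
    apply/forallP => j; have /forallP/(_ j) := incube_fr f; rewrite /K; lia.
  by rewrite mul1r mulr0 mulr0 addr0.
have {}H : 0 <= \sum_(f : idx d N) A (fr f) * FhatM a l M (fr f).
  by move: H; under eq_bigr do rewrite E.
under eq_bigr do rewrite mulrCA.
by rewrite -mulr_sumr mulr_ge0 ?lamfac_ge0.
Unshelve. all: by end_near. Qed.

(** Pairing with the nonnegative polynomials 1 + cos and 1 - cos of the phase of [n] gives F(0) +
    F(n) >= 0 and F(0) - F(n) >= 0. *)
Lemma Fhat_bound a l n : positive_index a -> Lambda R d l ->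
  `|Fhat a l n| <= minorant_density a l.
Proof.
move=> ha hl; rewrite -Fhat0 //.
pose N := (\sum_j an n j)%N.
have hn : incube N n.
  by apply/forallP => j; rewrite /N (bigD1 j) //=; rewrite /an; lia.
have h0 : incube N tzero by apply/forallP => j; rewrite tnth_mktuple.
have key (s : R) : `|s| <= 1 -> 0 <= Fhat a l tzero + s * Fhat a l n.
  move=> s1.
  have := @Fhat_pairing_ge0 a l N (fun m => (m == tzero)%:R + s * (m == n)%:R) (fun=> 0) ha hl.
  have E (G : d.-tuple int -> R) : \sum_(f : idx d N)
     ((fr f == tzero)%:R + s * (fr f == n)%:R) * G (fr f) = G tzero + s * G n.
    under eq_bigr do rewrite mulrDl -mulrA.
    by rewrite big_split /= -mulr_sumr !delta_fr hn h0 !mul1r.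
  rewrite E; apply => x; rewrite /tsum.
  under eq_bigr do rewrite mul0r addr0.
  rewrite (E (fun m => cos (phase m x))).
  have -> : phase tzero x = 0 by rewrite /phase big1 ?mulr0 // => j _; rewrite tnth_mktuple mul0r.
  rewrite cos0; have : `|s * cos (phase n x)| <= 1 by rewrite normrM mulr_ile1 ?cos_max.
  by rewrite ler_norml => /andP[]; lra.
have h1 := key 1; have h2 := key (-1).
rewrite normrN normr1 lexx in h2; rewrite normr1 lexx in h1.
by rewrite ler_norml; have := h1 isT; have := h2 isT; lra.
Qed.

Lemma minorant_density_ge0 a l : positive_index a -> Lambda R d l ->
  0 <= minorant_density a l.
Proof.
by move=> ha hl; apply: le_trans (Fhat_bound tzero ha hl); exact: normr_ge0.
Qed.

Lemma Fhat_fejer_ge0 a l N y : positive_index a -> Lambda R d l ->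
  0 <= \sum_(f : idx d N) wprod R N (fr f) * cos (phase (fr f) y) * Fhat a l (fr f).
Proof.
by move=> ha hl; have := Fhat_pairing_ge0 ha hl (fejer_kernel_ge0 N y).
Qed.

Lemma measurable_Lambda : measurable (Lambda R d).
Proof.
have -> : Lambda R d = \bigcap_(j in [set: 'I_d]) ((fun l => tnth l j) @^-1` `]0, +oo[%classic).
  apply/seteqP; split => l /= H j; first by move=> _ /=; rewrite in_itv /= andbT; exact: H.
  by have := H j I; rewrite /= in_itv /= andbT.
apply: fin_bigcap_measurable => // j _.
rewrite -[X in measurable X]setTI; apply: measurable_tnth => //; exact: measurable_itv.
Qed.

Lemma measurable_qv j : measurable_fun (Lambda R d) (fun l => qv l j).
Proof.
apply: (@eq_measurable_fun _ _ _ _ _ (fun l : d.-tuple R => expR (- pi * (tnth l j `^ (-1))))).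
  move=> l; rewrite inE => hl; rewrite /qv powR_inv1 //; exact/ltW/hl.
apply: measurable_funTS; apply: measurableT_comp; first exact: measurable_expR.
apply: measurable_funM; first exact: measurable_cst.
exact: (measurableT_comp (@measurable_powR R (-1)) (@measurable_tnth _ _ _ j)).
Qed.

Lemma measurable_ext_coef (eps : R) (N r : nat) j : eps = 1 \/ eps = -1 ->
  measurable_fun (Lambda R d) (fun l => ext_coef eps (qv l j) N r).
Proof.
move=> heps.
apply: (@measurable_fun_cvg _ _ _ _
    (fun (n : nat) (l : d.-tuple R) => \sum_(0 <= k < n) qv l j ^+ (k ^ 2) * rho eps N k r)).
  move=> n; apply: measurable_sum => k; apply: measurable_funM; last exact: measurable_cst.
  by apply: measurable_funX; exact: measurable_qv.
move=> l hl; apply: geom_bound_cvg; apply: geom_bound_rho => //; [exact: qv_gt0 | exact: qv_lt1].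
Qed.

Lemma measurable_lamfac : measurable_fun (Lambda R d) (@lamfac).
Proof.
apply: measurable_funTS; apply: measurable_prod => j _.
exact: (measurableT_comp (@measurable_powR R (- 2^-1)) (@measurable_tnth _ _ _ j)).
Qed.

Lemma measurable_selberg (p l m : 'I_d -> d.-tuple R -> R) :
  (forall i, measurable_fun (Lambda R d) (p i)) ->
  (forall i, measurable_fun (Lambda R d) (l i)) ->
  (forall i, measurable_fun (Lambda R d) (m i)) ->
  measurable_fun (Lambda R d)
    (fun x => selberg (fun i => p i x) (fun i => l i x) (fun i => m i x)).
Proof.
move=> hp hl hm; apply: measurable_funD; first apply: measurable_funB.
- by apply: measurable_prod.
- apply: measurable_sum => j; apply: measurable_prod => i _; by case: (i == j).
- by apply: measurable_funM; [exact: measurable_cst | exact: measurable_prod].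
Qed.

Lemma measurable_Fhat a n : measurable_fun (Lambda R d) (fun l => Fhat a l n).
Proof.
apply: measurable_funM; first exact: measurable_lamfac.
apply: measurable_selberg => i.
- by apply: measurable_funX; exact: measurable_qv.
- by apply: measurable_ext_coef; right.
- by apply: measurable_ext_coef; left.
Qed.

Lemma measurable_minorant_density a : positive_index a ->
  measurable_fun (Lambda R d) (minorant_density a).
Proof.
move=> ha; apply: (@eq_measurable_fun _ _ _ _ _ (fun l => Fhat a l tzero)).
  by move=> l; rewrite inE => hl; rewrite Fhat0.
exact: measurable_Fhat.
Qed.

(* The lower bound is the limit of these densities, obtained by pairing with
   the dilated Fejer kernels. *)
Definition fejer_density a N l : R := lamfac l *
  (1 - \prod_j \sum_(m < N.+1) ek R m * (-1) ^+ m * fw R N.+1 m * qv l j ^+ ((an a j * m) ^ 2)).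

Lemma alternating_sum_le (u : nat -> R) (n : nat) : (forall k, 0 <= u k) ->
  (forall k, u k.+1 <= u k) -> 0 <= \sum_(k < n) (-1) ^+ k * u k <= u 0%N.
Proof.
move=> u0 u1; elim: n u u0 u1 => [|n IH] u u0 u1; first by rewrite big_ord0 lexx u0.
rewrite big_ord_recl expr0 mul1r (_ : \sum_(i < n) _ = - \sum_(k < n) (-1) ^+ k * u k.+1).
  have := IH (fun k => u k.+1) (fun k => u0 _) (fun k => u1 _).
  by case/andP => h1 h2; have := u1 0%N; have := u0 0%N; rewrite /=; lra.
by rewrite -sumrN; apply: eq_bigr => k _; rewrite lift0 exprS; ring.
Qed.

(** Each factor of the product is 1 - 2 S, where [S] is an alternating sum of decreasing terms in
    [0, 1]; hence 0 <= S <= 1 and the factor has absolute value at most 1. Fatou's lemma relies on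
    this sign. *)
Lemma fejer_density_ge0 a N l : Lambda R d l -> 0 <= fejer_density a N l.
Proof.
move=> hl; rewrite /fejer_density mulr_ge0 ?lamfac_ge0 // subr_ge0.
apply: le_trans (ler_norm _) _; rewrite normr_prod; apply: prodr_ile1 => j _.
rewrite normr_ge0 /=.
pose u m := fw R N.+1 m * qv l j ^+ ((an a j * m) ^ 2).
have q0 := ltW (qv_gt0 l j); have q1 := ltW (qv_lt1 j hl).
have u0 k : 0 <= u k by rewrite mulr_ge0 ?fw_ge0 // exprn_ge0.
have u1 k : u k.+1 <= u k.
  rewrite ler_pM ?fw_ge0 ?exprn_ge0 ?fw_anti // ler_wiXn2l //.
  by rewrite leq_exp2r // leq_mul2l leqnSn orbT.
have uz : u 0%N = 1 by rewrite /u fw0 // muln0 expr0 mulr1.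
have /andP[S0 S1] := @alternating_sum_le (fun k => u k.+1) N (fun k => u0 _) (fun k => u1 _).
rewrite big_ord_recl /= (_ : \sum_(i < N) _ = - (2 * \sum_(k < N) (-1) ^+ k * u k.+1)).
  rewrite /ek /= !mul1r -/(u 0%N) uz ler_norml.
  have := u1 0%N; rewrite uz; apply/implyP; move: S0 S1; lra.
rewrite mulr_sumr -sumrN; apply: eq_bigr => k _.
by rewrite /bump /= add1n /u /ek /= exprS; ring.
Qed.

End Densities.

(** * Fourier coefficients and real trigonometric polynomials *)

Section TrigPoly.
Local Open Scope complex_scope.
Variables (R : realType) (d : nat).
Implicit Types (g P : d.-tuple R -> R) (n m b : d.-tuple int) (x : d.-tuple R).

Local Notation T := (torus R d).

Definition fcos g n : R := \int[T]_x (g x * cos (phase n x)).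
Definition fsin g n : R := \int[T]_x (g x * sin (phase n x)).

Lemma Re_mul (u v : R[i]) :
  complex.Re (u * v) = complex.Re u * complex.Re v - complex.Im u * complex.Im v.
Proof. by case: u v => [a b] [c e]. Qed.

Lemma Im_mul (u v : R[i]) :
  complex.Im (u * v) = complex.Re u * complex.Im v + complex.Im u * complex.Re v.
Proof. by case: u v => [a b] [c e]. Qed.

Lemma Re_echar n x : complex.Re (echar n x) = cos (phase n x).
Proof. by rewrite /= expR0 mul1r mul0r subr0. Qed.

Lemma Im_echar n x : complex.Im (echar n x) = sin (phase n x).
Proof. by rewrite /= expR0 mul1r mul0r addr0. Qed.

Lemma Re_fourier g n : complex.Re (fourier g n) = fcos g n.
Proof.
apply: eq_Rintegral => x _; rewrite Re_mul (Re_echar (tneg n)) phaseN cosN.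
by rewrite mul0r subr0.
Qed.

Lemma Im_fourier g n : bdm g -> complex.Im (fourier g n) = - fsin g n.
Proof.
move=> bg; rewrite -mulN1r /fsin -IntZ; last by apply: bdmM => //; exact: bdm_sinphase.
apply: eq_Rintegral => x _; rewrite Im_mul (Im_echar (tneg n)) phaseN sinN.
by rewrite mul0r addr0 mulN1r mulrN.
Qed.

Definition inbox b n := [forall j : 'I_d, (an n j < an b j)%N].

Lemma freq_boxE b n : positive_index b -> freq_box b n <-> inbox b n.
Proof.
move=> hb; split => [H|/forallP H] .
  apply/forallP => /= j; have h1 : - tnth b j < tnth n j < tnth b j := H j.
  by have h2 : 1 <= tnth b j := hb j; rewrite /an; lia.
move=> j; have h1 : (an n j < an b j)%N := H j; move: h1.
have h2 : 1 <= tnth b j := hb j; rewrite /an => h1.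
have h3 : - tnth b j < tnth n j < tnth b j by lia.
exact: h3.
Qed.

Lemma inbox_tneg b n : inbox b (tneg n) = inbox b n.
Proof. by apply: eq_forallb => j; rewrite an_tneg. Qed.

Lemma inbox0 b : positive_index b -> inbox b (tzero d).
Proof. by move=> hb; apply/forallP => j; rewrite {1}/an tnth_mktuple an_pos. Qed.

Lemma inboxN b n : positive_index b -> ~~ inbox b n -> exists j, tnth b j <= `|tnth n j|.
Proof.
move=> hb /forallPn [j hj]; exists j; move: hj (hb j); rewrite /an; lia.
Qed.

Definition bsize b : nat := (\sum_j an b j)%N.

Lemma inbox_incube b n : inbox b n -> incube (bsize b) n.
Proof.
move=> /forallP H; apply/forallP => j; have := H j.
by rewrite /bsize (bigD1 j) //= /an; lia.
Qed.

Lemma sum_freq_box b N (F : d.-tuple int -> R[i]) : positive_index b ->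
  (forall n, inbox b n -> incube N n) ->
  \sum_(n \in freq_box b) F n = \sum_(f : idx d N | inbox b (fr f)) F (fr f).
Proof.
move=> hb hN.
rewrite (@fsbigE _ _ _ _ _ [seq fr f | f <- enum (idx d N) & inbox b (fr f)]).
- rewrite big_map big_filter_cond big_enum_cond /=; apply: eq_bigl => f.
  apply/andP/idP => [[] //|h]; split => //.
  by rewrite mem_set //; apply/freq_boxE.
- by rewrite map_inj_uniq; [rewrite filter_uniq // enum_uniq | move=> ? ?; exact: fr_inj].
- by move=> _ /mapP[f + ->]; rewrite mem_filter => /andP[h _]; apply/freq_boxE.
- move=> n /(freq_boxE _ hb) h /negP[]; have [f fE] := fr_surj (hN _ h).
  by apply/mapP; exists f; rewrite ?fE // mem_filter fE h mem_enum.
Qed.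

Lemma fcos_tneg g n : fcos g (tneg n) = fcos g n.
Proof. by apply: eq_Rintegral => x _; rewrite phaseN cosN. Qed.

Lemma fsin_tneg g n : bdm g -> fsin g (tneg n) = - fsin g n.
Proof.
move=> bg; rewrite -mulN1r /fsin -IntZ; last by apply: bdmM => //; exact: bdm_sinphase.
by apply: eq_Rintegral => x _; rewrite phaseN sinN mulN1r mulrN.
Qed.

Definition boxed b (A : d.-tuple int -> R) n : R := (inbox b n)%:R * A n.

Lemma Re_sum (I : Type) (r : seq I) (Q : pred I) (F : I -> R[i]) :
  complex.Re (\sum_(i <- r | Q i) F i) = \sum_(i <- r | Q i) complex.Re (F i).
Proof. exact: raddf_sum. Qed.

Lemma Im_sum (I : Type) (r : seq I) (Q : pred I) (F : I -> R[i]) :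
  complex.Im (\sum_(i <- r | Q i) F i) = \sum_(i <- r | Q i) complex.Im (F i).
Proof. exact: raddf_sum. Qed.

(** The imaginary part is left as it stands: turning it into [- fsin P] requires [P] bounded and
    measurable, which [trig_poly_bdm] deduces from this very formula. *)
Lemma trig_poly_Re b P x : positive_index b -> trig_poly b P ->
  P x = tsum (bsize b) (boxed b (fcos P))
    (boxed b (fun n => - complex.Im (fourier P n))) x.
Proof.
move=> hb hP; rewrite -[LHS]/(complex.Re (P x)%:C) hP.
rewrite (sum_freq_box _ hb (inbox_incube (b := b))) Re_sum /tsum big_mkcond.
apply: eq_bigr => f _; rewrite /boxed; case: ifP => _; last by rewrite !mul0r addr0.
by rewrite Re_mul Re_echar Im_echar Re_fourier !mul1r mulNr.
Qed.

Lemma trig_poly_bdm b P : positive_index b -> trig_poly b P -> bdm P.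
Proof.
move=> hb hP; have -> : P = tsum (bsize b) (boxed b (fcos P))
    (boxed b (fun n => - complex.Im (fourier P n))).
  by apply/funext => x; exact: trig_poly_Re.
exact: bdm_tsum.
Qed.

Lemma trig_poly_tsum b P : positive_index b -> trig_poly b P ->
  forall x, P x = tsum (bsize b) (boxed b (fcos P)) (boxed b (fsin P)) x.
Proof.
move=> hb hP x; rewrite (trig_poly_Re x hb hP); have bP := trig_poly_bdm hb hP.
by apply: eq_bigr => f _; rewrite /boxed Im_fourier // opprK.
Qed.

Lemma tsum_trig_poly b (A B : d.-tuple int -> R) : positive_index b ->
  (forall n, A (tneg n) = A n) -> (forall n, B (tneg n) = - B n) ->
  trig_poly b (tsum (bsize b) (boxed b A) (boxed b B)).
Proof.
move=> hb hA hB x.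
have bA n : boxed b A (tneg n) = boxed b A n by rewrite /boxed inbox_tneg hA.
have bB n : boxed b B (tneg n) = - boxed b B n by rewrite /boxed inbox_tneg hB mulrN.
rewrite (sum_freq_box _ hb (inbox_incube (b := b))).
have E (f : idx d (bsize b)) : inbox b (fr f) ->
    fourier (tsum (bsize b) (boxed b A) (boxed b B)) (fr f) * echar (fr f) x =
    (A (fr f) * cos (phase (fr f) x) + B (fr f) * sin (phase (fr f) x)) +i*
    (A (fr f) * sin (phase (fr f) x) - B (fr f) * cos (phase (fr f) x)).
  move=> h; apply/eqP; rewrite eq_complex (Re_mul (fourier _ _)) (Im_mul (fourier _ _)).
  rewrite Re_fourier Im_fourier; last exact: bdm_tsum.
  rewrite Re_echar Im_echar /fcos /fsin int_tsum_cos // int_tsum_sin //.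
  rewrite incube_fr /boxed h /=.
  by apply/andP; split; apply/eqP; ring.
rewrite (eq_bigr _ E); apply/eqP; rewrite eq_complex; apply/andP; split; apply/eqP.
  rewrite Re_sum /= /tsum [RHS]big_mkcond; apply: eq_bigr => f _ /=.
  by rewrite /boxed; case: ifP => _; rewrite ?mul1r // !mul0r addr0.
rewrite Im_sum /= big_mkcond /=.
pose G n := boxed b A n * sin (phase n x) - boxed b B n * cos (phase n x).
have GE : forall f : idx d (bsize b), (if inbox b (fr f) then
   A (fr f) * sin (phase (fr f) x) - B (fr f) * cos (phase (fr f) x) else 0) = G (fr f).
  by move=> f; rewrite /G /boxed; case: ifP => _; rewrite ?mul1r // !mul0r subr0.
rewrite (eq_bigr _ (fun f _ => GE f)).
(* The imaginary part is a sum of terms odd in the frequency over a symmetric cube, hence zero. *)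
have : \sum_(f : idx d (bsize b)) G (fr f) = - \sum_(f : idx d (bsize b)) G (fr f).
  rewrite -[LHS]sum_fr_tneg -sumrN; apply: eq_bigr => f _.
  by rewrite /G bA bB phaseN sinN cosN; ring.
by move: (\sum_f G (fr f)) => S; lra.
Qed.

Lemma tsum_periodic N (A B : d.-tuple int -> R) : Zperiodic (tsum N A B).
Proof.
move=> x m; apply: eq_bigr => f _.
have [k ->] : exists k : int, phase (fr f) [tuple tnth x j + (tnth m j)%:~R | j < d] =
    phase (fr f) x + 2 * pi * k%:~R.
  exists (\sum_j tnth (fr f) j * tnth m j).
  rewrite /phase -mulrDr; congr (_ * _); rewrite rmorph_sum -big_split.
  by apply: eq_bigr => j _; rewrite (tnth_mktuple (fun j => tnth x j + _)) mulrDr /= intrM.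
by rewrite cosD sinD cos_intpi sin_intpi !mulr0 !mulr1 subr0 addr0.
Qed.

Lemma continuous_bigsum (S : topologicalType) (I : Type) (r : seq I) (F : I -> S -> R) :
  (forall i, continuous (F i)) -> continuous (fun t => \sum_(i <- r) F i t).
Proof.
move=> H; elim: r => [|i r IH].
  by under eq_fun do rewrite big_nil; move=> t; exact: cvg_cst.
by under eq_fun do rewrite big_cons; move=> t; apply: cvgD; [exact: H | exact: IH].
Qed.

Lemma continuous_mull (S : topologicalType) (c : R) (F : S -> R) :
  continuous F -> continuous (fun t => c * F t).
Proof. by move=> H t; apply: cvgMr; exact: H. Qed.

Lemma tcontinuous_tsum N (A B : d.-tuple int -> R) : tcontinuous (tsum N A B).
Proof.
have cph n : continuous (fun v : 'rV[R]_d => phase n [tuple v ord0 j | j < d]).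
  have C : continuous (fun v : 'rV[R]_d => \sum_(j < d) (tnth n j)%:~R * v ord0 j).
    apply: continuous_bigsum => j; apply: continuous_mull.
    exact: (@coord_continuous R 1 d ord0 j).
  rewrite (_ : (fun v : 'rV[R]_d => _) =
     (fun v : 'rV[R]_d => 2 * pi * \sum_(j < d) (tnth n j)%:~R * v ord0 j)).
    exact: continuous_mull.
  apply/funext => v; congr (_ * _); apply: eq_bigr => j _.
  by rewrite (tnth_mktuple (fun j => v ord0 j)).
apply: (@continuous_bigsum 'rV[R]_d _ _ (fun f v =>
  A (fr f) * cos (phase (fr f) [tuple v ord0 j | j < d]) +
  B (fr f) * sin (phase (fr f) [tuple v ord0 j | j < d]))) => f.
have ccos : continuous (fun v : 'rV[R]_d => A (fr f) * cos (phase (fr f) [tuple v ord0 j | j < d])).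
  by apply: continuous_mull => v; apply: continuous_comp; [exact: cph | exact: continuous_cos].
have csin : continuous (fun v : 'rV[R]_d => B (fr f) * sin (phase (fr f) [tuple v ord0 j | j < d])).
  by apply: continuous_mull => v; apply: continuous_comp; [exact: cph | exact: continuous_sin].
by move=> v; exact: (continuousD (ccos v) (csin v)).
Qed.

Lemma tcontinuousB g P : tcontinuous g -> tcontinuous P ->
  tcontinuous (fun x => g x - P x).
Proof. by move=> cg cP v; exact: (cvgB (cg v) (cP v)). Qed.

Lemma ZperiodicB g P : Zperiodic g -> Zperiodic P -> Zperiodic (fun x => g x - P x).
Proof. by move=> pg pP x n; rewrite pg pP. Qed.

Lemma fcos0 g : fcos g (tzero d) = \int[T]_x g x.
Proof.
apply: eq_Rintegral => x _; rewrite (_ : phase _ x = 0) ?cos0 ?mulr1 //.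
by rewrite /phase big1 ?mulr0 // => j _; rewrite tnth_mktuple mul0r.
Qed.

End TrigPoly.

(** * Real-valued integrals against nu *)

Section Integration.
Local Open Scope complex_scope.
Variables (R : realType) (d : nat).
Variable nu : {measure set (d.-tuple R) -> \bar R}.
Implicit Types (f : d.-tuple R -> R).

Local Notation L := (Lambda R d).
Local Notation nint f := (nu.-integrable L (EFin \o f)).

Let mL := @measurable_Lambda R d.

Lemma J_fineK f : nint f -> (\int[nu]_(l in L) f l)%:E = (\int[nu]_(l in L) (f l)%:E)%E.
Proof. by move=> h; rewrite /Rintegral fineK //; exact: integrable_fin_num. Qed.

Lemma nint_ge0 f : measurable_fun L f -> (forall l, L l -> 0 <= f l) ->
  (\int[nu]_(l in L) (f l)%:E < +oo)%E -> nint f.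
Proof.
move=> mf f0 h; apply/integrableP; split; first exact/measurable_EFinP.
by under eq_integral => l /set_mem hl do rewrite gee0_abs ?lee_fin ?f0 //.
Qed.

Lemma nintZ (c : R) f : nint f -> nint (fun l => c * f l).
Proof.
move=> h; have := integrableZl mL c h; exact: eq_integrable.
Qed.

Lemma nint_sum (I : Type) (r : seq I) (P : pred I) (F : I -> d.-tuple R -> R) :
  (forall i, P i -> nint (F i)) -> nint (fun l => \sum_(i <- r | P i) F i l).
Proof.
move=> H; have := integrable_sum mL r H; apply: eq_integrable => // l _.
by rewrite /= sumEFin.
Qed.

Lemma J_sum (I : Type) (r : seq I) (P : pred I) (F : I -> d.-tuple R -> R) :
  (forall i, P i -> nint (F i)) ->
  \int[nu]_(l in L) (\sum_(i <- r | P i) F i l) =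
  \sum_(i <- r | P i) \int[nu]_(l in L) F i l.
Proof.
move=> H; elim: r => [|i r IH].
  under eq_Rintegral do rewrite big_nil; rewrite big_nil.
  by rewrite (Rintegral_cst nu mL) mul0r.
rewrite big_cons; under eq_Rintegral do rewrite big_cons.
case: ifP => Pi; last exact: IH.
rewrite RintegralD ?IH //; first exact: H.
exact: nint_sum.
Qed.

End Integration.

(** * Lower bound for the mean of g - P *)

Section LowerBound.
Variables (R : realType) (d : nat).
Implicit Types (a b n : d.-tuple int) (l x : d.-tuple R).

Definition dilw a N n : R := \prod_j dilfw R (an a j) N.+1 (an n j).

Definition dilsize a N : nat := (\sum_j an a j * N.+1)%N.

Lemma dilsize_ge a N j : (an a j * N.+1 <= dilsize a N)%N.
Proof. by rewrite /dilsize (bigD1 j) //= leq_addr. Qed.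

Lemma an_tzero j : an (tzero d) j = 0%N.
Proof. by rewrite /an tnth_mktuple. Qed.

Lemma dilw0 a N : dilw a N (tzero d) = 1.
Proof. by rewrite /dilw big1 // => j _; rewrite an_tzero dilfw0. Qed.

(** A nonzero frequency of the box has a coordinate of absolute value strictly between 0 and a_j,
    where the dilated weight vanishes. *)
Lemma dilw_box a N n : inbox a n -> dilw a N n = (n == tzero d)%:R.
Proof.
move=> /forallP hn; case: eqP => [->|ne]; first exact: dilw0.
have [j nj] : exists j, an n j != 0%N.
  apply/existsP; apply: contraPT (ne) => /existsPn H []; apply/eq_from_tnth => j.
  by have := H j; rewrite negbK /an absz_eq0 tnth_mktuple => /eqP.
apply/eqP; rewrite /dilw prodf_seq_eq0; apply/hasP; exists j; first by rewrite mem_index_enum.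
by rewrite /= dilfw_small // lt0n nj hn.
Qed.

Definition dilker a N x : R := tsum (dilsize a N) (dilw a N) (fun=> 0) x.

Lemma dilker_ge0 a N x : positive_index a -> 0 <= dilker a N x.
Proof.
move=> ha.
have -> : dilker a N x =
    \prod_j cosum (dilsize a N).+1 (dilfw R (an a j) N.+1) (2 * pi * tnth x j).
  rewrite (cosum_prod (dilsize a N) (fun j => dilfw R (an a j) N.+1)).
  by apply: eq_bigr => f _; rewrite mul0r addr0.
apply: prodr_ge0 => j _; rewrite (@cosum_extend R (an a j * N.+1)).
- exact: dilfw_ge0 (an_pos j ha).
- by apply: leqW; exact: dilsize_ge.
- by move=> k hk; rewrite dilfw_ge // an_pos.
Qed.

Lemma gauss_hatE l n : gauss_hat l n = lamfac l * \prod_j qv l j ^+ (an n j ^ 2).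
Proof.
rewrite /gauss_hat big_split /=; congr (_ * _).
by apply: eq_bigr => j _; rewrite (qvX l j) sq_an.
Qed.

Lemma gauss_hat_ge0 l n : 0 <= gauss_hat l n.
Proof.
by rewrite gauss_hatE mulr_ge0 ?lamfac_ge0 // prodr_ge0 // => j _; rewrite exprn_ge0 // ltW // qv_gt0.
Qed.

(** Expanding the product over the cube, the frequency 0 contributes 1 and cancels the leading 1 of
    the density. *)
Lemma fejer_densityE a N l : positive_index a -> fejer_density a N l =
  - \sum_(f : idx d (dilsize a N) | fr f != tzero d) dilw a N (fr f) * gauss_hat l (fr f).
Proof.
move=> ha; set K := dilsize a N.
pose c (j : 'I_d) k := dilfw R (an a j) N.+1 k * qv l j ^+ (k ^ 2).
have E : \prod_j (\sum_(m < N.+1) ek R m * (-1) ^+ m * fw R N.+1 m * qv l j ^+ ((an a j * m) ^ 2))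
    = \sum_(f : idx d K) dilw a N (fr f) * \prod_j qv l j ^+ (an (fr f) j ^ 2).
  transitivity (\prod_j cosum K.+1 (c j) (2 * pi * 0)).
    apply: eq_bigr => j _; rewrite mulr0 (@cosum_extend R (an a j * N.+1)); last first.
    - by move=> k hk; rewrite /c dilfw_ge ?mul0r // an_pos.
    - by apply: leqW; exact: dilsize_ge.
    have a0 := an_pos j ha.
    rewrite -(sum_multiples N.+1 (fun m => ek R m * (-1) ^+ m * fw R N.+1 m *
      qv l j ^+ ((an a j * m) ^ 2)) a0).
    apply: eq_bigr => k _; rewrite mulr0 cos0 mulr1 /c /dilfw.
    case: eqP => [h|]; last by rewrite mul0r mulr0.
    have kE : nat_of_ord k = (an a j * (k %/ an a j))%N.
      by rewrite {1}(divn_eq k (an a j)) h addn0 mulnC.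
    rewrite -kE; have -> : ek R (k %/ an a j) = ek R k.
      by rewrite /ek [in RHS]kE muln_eq0 [(an a j == 0)%N]eqn0Ngt a0.
    by rewrite !mulrA.
  rewrite (cosum_prod K c (fun=> 0)); apply: eq_bigr => f _.
  have -> : \sum_j (tnth (fr f) j)%:~R * 0 = 0 :> R by rewrite big1 // => j _; rewrite mulr0.
  by rewrite mulr0 cos0 mulr1 big_split.
have [f0 f0E] := @fr_surj d K (tzero d) (ltac:(by apply/forallP => j; rewrite tnth_mktuple)).
rewrite /fejer_density E (bigD1 f0) //= f0E dilw0 mul1r.
rewrite [X in 1 - (X + _)]big1; last by move=> j _; rewrite an_tzero expr0.
rewrite opprD addrA subrr add0r mulrN mulr_sumr; congr (- _).
apply: eq_big => [f|f _]; last by rewrite gauss_hatE; ring.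
by rewrite -f0E (inj_eq (@fr_inj d K)).
Qed.

Lemma measurable_gauss_hat n : measurable_fun (Lambda R d) (fun l => gauss_hat l n).
Proof.
apply: (@eq_measurable_fun _ _ _ _ _
    (fun l => lamfac l * \prod_j qv l j ^+ (an n j ^ 2))).
  by move=> l _; rewrite gauss_hatE.
apply: measurable_funM; first exact: measurable_lamfac.
by apply: measurable_prod => j _; apply: measurable_funX; exact: measurable_qv.
Qed.

Lemma measurable_fejer_density a N : positive_index a ->
  measurable_fun (Lambda R d) (fejer_density a N).
Proof.
move=> ha; apply: measurable_funM; first exact: measurable_lamfac.
apply: measurable_funB; first exact: measurable_cst.
apply: measurable_prod => j _; apply: measurable_sum => k.
apply: measurable_funM; first exact: measurable_cst.
by apply: measurable_funX; exact: measurable_qv.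
Qed.

Lemma cvg_fejer_density a l : positive_index a -> Lambda R d l ->
  (fun N => fejer_density a N l) @ \oo --> bound_density a l.
Proof.
move=> ha hl; apply: cvgMr; apply: cvgB; first exact: cvg_cst.
apply: cvg_bigprod => j _; rewrite theta_at_half //.
have hm : (-1 = 1 :> R) \/ (-1 = -1 :> R) by right.
have /andP[q0 q1] := qvX_itv j ha hl.
have H M k : 0 <= fw R M.+1 k <= 1.
  by rewrite fw_ge0 /= /fw; case: ifP => _ //; rewrite lerBlDr lerDl divr_ge0.
have cw k : (fun M => fw R M.+1 k) @ \oo --> (1 : R).
  by rewrite (cvg_shiftS (fun M => fw R M k)); exact: cvg_fw.
have := cvg_weighted_series (geom_bound_th hm q0 q1) H cw.
apply: cvg_trans; apply: near_eq_cvg; near=> N; apply: eq_bigr => k _.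
by rewrite -exprM -expnMn; ring.
Unshelve. all: by end_near. Qed.

Variable nu : {measure set (d.-tuple R) -> \bar R}.
Variable g : d.-tuple R -> R.
Hypotheses (bg : bdm g).

Local Notation L := (Lambda R d).
Local Notation nint f := (nu.-integrable L (EFin \o f)).
Local Notation T := (torus R d).

Variable a : d.-tuple int.
Hypothesis ha : positive_index a.
Hypothesis g_hat : forall k : d.-tuple int, (exists j : 'I_d, tnth a j <= `|tnth k j|) ->
   (complex.Re (fourier g k))%:E = (\int[nu]_(l in L) (gauss_hat l k)%:E)%E /\
   complex.Im (fourier g k) = 0.

(** The identity assumed for the coefficients of [g] carries integrability: the extended integral of
    a nonnegative function equals a real number. *)
Lemma nint_gauss n : ~~ inbox a n -> nint (fun l => gauss_hat l n).
Proof.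
move=> /(inboxN ha) /g_hat [E _]; apply: nint_ge0; first exact: measurable_gauss_hat.
  by move=> l _; exact: gauss_hat_ge0.
by rewrite -E ltry.
Qed.

Lemma fcos_gauss n : ~~ inbox a n -> fcos g n = \int[nu]_(l in L) gauss_hat l n.
Proof.
move=> hn; have /g_hat [E _] := inboxN ha hn; apply: EFin_inj.
by rewrite (J_fineK (nint_gauss hn)) -E Re_fourier.
Qed.

Lemma fsin_gauss n : ~~ inbox a n -> fsin g n = 0.
Proof.
by move=> /(inboxN ha) /g_hat [_]; rewrite Im_fourier // => /eqP; rewrite oppr_eq0 => /eqP.
Qed.

Lemma dilw_out N n : n != tzero d -> inbox a n -> dilw a N n = 0.
Proof. by move=> /negbTE n0 hn; rewrite dilw_box // n0. Qed.

Lemma nint_term N n : n != tzero d -> nint (fun l => dilw a N n * gauss_hat l n).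
Proof.
move=> n0; case: (boolP (inbox a n)) => hn; last by apply: nintZ; exact: nint_gauss.
under eq_fun do rewrite dilw_out // mul0r.
by apply: eq_integrable (integrable0 nu L) => //; exact: measurable_Lambda.
Qed.

(** Pairing [g - P] with [dilker] leaves its mean plus the coefficients of [g] outside the box,
    weighted by [dilw]. These are integrals of [gauss_hat], and their weighted sum is minus the
    integral of [fejer_density]. *)
Lemma fejer_density_le N P : trig_poly a P -> minorizes P g ->
  (\int[nu]_(l in L) (fejer_density a N l)%:E <= (\int[T]_x (g x - P x))%:E)%E.
Proof.
move=> hP gP; have bP := trig_poly_bdm ha hP.
have bV : bdm (dilker a N) by exact: bdm_tsum.
have H : 0 <= \int[T]_x ((g x - P x) * dilker a N x).
  by apply: Rintegral_ge0 => x _; rewrite mulr_ge0 ?dilker_ge0 // subr_ge0.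
rewrite int_mul_tsum in H; last exact: bdmB.
have fB n : \int[T]_x ((g x - P x) * cos (phase n x)) = fcos g n - fcos P n.
  rewrite -IntB; try by apply: bdmM => //; exact: bdm_cosphase.
  by apply: eq_Rintegral => x _; rewrite mulrBl.
have fP n : ~~ inbox a n -> fcos P n = 0.
  move=> hn; have PE := funext (trig_poly_tsum ha hP).
  transitivity (\int[T]_x (tsum (bsize a) (boxed a (fcos P)) (boxed a (fsin P)) x *
      cos (phase n x))); first by rewrite -PE.
  rewrite int_tsum_cos; last by move=> m; rewrite /boxed inbox_tneg fcos_tneg.
  by rewrite /boxed (negbTE hn) mul0r mulr0.
pose K := dilsize a N.
have S : \sum_(f : idx d K) dilw a N (fr f) * (fcos g (fr f) - fcos P (fr f)) =
    fcos g (tzero d) - fcos P (tzero d) +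
    \sum_(f : idx d K | fr f != tzero d) dilw a N (fr f) * fcos g (fr f).
  have [f0 f0E] := @fr_surj d K (tzero d) (ltac:(by apply/forallP => j; rewrite tnth_mktuple)).
  rewrite (bigD1 f0) //= f0E dilw0 mul1r; congr (_ + _).
  apply: eq_big => [f|f fn]; first by rewrite -f0E (inj_eq (@fr_inj d K)).
  have {}fn : fr f != tzero d by rewrite -f0E (inj_eq (@fr_inj d K)).
  case: (boolP (inbox a (fr f))) => hn; first by rewrite dilw_out // !mul0r.
  by rewrite fP // subr0.
have {}H : 0 <= fcos g (tzero d) - fcos P (tzero d) +
    \sum_(f : idx d K | fr f != tzero d) dilw a N (fr f) * fcos g (fr f).
  rewrite -S; apply: le_trans H _; rewrite le_eqVlt; apply/orP; left; apply/eqP.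
  by apply: eq_bigr => f _; rewrite fB mul0r addr0.
have I : nint (fun l => \sum_(f : idx d K | fr f != tzero d) dilw a N (fr f) * gauss_hat l (fr f)).
  by apply: nint_sum => f fn; exact: nint_term.
have J : \int[nu]_(l in L) (\sum_(f : idx d K | fr f != tzero d) dilw a N (fr f) * gauss_hat l (fr f))
    = \sum_(f : idx d K | fr f != tzero d) dilw a N (fr f) * fcos g (fr f).
  rewrite J_sum; last by move=> f fn; exact: nint_term.
  apply: eq_bigr => f fn; case: (boolP (inbox a (fr f))) => hn.
    rewrite dilw_out // mul0r; under eq_Rintegral do rewrite mul0r.
    by rewrite (Rintegral_cst nu (@measurable_Lambda R d)) mul0r.
  rewrite RintegralZl ?fcos_gauss //; [exact: measurable_Lambda | exact: nint_gauss].
under eq_integral do rewrite fejer_densityE // -mulN1r.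
rewrite -J_fineK; last exact: nintZ.
rewrite lee_fin RintegralZl //; last exact: measurable_Lambda.
by rewrite J IntB // -!fcos0; lra.
Qed.

Lemma bound_density_le P : trig_poly a P -> minorizes P g ->
  (\int[nu]_(l in L) (bound_density a l)%:E <= (\int[T]_x (g x - P x))%:E)%E.
Proof.
move=> hP gP.
pose u N l := (fejer_density a N l)%:E.
have F : (\int[nu]_(l in L) limn_einf (u^~ l) <= limn_einf (fun N => \int[nu]_(l in L) u N l))%E.
  apply: fatou => [|N|N l hl]; first exact: measurable_Lambda.
    by apply/measurable_EFinP; exact: measurable_fejer_density.
  by rewrite lee_fin fejer_density_ge0.
apply: (@le_trans _ _ (\int[nu]_(l in L) limn_einf (u^~ l))%E).
  rewrite le_eqVlt; apply/orP; left; apply/eqP; apply: eq_integral => l /set_mem hl.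
  have cv : u^~ l @ \oo --> (bound_density a l)%:E.
    by apply: cvg_EFin; [near=> N | exact: cvg_fejer_density].
  by rewrite (cvg_limn_einf_sup cv).1.
apply: (le_trans F).
rewrite limn_einf_lim; apply: lime_le; first exact: is_cvg_einfs.
near=> N; apply: le_trans (fejer_density_le N hP gP).
by apply: ge_ereal_inf; exists (\int[nu]_(l in L) u N l)%E => //; exists N => /=.
Unshelve. all: by end_near. Qed.
End LowerBound.

(** * Construction of the minorants and limit of their means *)

Section Minorant.
Variables (R : realType) (d : nat).
Variable nu : {measure set (d.-tuple R) -> \bar R}.
Variable g : d.-tuple R -> R.
Hypotheses (g_per : Zperiodic g) (g_cont : tcontinuous g).

Local Notation L := (Lambda R d).
Local Notation nint f := (nu.-integrable L (EFin \o f)).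
Local Notation T := (torus R d).

Let bg : bdm g := periodic_bdm g_per g_cont.

(** Serves the positive indices that do not dominate [a]; the polynomial is a constant below [g]. *)
Lemma const_minorant (b : d.-tuple int) : positive_index b ->
  exists2 P, trig_poly b P & minorizes P g.
Proof.
move=> hb; have [M HM] := periodic_bounded g_per g_cont.
pose A (n : d.-tuple int) : R := (n == tzero d)%:R * - M.
exists (tsum (bsize b) (boxed b A) (boxed b (fun=> 0))).
  apply: tsum_trig_poly => // n; last by rewrite oppr0.
  rewrite /A; congr (_%:R * _); congr nat_of_bool.
  have tz : tneg (tzero d) = tzero d.
    by apply/eq_from_tnth => j; rewrite !tnth_mktuple oppr0.
  by rewrite -{1}tz (inj_eq (inv_inj (@tnegK d))).
move=> x; have /ler_normlP[Mx _] := HM x.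
have -> : tsum (bsize b) (boxed b A) (boxed b (fun=> 0)) x = - M; last by lra.
transitivity (\sum_(f : idx d (bsize b)) (fr f == tzero d)%:R *
    (fun m => (inbox b m)%:R * (- M * cos (phase m x))) (fr f)).
  by rewrite /tsum; apply: eq_bigr => f _; rewrite /boxed /A; ring.
have -> := delta_fr (bsize b) (tzero d)
  (fun m => (inbox b m)%:R * (- M * cos (phase m x)) : R).
rewrite inbox0 // inbox_incube ?inbox0 // !mul1r.
rewrite (_ : phase _ x = 0) ?cos0 ?mulr1 //.
by rewrite /phase big1 ?mulr0 // => j _; rewrite tnth_mktuple mul0r.
Qed.

Variable a : d.-tuple int.
Hypothesis ha : positive_index a.
Hypothesis hnu : (\int[nu]_(l in L) (minorant_density a l)%:E < +oo)%E.
Hypothesis g_hat : forall k : d.-tuple int, (exists j : 'I_d, tnth a j <= `|tnth k j|) ->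
   (complex.Re (fourier g k))%:E = (\int[nu]_(l in L) (gauss_hat l k)%:E)%E /\
   complex.Im (fourier g k) = 0.

Section Index.
Variable b : d.-tuple int.
Hypothesis hab : forall j, tnth a j <= tnth b j.

Let hb : positive_index b.
Proof. by move=> j; exact: le_trans (ha j) (hab j). Qed.

(** Finiteness is assumed at [a] alone; [minorant_density_anti] carries it to every [b] above
    [a]. *)
Lemma nint_minorant : nint (minorant_density b).
Proof.
apply: nint_ge0; first exact: measurable_minorant_density.
  by move=> l hl; exact: minorant_density_ge0.
apply: le_lt_trans hnu; apply: ge0_le_integral.
- exact: measurable_Lambda.
- by move=> l hl; rewrite lee_fin minorant_density_ge0.
- by apply/measurable_EFinP; exact: measurable_minorant_density.
- by apply/measurable_EFinP; exact: measurable_minorant_density.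
- by move=> l hl; rewrite lee_fin minorant_density_anti.
Qed.

Lemma nint_Fhat n : nint (fun l => Fhat b l n).
Proof.
apply: (le_integrable (@measurable_Lambda R d) _ _ nint_minorant).
  by apply/measurable_EFinP; exact: measurable_Fhat.
move=> l hl /=; rewrite lee_fin [leRHS]ger0_norm ?minorant_density_ge0 //; exact: Fhat_bound.
Qed.

Definition Cint n : R := \int[nu]_(l in L) Fhat b l n.

Lemma Cint_tneg n : Cint (tneg n) = Cint n.
Proof. by apply: eq_Rintegral => l _; rewrite Fhat_tneg. Qed.

(** The coefficients [Cint] of the difference are real and even, so the sine part is copied from [g]
    unchanged. *)
Definition minorant : d.-tuple R -> R :=
  tsum (bsize b) (boxed b (fun n => fcos g n - Cint n)) (boxed b (fsin g)).

Lemma minorant_trig_poly : trig_poly b minorant.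
Proof.
apply: tsum_trig_poly => [|n|n]; first exact: hb.
  by rewrite fcos_tneg Cint_tneg.
exact: (fsin_tneg n bg).
Qed.

Let h x := g x - minorant x.

Let bh : bdm h.
Proof. by apply: bdmB => //; exact: bdm_tsum. Qed.

Lemma inbox_le n : ~~ inbox b n -> ~~ inbox a n.
Proof.
apply: contra => /forallP H; apply/forallP => j; apply: leq_trans (H j) _.
have h1 := ha j; have h2 : tnth a j <= tnth b j := hab j; rewrite /an; lia.
Qed.

(** Inside the box this holds by construction. Outside, [minorant] has no coefficient and [Fhat] is
    [gauss_hat], whose integral is the coefficient of [g]. *)
Lemma fcos_defect n : \int[T]_x (h x * cos (phase n x)) = Cint n.
Proof.
have bm : bdm minorant by exact: bdm_tsum.
have -> : \int[T]_x (h x * cos (phase n x)) = fcos g n - fcos minorant n.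
  rewrite -IntB; try by apply: bdmM => //; exact: bdm_cosphase.
  by apply: eq_Rintegral => x _; rewrite mulrBl.
rewrite /minorant {2}/fcos int_tsum_cos; last first.
  by move=> m; rewrite /boxed inbox_tneg fcos_tneg Cint_tneg.
rewrite /boxed; case: (boolP (inbox b n)) => hn.
  by rewrite inbox_incube // !mul1r opprB addrC subrK.
rewrite mul0r mulr0 subr0 (fcos_gauss ha g_hat (inbox_le hn)).
by apply: eq_Rintegral => l _; rewrite Fhat_out //; exact: inboxN.
Qed.

Lemma fsin_defect n : \int[T]_x (h x * sin (phase n x)) = 0.
Proof.
have bm : bdm minorant by exact: bdm_tsum.
have -> : \int[T]_x (h x * sin (phase n x)) = fsin g n - fsin minorant n.
  rewrite -IntB; try by apply: bdmM => //; exact: bdm_sinphase.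
  by apply: eq_Rintegral => x _; rewrite mulrBl.
rewrite /minorant {2}/fsin int_tsum_sin; last first.
  by move=> m; rewrite /boxed inbox_tneg fsin_tneg // mulrN.
rewrite /boxed; case: (boolP (inbox b n)) => hn.
  by rewrite inbox_incube // !mul1r subrr.
by rewrite mul0r mulr0 subr0 (fsin_gauss bg ha g_hat (inbox_le hn)).
Qed.

(** The Fejer means of [h] are finite combinations of the [Cint], hence integrals over lambda of the
    nonnegative sums in [Fhat_fejer_ge0]. *)
Lemma minorant_minorizes : minorizes minorant g.
Proof.
suff H : forall y, 0 <= h y by move=> y; rewrite -subr_ge0; exact: H.
apply: fejer_pos.
- by apply: ZperiodicB => //; exact: tsum_periodic.
- by apply: tcontinuousB => //; exact: tcontinuous_tsum.
move=> N y; rewrite int_mul_tsum //.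
have -> : \sum_(f : idx d N) (wprod R N (fr f) * cos (phase (fr f) y) *
      \int[T]_x (h x * cos (phase (fr f) x)) +
    wprod R N (fr f) * sin (phase (fr f) y) * \int[T]_x (h x * sin (phase (fr f) x))) =
  \int[nu]_(l in L) (\sum_(f : idx d N) wprod R N (fr f) * cos (phase (fr f) y) * Fhat b l (fr f)).
  rewrite J_sum; last by move=> f _; apply: nintZ; exact: nint_Fhat.
  apply: eq_bigr => f _; rewrite fcos_defect fsin_defect mulr0 addr0.
  by rewrite RintegralZl //; [exact: measurable_Lambda | exact: nint_Fhat].
by apply: Rintegral_ge0 => l hl; exact: Fhat_fejer_ge0.
Qed.

Lemma minorant_integral :
  (\int[T]_x (g x - minorant x))%:E = (\int[nu]_(l in L) (minorant_density b l)%:E)%E.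
Proof.
rewrite -(J_fineK nint_minorant) -[X in X%:E]fcos0; congr EFin.
rewrite /fcos fcos_defect; apply: eq_Rintegral => l /set_mem hl; exact: Fhat0.
Qed.

End Index.

(** The nomes tend to 0, so both theta values tend to 1, where 1 - P + D vanishes. *)
Lemma cvg_minorant_density (c : nat -> d.-tuple int) l : (forall n j, tnth (c n) j = n.+1%:Z) ->
  L l -> (fun n => minorant_density (c n) l) @ \oo --> (0 : R).
Proof.
move=> cE hl.
have hc n : positive_index (c n) by move=> j; rewrite cE.
have ac n j : an (c n) j = n.+1 by rewrite /an cE.
have thc eps j : eps = 1 \/ eps = -1 ->
    (fun n => th eps (qv l j ^+ (n.+1 ^ 2))) @ \oo --> (1 : R).
  move=> heps; have q0 := qv_gt0 l j; have q1 := qv_lt1 j hl.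
  have cq : (fun n => qv l j ^+ n.+1) @ \oo --> (0 : R).
    by rewrite (cvg_shiftS (fun n => qv l j ^+ n)); apply: cvg_expr; rewrite gtr0_norm.
  have cb : (fun n => 2 * qv l j ^+ n.+1 / (1 - qv l j)) @ \oo --> (0 : R).
    have -> : (0 : R) = 2 * 0 / (1 - qv l j) by rewrite mulr0 mul0r.
    by apply: cvgMl; apply: cvgMr.
  apply/cvgrPdist_le => e e0; have /cvgr0_norm_le/(_ e e0) H := cb; near=> n.
  have qn : 0 < qv l j ^+ (n.+1 ^ 2) < 1 by rewrite exprn_gt0 //= exprn_ilt1 // ltW.
  case/andP: qn => qn0 qn1; rewrite distrC (le_trans (th_near1 heps qn0 qn1)) //.
  have le1 : qv l j ^+ (n.+1 ^ 2) <= qv l j ^+ n.+1.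
    by rewrite ler_wiXn2l ?(ltW q0) ?(ltW q1) //; lia.
  have le2 : qv l j ^+ n.+1 <= qv l j.
    by rewrite -[leRHS]expr1 ler_wiXn2l ?(ltW q0) ?(ltW q1).
  apply: (@le_trans _ _ (2 * qv l j ^+ n.+1 / (1 - qv l j))).
    rewrite ler_pM ?mulr_ge0 ?ler_pM2l ?invr_ge0 ?subr_ge0 ?(ltW qn0) ?(ltW qn1) //.
    by rewrite lef_pV2 ?posrE ?subr_gt0 // lerB // (le_trans le1).
  apply: le_trans (ler_norm _) _; near: n; exact: H.
have c0 j : (fun n => theta_at (c n) l 0 j) @ \oo --> (1 : R).
  by under eq_fun do rewrite theta_at0 // ac; apply: thc; left.
have ch j : (fun n => theta_at (c n) l 2^-1 j) @ \oo --> (1 : R).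
  by under eq_fun do rewrite theta_at_half // ac; apply: thc; right.
have cP : (fun n => \prod_j theta_at (c n) l 0 j) @ \oo --> (\prod_(j < d) 1 : R).
  exact: cvg_bigprod.
have cS : (fun n => \sum_j (1 - theta_at (c n) l 2^-1 j / theta_at (c n) l 0 j)) @ \oo -->
    (\sum_(j < d) (1 - 1 / 1) : R).
  apply: cvg_bigsum => j _; apply: cvgB; first exact: cvg_cst.
  by apply: cvgM => //; apply: cvgV => //; rewrite oner_eq0.
have z : (1 - \prod_(j < d) 1 + \prod_(j < d) 1 * \sum_(j < d) (1 - 1 / 1)) * lamfac l = 0.
  by rewrite !big1 ?divr1 ?subrr // ?mulr0 ?addr0 ?mul0r // => j _; rewrite divr1 subrr.
pose F n := (1 - \prod_j theta_at (c n) l 0 j + \prod_j theta_at (c n) l 0 j *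
    \sum_j (1 - theta_at (c n) l 2^-1 j / theta_at (c n) l 0 j)) * lamfac l.
have -> : (fun n => minorant_density (c n) l) = F by apply/funext => n; exact: minorant_densityE.
have cF : F @ \oo -->
    (1 - \prod_(j < d) 1 + \prod_(j < d) 1 * \sum_(j < d) (1 - 1 / 1)) * lamfac l.
  by apply: cvgMl; apply: cvgD; [apply: cvgB => //; exact: cvg_cst | exact: cvgM].
by rewrite z in cF.
Unshelve. all: by end_near. Qed.

(** Dominated convergence runs along the diagonal indices, and any [b] above one of them inherits
    its bound by [minorant_density_anti]. The shift by [A] keeps the sequence above [a], whose
    density is the dominating function. *)
Lemma minorant_integral_small (e : R) : 0 < e -> exists N : int,
  forall b : d.-tuple int, (forall j, N <= tnth b j) ->
    (forall j, tnth a j <= tnth b j) /\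
    (\int[nu]_(l in L) (minorant_density b l)%:E < e%:E)%E.
Proof.
move=> e0.
pose A : nat := (\sum_j an a j)%N.
pose c n : d.-tuple int := [tuple n.+1%:Z | j < d].
have cE n j : tnth (c n) j = n.+1%:Z by rewrite tnth_mktuple.
have ac n : (A <= n)%N -> forall j, tnth a j <= tnth (c n) j.
  move=> An j; rewrite cE; have := ha j.
  have : (an a j <= A)%N by rewrite /A (bigD1 j) //= leq_addr.
  by rewrite /an; lia.
pose f n (l : d.-tuple R) := (minorant_density (c (n + A)%N) l)%:E.
have hcA n : positive_index (c (n + A)%N) by move=> j; rewrite cE.
have fl : (fun n => \int[nu]_(l in L) f n l)%E @ \oo --> 0%E.
  have -> : 0%E = (\int[nu]_(l in L) cst 0 l)%E :> \bar R by rewrite integral0.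
  have mf n : measurable_fun L (f n).
    by apply/measurable_EFinP; exact: measurable_minorant_density.
  have mz : measurable_fun L (cst 0%E : d.-tuple R -> \bar R) by exact: measurable_cst.
  have fz : {ae nu, forall l, L l -> f ^~ l @ \oo --> (cst 0%E l : \bar R)}.
    apply: aeW => l hl; apply: cvg_EFin; first by near=> n.
    by have := cvg_minorant_density cE hl; rewrite -(cvg_shiftn A).
  have fle : {ae nu, forall l n, L l -> (`|f n l| <= (EFin \o minorant_density a) l)%E}.
    apply: aeW => l n hl; rewrite /f lee_fin ger0_norm; last exact: minorant_density_ge0.
    by apply: minorant_density_anti => // j; apply: ac; rewrite leq_addl.
  have ig : nint (minorant_density a) by exact: nint_minorant.
  by have [_ _] := dominated_convergence (@measurable_Lambda R d) mf mz fz ig fle.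
have [n fn] : exists n, (\int[nu]_(l in L) f n l < e%:E)%E.
  have [] := fl [set x : \bar R | (x < e%:E)%E].
    by apply: open_nbhs_nbhs; split; [exact: open_ereal_lt_ereal | rewrite /= lte_fin].
  by move=> n _ /(_ n (leqnn n)); exists n.
exists (n + A).+1%:Z => b hN.
have hab j : tnth a j <= tnth b j.
  by apply: le_trans (hN j); rewrite -(cE _ j); apply: ac; rewrite leq_addl.
have hb : positive_index b by move=> j; exact: le_trans (ha j) (hab j).
split; [exact: hab | apply: le_lt_trans fn; apply: ge0_le_integral].
- exact: measurable_Lambda.
- by move=> l hl; rewrite lee_fin minorant_density_ge0.
- by apply/measurable_EFinP; exact: measurable_minorant_density.
- by apply/measurable_EFinP; exact: measurable_minorant_density.
- move=> l hl; rewrite lee_fin minorant_density_anti // => j; rewrite cE; exact: hN.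
Unshelve. all: by end_near. Qed.

End Minorant.

Local Open Scope complex_scope.

Theorem theorem17 (R : realType) (d : nat) (hd : (0 < d)%N)
    (a : d.-tuple int) (ha : positive_index a)
    (nu : {measure set (d.-tuple R) -> \bar R})
    (hnu : (\int[nu]_(l in Lambda R d) (minorant_density a l)%:E < +oo)%E)
    (g : d.-tuple R -> R) (g_per : Zperiodic g) (g_cont : tcontinuous g)
    (g_hat : forall k : d.-tuple int,
       (exists j : 'I_d, tnth a j <= `|tnth k j|) ->
       (complex.Re (fourier g k))%:E =
         (\int[nu]_(l in Lambda R d) (gauss_hat l k)%:E)%E /\
       complex.Im (fourier g k) = 0) :
  (forall P : d.-tuple R -> R, trig_poly a P -> minorizes P g ->
     (\int[nu]_(l in Lambda R d) (bound_density a l)%:E <=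
      (\int[torus R d]_x (g x - P x))%:E)%E) /\
  (exists L : d.-tuple int -> d.-tuple R -> R,
     [/\ forall b, positive_index b ->
           trig_poly b (L b) /\ minorizes (L b) g,
         forall b : d.-tuple int, (forall j : 'I_d, tnth a j <= tnth b j) ->
           (\int[torus R d]_x (g x - L b x))%:E =
           (\int[nu]_(l in Lambda R d) (minorant_density b l)%:E)%E &
         forall e : R, 0 < e -> exists N : int, forall b : d.-tuple int,
           (forall j : 'I_d, N <= tnth b j) ->
           `| \int[torus R d]_x (g x - L b x) | < e]).
Proof.
have bg := periodic_bdm g_per g_cont.
split; first by move=> P hP gP; exact: (bound_density_le bg ha g_hat hP gP).
(* An index above [a] receives the constructed minorant and any other positive index a constant; for
   the remaining ones both requirements are void and [g] is a dummy value. *)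
have ex b : exists P : d.-tuple R -> R,
    (positive_index b -> trig_poly b P /\ minorizes P g) /\
    ((forall j, tnth a j <= tnth b j) ->
      (\int[torus R d]_x (g x - P x))%:E = (\int[nu]_(l in Lambda R d) (minorant_density b l)%:E)%E).
  have [hab|hab] := pselect (forall j, tnth a j <= tnth b j).
    exists (minorant nu g b); split=> _; last by apply: (@minorant_integral _ _ _ _ _ _ a).
    by split; [exact: (minorant_trig_poly nu g_per g_cont ha hab)
              | exact: (minorant_minorizes g_per g_cont ha hnu g_hat hab)].
  have [hb|hb] := pselect (positive_index b).
    have [P hP gP] := const_minorant g_per g_cont hb.
    by exists P; split=> // /hab.
  by exists g; split=> [/hb|/hab].
have [L hL] := choice ex.
exists L; split=> [b hb|b hab|e e0]; [exact: (hL b).1 | exact: (hL b).2 |].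
have [N hN] := minorant_integral_small ha hnu e0.
exists N => b /hN [hab]; rewrite -(hL b).2 // lte_fin ger0_norm //.
apply: Rintegral_ge0 => x _; rewrite subr_ge0.
by apply: ((hL b).1 _).2 => j; exact: le_trans (ha j) (hab j).
Qed.
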